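(* Let $-1<\beta<\infty$, let $\varphi:\mathbb{D}\to\mathbb{D}$ be an analytic self-map and let $w\in H^\infty$. Suppose that there is an increasing sequence $(N_k)_{k\in\mathbb{N}}$ of positive integers such that $$\lim_{k\to\infty}\frac1{N_k}\sum_{j=1}^{N_k}\|w^{(j)}\|_2=0\quad\text{and}\quad\sup_{N\in\mathbb{N}}\frac1N\sum_{j=1}^N\|w^{(j)}\|_{\beta_2}=\infty.$$ Then the weighted composition operator $C_{w,\varphi}$ is densely mean Li--Yorke chaotic on both $H^2$ and $A^2_\beta$.
   Context: $\mathbb{D}$ is the open unit disk in $\mathbb{C}$, $\mathbb{T}$ the unit circle, $\mathbb{N}=\{1,2,\dots\}$, and $H^\infty$ the space of bounded analytic functions on $\mathbb{D}$. The weighted composition operator is $C_{w,\varphi}f=w\cdot(f\circ\varphi)$; it is bounded on the spaces below. $\varphi^n$ is the $n$-fold iterate of $\varphi$; $w^{(1)}=w$ and $w^{(n)}=(w\circ\varphi^{n-1})\cdots(w\circ\varphi)\cdot w$ for $n\ge2$. $H^2$ is the Hardy space of analytic $f$ on $\mathbb{D}$ with $\|f\|_2^2=\sup_{0<r<1}\int_{\mathbb{T}}|f(rz)|^2\,dm(z)<\infty$, with $m$ normalized Lebesgue measure on $\mathbb{T}$. $A^2_\beta$ is the weighted Bergman space of analytic $f$ on $\mathbb{D}$ with $\|f\|_{\beta_2}^2=\int_{\mathbb{D}}|f(z)|^2\,dA_\beta(z)<\infty$, where $dA_\beta(z)=(\beta+1)(1-|z|^2)^\beta\,dA(z)$ and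 $dA$ is normalized area measure on $\mathbb{D}$. A bounded operator $T$ on a Banach space $X$ is densely mean Li--Yorke chaotic if there is an uncountable dense set $S\subset X$ such that for all distinct $x,y\in S$, $\liminf_{N\to\infty}\frac1N\sum_{j=1}^N\|T^jx-T^jy\|=0$ and $\limsup_{N\to\infty}\frac1N\sum_{j=1}^N\|T^jx-T^jy\|>0$. *)

(* Defs.v *)
From HB Require Import structures.
From mathcomp Require Import all_boot all_order all_algebra.
From mathcomp Require Import all_classical all_reals all_analysis.
From mathcomp Require Export complex.

Set Implicit Arguments.
Unset Strict Implicit.
Unset Printing Implicit Defensive.

Import Order.TTheory GRing.Theory Num.Theory.
Import numFieldNormedType.Exports.

Local Open Scope classical_set_scope.
Local Open Scope ring_scope.
Local Open Scope complex_scope.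

(* The modulus as an element of R; the generic `|z| lives in R[i]. *)
Definition modulus (R : realType) (z : R[i]) : R := ComplexField.Normc.normc z.

Definition disk (R : realType) : set R[i] := [set z | modulus z < 1].

(* Functions on the disk are total functions R[i] -> R[i] whose values outside
   the disk are irrelevant: every notion below (analyticity, the norms, the
   iterates of a self-map) only depends on the restriction to the disk. *)
Definition analytic_on_disk (R : realType) (f : R[i] -> R[i]) : Prop :=
  forall z, disk z -> derivable (f : R[i]^o -> R[i]^o) z 1.

Definition Hinfty (R : realType) : set (R[i] -> R[i]) :=
  [set f | analytic_on_disk f /\
           exists M : R, forall z, disk z -> modulus (f z) <= M].

(* Mean of |f(r z)|^2 for the normalized Lebesgue measure on the circle,
   parametrized by z = exp(it), 0 <= t <= 2 pi. *)
Definition circle_mean2 (R : realType) (f : R[i] -> R[i]) (r : R) : \bar R :=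
  ((2 * pi)^-1%:E *
   \int[lebesgue_measure]_(t in `[0%R, (2 * pi)%R])
      ((modulus (f (r * cos t +i* (r * sin t)))) ^+ 2)%:E)%E.

Definition hardy_norm (R : realType) (f : R[i] -> R[i]) : \bar R :=
  poweR (ereal_sup [set circle_mean2 f r | r in `]0%R, 1%R[ ]) 2^-1.

Definition H2 (R : realType) : set (R[i] -> R[i]) :=
  [set f | analytic_on_disk f /\ (hardy_norm f < +oo)%E].

(* C is identified with R * R carrying planar Lebesgue measure, and
   dA = dx dy / pi. *)
Definition bergman_norm (R : realType) (beta : R) (f : R[i] -> R[i]) : \bar R :=
  poweR (\int[lebesgue_measure \x lebesgue_measure]_(
           p in [set p : R * R | disk (p.1 +i* p.2)])
      (((modulus (f (p.1 +i* p.2))) ^+ 2) *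
       (pi^-1 * (beta + 1) *
          ((1 - (modulus (p.1 +i* p.2)) ^+ 2) `^ beta)))%:E)%E 2^-1.

Definition A2 (R : realType) (beta : R) : set (R[i] -> R[i]) :=
  [set f | analytic_on_disk f /\ (bergman_norm beta f < +oo)%E].

Definition wcomp (R : realType) (w phi : R[i] -> R[i]) (f : R[i] -> R[i]) :
  R[i] -> R[i] := fun z => w z * f (phi z).

(* w^(n) = (w o phi^(n-1)) ... (w o phi) w *)
Definition wprod (R : realType) (w phi : R[i] -> R[i]) (n : nat) :
  R[i] -> R[i] := fun z => \prod_(i < n) w (iter i phi z).

(* (1/N) (u 1 + ... + u N), meaningful for N >= 1. *)
Definition cesaro_mean (R : realType) (u : nat -> \bar R) (N : nat) : \bar R :=
  ((N%:R^-1)%:E * \sum_(1 <= j < N.+1) u j)%E.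

(* The Banach space is given by its underlying set X of vectors and its norm;
   nrm is finite on X and may take the value +oo elsewhere. *)
Definition bounded_operator (R : realType) (V : lmodType R[i]) (X : set V)
    (nrm : V -> \bar R) (T : V -> V) : Prop :=
  [/\ forall x, X x -> X (T x),
      forall (a : R[i]) x y, X x -> X y -> T (a *: x + y) = a *: T x + T y
    & exists M : R, forall x, X x -> (nrm (T x) <= M%:E * nrm x)%E].

(* When nrm (x - y) = 0 does not imply x = y (functions that agree on the disk
   but not outside it), the positivity of the limsup still forces distinct
   elements of S to represent distinct vectors, so the uncountability of S is
   that of a set of genuine vectors. *)
Definition densely_mean_Li_Yorke_chaotic (R : realType) (V : lmodType R[i])
    (X : set V) (nrm : V -> \bar R) (T : V -> V) : Prop :=
  bounded_operator X nrm T /\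
  exists S : set V,
    [/\ S `<=` X,
        ~ countable S,
        forall x, X x -> forall e : R, 0 < e ->
          exists2 y, S y & (nrm (x - y)%R < e%:E)%E
      & forall x y, S x -> S y -> x <> y ->
          let mean := cesaro_mean (fun j => nrm (iter j T x - iter j T y)%R) in
          limn_einf mean = 0%E /\ (0 < limn_esup mean)%E].

(* Main.v *)
(* Both squared norms depend on f only through its circle means M2 f r: the
   square of the H^2 norm is their supremum, and integration in polar
   coordinates turns that of A^2_beta into a weighted integral of M2 f (sqrt s)
   over 0 < s < 1.  The operator C_{w,phi} is bounded because of Littlewood's
   inequality M2 (f o phi) r <= K M2 f rho, rho^2 = 1 - c (1 - r^2), obtained
   from the Poisson formula and Harnack's inequality, and polynomials are dense
   by Parseval's identity.

   Iterating, (C_{w,phi})^j f = w^(j) (f o phi^j), so for bounded f the averages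
   of the orbit of f are dominated by those of w^(j).  These tend to 0 along N_k
   in H^2, hence in A^2_beta, and are unbounded in A^2_beta, hence in H^2.  The
   vectors whose orbit averages are bounded thus form a linear subspace K missing
   the constant 1, and it suffices to find a dense uncountable set of bounded
   functions with pairwise differences outside K.  Let (d_q) enumerate the
   polynomials with rational coefficients, each infinitely often, and let c_q be
   distinct reals tending to 0.  A line in the direction 1 meets K at most once,
   so for all but countably many t the functions d_q + t c_q 1 have differences
   outside K, and so do the multiples m 1 added to them, for all but countably
   many real m. *)
Require Import Defs.
From mathcomp Require Import all_boot all_order all_algebra.
From mathcomp Require Import all_classical all_reals all_analysis.
From HB Require Import structures.
From mathcomp Require Import measurable_realfun.
From mathcomp Require Import ring lra.

Set Implicit Arguments.
Unset Strict Implicit.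
Unset Printing Implicit Defensive.

Import Order.TTheory GRing.Theory Num.Theory.
Import numFieldNormedType.Exports.

Local Open Scope classical_set_scope.
Local Open Scope ring_scope.
Local Open Scope complex_scope.

(** The comparison radius in Littlewood's inequality is shaped so that, in the variable s = r^2, it
    is the affine map s -> 1 - c (1 - s). This map multiplies 1 - s by c, hence the weight (1 -
    s)^beta by c^beta and Lebesgue measure by c: one inequality bounds composition on A^2_beta by a
    change of variables and on H^2 by passing to the supremum. All function theory stays on circles
    of radius r < 1, where the functions are continuous and every mean is the integral of a
    continuous function. Squared norms are what is compared, and |a + b|^2 <= 2 |a|^2 + 2 |b|^2
    yields a triangle inequality with a factor 2. This is enough, because the norm only has to make
    two conditions stable under linear combinations: averages tending to 0 along N_k, and averages
    staying bounded. The passage between the two spaces rests on ||f||_A <= ||1||_A ||f||_H, where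
    ||1||_A is finite because beta > -1. *)

Local Notation Re := complex.Re.
Local Notation Im := complex.Im.
#[local] Arguments modulus : simpl never.

(** * Complex differentiation and path integrals *)

Section Modulus.
Variable R : realType.
Implicit Types (x y z : R[i]).

Lemma modulusE z : modulus z = Num.sqrt (Re z ^+ 2 + Im z ^+ 2).
Proof. by case: z. Qed.

Lemma sqr_modulus z : modulus z ^+ 2 = Re z ^+ 2 + Im z ^+ 2.
Proof. by rewrite modulusE sqr_sqrtr ?addr_ge0 ?sqr_ge0. Qed.

Lemma modulus_ge0 z : 0 <= modulus z.
Proof. by rewrite modulusE sqrtr_ge0. Qed.

Lemma modulus0 : modulus (0 : R[i]) = 0.
Proof. exact: ComplexField.Normc.normc0. Qed.

Lemma modulus1 : modulus (1 : R[i]) = 1.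
Proof. exact: ComplexField.Normc.normc1. Qed.

Lemma modulusM x y : modulus (x * y) = modulus x * modulus y.
Proof. exact: ComplexField.Normc.normcM. Qed.

Lemma modulusV x : modulus x^-1 = (modulus x)^-1.
Proof. exact: ComplexField.Normc.normcV. Qed.

Lemma modulusN x : modulus (- x) = modulus x.
Proof. exact: normcN. Qed.

Lemma modulusX x n : modulus (x ^+ n) = modulus x ^+ n.
Proof. by elim: n => [|n IH]; rewrite ?expr0 ?modulus1// !exprS modulusM IH. Qed.

Lemma le_modulusD x y : modulus (x + y) <= modulus x + modulus y.
Proof. exact: le_normcD. Qed.

Lemma le_modulusB x y : modulus (x - y) <= modulus x + modulus y.
Proof. by rewrite -(modulusN y) le_modulusD. Qed.

Lemma modulusC x y : modulus (x - y) = modulus (y - x).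
Proof. by rewrite -modulusN opprB. Qed.

Lemma ge_modulusB x y : modulus x - modulus y <= modulus (x - y).
Proof. by rewrite lerBlDr; apply: le_trans (le_modulusD _ _); rewrite subrK. Qed.

Lemma modulus_eq0 z : (modulus z == 0) = (z == 0).
Proof.
by apply/eqP/eqP => [/ComplexField.Normc.eq0_normc//|->]; exact: modulus0.
Qed.

Lemma modulus_gt0 z : (0 < modulus z) = (z != 0).
Proof. by rewrite lt_def modulus_eq0 modulus_ge0 andbT. Qed.

Lemma modulus_real (r : R) : modulus r%:C = `|r|.
Proof. by rewrite modulusE /= expr0n /= addr0 sqrtr_sqr. Qed.

Lemma modulus_conj z : modulus z^*%C = modulus z.
Proof. by case: z => a b; rewrite !modulusE /= sqrrN. Qed.

Lemma le_Re_modulus z : `|Re z| <= modulus z.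
Proof. by rewrite modulusE -sqrtr_sqr ler_wsqrtr// lerDl sqr_ge0. Qed.

Lemma le_Im_modulus z : `|Im z| <= modulus z.
Proof. by rewrite modulusE -sqrtr_sqr ler_wsqrtr// lerDr sqr_ge0. Qed.

Lemma modulus_le z : modulus z <= `|Re z| + `|Im z|.
Proof.
rewrite -(ler_pXn2r (n := 2)) ?nnegrE ?modulus_ge0 ?addr_ge0//.
rewrite sqr_modulus sqrrD !real_normK ?num_real//.
by rewrite lerD2r lerDl mulrn_wge0// mulr_ge0.
Qed.

Lemma conjM_modulus z : z * z^*%C = ((modulus z) ^+ 2)%:C.
Proof.
rewrite sqr_modulus; case: z => a b /=; apply/eqP.
by rewrite eq_complex/=; apply/andP; split; apply/eqP; ring.
Qed.

Lemma complexP x y : Re x = Re y -> Im x = Im y -> x = y.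
Proof. by case: x; case: y => a b c d /= -> ->. Qed.

Lemma realcB (r s : R) : (r - s)%:C = r%:C - s%:C.
Proof. exact: rmorphB. Qed.

Lemma realcM (r s : R) : (r * s)%:C = r%:C * s%:C.
Proof. exact: rmorphM. Qed.

Lemma realcX (r : R) n : (r ^+ n)%:C = r%:C ^+ n.
Proof. exact: rmorphXn. Qed.

Lemma realcV (r : R) : (r^-1)%:C = (r%:C)^-1.
Proof. exact: fmorphV. Qed.

Lemma conjM x y : (x * y)^*%C = x^*%C * y^*%C.
Proof. exact: rmorphM. Qed.

Lemma conjB x y : (x - y)^*%C = x^*%C - y^*%C.
Proof. exact: rmorphB. Qed.

Lemma conjX x n : (x ^+ n)^*%C = x^*%C ^+ n.
Proof. exact: rmorphXn. Qed.

Lemma conjV x : (x^-1)^*%C = (x^*%C)^-1.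
Proof. exact: fmorphV. Qed.

Lemma conj_real (r : R) : (r%:C)^*%C = r%:C.
Proof. by apply: complexP => //=; rewrite oppr0. Qed.

Lemma conj_eq0 x : (x^*%C == 0) = (x == 0).
Proof. by rewrite -!modulus_eq0 modulus_conj. Qed.

Lemma cReD x y : Re (x + y) = Re x + Re y. Proof. by case: x; case: y. Qed.
Lemma cImD x y : Im (x + y) = Im x + Im y. Proof. by case: x; case: y. Qed.
Lemma cReN x : Re (- x) = - Re x. Proof. by case: x. Qed.
Lemma cImN x : Im (- x) = - Im x. Proof. by case: x. Qed.
Lemma cReM x y : Re (x * y) = Re x * Re y - Im x * Im y.
Proof. by case: x; case: y. Qed.
Lemma cImM x y : Im (x * y) = Re x * Im y + Im x * Re y.
Proof. by case: x; case: y. Qed.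

Lemma cReV x : Re x^-1 = Re x / modulus x ^+ 2.
Proof. by rewrite sqr_modulus; case: x. Qed.

Lemma cImV x : Im x^-1 = - Im x / modulus x ^+ 2.
Proof. by rewrite sqr_modulus; case: x => a b /=; rewrite mulNr. Qed.

Lemma cRe_realM (r : R) x : Re (r%:C * x) = r * Re x.
Proof. by rewrite cReM /= mul0r subr0. Qed.

Lemma normE z : `|z| = (modulus z)%:C.
Proof. by []. Qed.

Lemma ltcR_modulus z (e : R) : (`|z| < e%:C) = (modulus z < e).
Proof. by rewrite normE ltcR. Qed.

End Modulus.

Section Derivative.
Variable R : realType.
Implicit Types (f g : R[i] -> R[i]) (z d : R[i]).

(** The increment form, with real e and r and without division by h, lets remainder estimates be
    composed with no separate case h = 0. *)
Definition has_cderiv f z d := forall e : R, 0 < e ->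
  exists2 r : R, 0 < r & forall h, modulus h < r ->
    modulus (f (z + h) - f z - d * h) <= e * modulus h.

Definition ccont f z := forall e : R, 0 < e ->
  exists2 r : R, 0 < r & forall h, modulus h < r ->
    modulus (f (z + h) - f z) < e.

Lemma posC_real (e : R[i]) : 0 < e -> exists2 r : R, 0 < r & e = r%:C.
Proof.
by case: e => a b; rewrite ltcE /= => /andP[/eqP b0 a0]; exists a; rewrite ?b0.
Qed.

Lemma derivable_cderivP f z :
  derivable (f : R[i]^o -> R[i]^o) z 1 <-> exists d, has_cderiv f z d.
Proof.
split=> [/cvg_ex[/= d dP]|[d dP]].
  exists d => e e0.
  have : 0 < (e%:C : R[i]) by rewrite ltcR.
  move/cvgrPdist_le: dP => /[apply].
  rewrite near_withinE /= => /nbhs_ballP[/= r0 /posC_real[r r_gt0 ->] rP].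
  exists r => // h hr.
  have [->|h0] := eqVneq h 0.
    by rewrite addr0 subrr mulr0 subrr modulus0 mulr0.
  have := rP h; rewrite /ball_ /= sub0r normrN ltcR_modulus => /(_ hr h0).
  rewrite normE lecR => H.
  have -> : f (z + h) - f z - d * h =
      - ((d - h^-1 *: (f (h *: 1 + z) - f z)) * h).
    by rewrite /GRing.scale /= mulr1 (addrC z); field.
  by rewrite modulusN modulusM ler_wpM2r// modulus_ge0.
apply/cvg_ex; exists d; apply/cvgrPdist_le => /= e /posC_real[e' e0 ->].
have [r r0 rP] := dP _ e0.
rewrite near_withinE; apply/nbhs_ballP; exists r%:C => /=; first by rewrite ltcR.
move=> h; rewrite -ball_normE /ball_ /= sub0r normrN ltcR_modulus => hr h0.
rewrite normE lecR.
have := rP _ hr.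
have -> : f (z + h) - f z - d * h =
      - ((d - h^-1 *: (f (h *: 1 + z) - f z)) * h).
  by rewrite /GRing.scale /= mulr1 (addrC z); field.
by rewrite modulusN modulusM ler_pM2r// modulus_gt0.
Qed.

Lemma has_cderiv_cont f z d : has_cderiv f z d -> ccont f z.
Proof.
move=> fd e e0; have [r r0 rP] := fd _ ltr01.
have D0 : 0 < 2 + modulus d by have := modulus_ge0 d; lra.
exists (Num.min r (e / (2 + modulus d))).
  by rewrite lt_min r0 divr_gt0.
move=> h; rewrite lt_min => /andP[/rP + he].
rewrite mul1r => H.
have -> : f (z + h) - f z = (f (z + h) - f z - d * h) + d * h by ring.
apply: le_lt_trans (le_modulusD _ _) _; rewrite modulusM.
apply: le_lt_trans (_ : modulus h * (1 + modulus d) < _).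
  by rewrite mulrDr mulr1 lerD// mulrC.
move: he; rewrite ltr_pdivlMr//; apply: le_lt_trans.
by rewrite ler_wpM2l ?modulus_ge0// lerD2r ler1n.
Qed.

End Derivative.

Section PathContinuity.
Variable R : realType.
Implicit Types (g : R -> R[i]) (t : R).

(** Componentwise, because integrals of complex paths are defined through their real and imaginary
    parts. *)
Definition pcont g t :=
  {for t, continuous (fun s => Re (g s))} /\
  {for t, continuous (fun s => Im (g s))}.

Lemma pcontP g t : pcont g t <->
  forall e : R, 0 < e -> \forall s \near t, modulus (g s - g t) < e.
Proof.
split=> [[cr ci] e e0|H].
  have e2 : 0 < e / 2 by rewrite divr_gt0.
  move/cvgrPdist_lt : cr => /(_ _ e2) cr.
  move/cvgrPdist_lt : ci => /(_ _ e2) ci.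
  near=> s; apply: le_lt_trans (modulus_le _) _.
  rewrite cReD cImD cReN cImN [ltRHS]splitr ltrD//.
    by rewrite distrC; near: s; exact: cr.
  by rewrite distrC; near: s; exact: ci.
split; apply/cvgrPdist_lt => e /H; apply: filterS => s; apply: le_lt_trans.
  by rewrite modulusC -cReN -cReD le_Re_modulus.
by rewrite modulusC -cImN -cImD le_Im_modulus.
Unshelve. all: by end_near. Qed.

Lemma pcont_comp (f : R[i] -> R[i]) g t :
  ccont f (g t) -> pcont g t -> pcont (f \o g) t.
Proof.
move=> cf /pcontP cg; apply/pcontP => e /cf[r r0 rP].
apply: filterS (cg _ r0) => s /rP /=; by rewrite addrCA subrr addr0.
Qed.

Lemma pcont_cst (c : R[i]) t : pcont (fun=> c) t.
Proof. by split; exact: cvg_cst. Qed.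

Lemma pcontD g1 g2 t : pcont g1 t -> pcont g2 t ->
  pcont (fun s => g1 s + g2 s) t.
Proof.
move=> [r1 i1] [r2 i2]; split.
- rewrite (_ : (fun s => _) = (fun s => Re (g1 s) + Re (g2 s))); last first.
    by apply/funext => s; rewrite cReD.
  exact: continuousD.
- rewrite (_ : (fun s => _) = (fun s => Im (g1 s) + Im (g2 s))); last first.
    by apply/funext => s; rewrite cImD.
  exact: continuousD.
Qed.

Lemma pcontM g1 g2 t : pcont g1 t -> pcont g2 t ->
  pcont (fun s => g1 s * g2 s) t.
Proof.
move=> [r1 i1] [r2 i2]; split.
- rewrite (_ : (fun s => _) =
    (fun s => Re (g1 s) * Re (g2 s) - Im (g1 s) * Im (g2 s))); last first.
    by apply/funext => s; rewrite cReM.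
  by apply: continuousB; exact: continuousM.
- rewrite (_ : (fun s => _) =
    (fun s => Re (g1 s) * Im (g2 s) + Im (g1 s) * Re (g2 s))); last first.
    by apply/funext => s; rewrite cImM.
  by apply: continuousD; exact: continuousM.
Qed.

Lemma pcontN g t : pcont g t -> pcont (fun s => - g s) t.
Proof.
move=> [r1 i1]; split.
- rewrite (_ : (fun s => _) = (fun s => - Re (g s))); last first.
    by apply/funext => s; rewrite cReN.
  exact: continuousN.
- rewrite (_ : (fun s => _) = (fun s => - Im (g s))); last first.
    by apply/funext => s; rewrite cImN.
  exact: continuousN.
Qed.

Lemma pcontB g1 g2 t : pcont g1 t -> pcont g2 t ->
  pcont (fun s => g1 s - g2 s) t.
Proof. by move=> h1 h2; exact: (pcontD h1 (pcontN h2)). Qed.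

Lemma pcontX g t n : pcont g t -> pcont (fun s => g s ^+ n) t.
Proof.
move=> gt; elim: n => [|n IH]; first exact: pcont_cst.
rewrite (_ : (fun s => _) = (fun s => g s * g s ^+ n)); last first.
  by apply/funext => s; rewrite exprS.
exact: pcontM.
Qed.

Lemma pcont_conj g t : pcont g t -> pcont (fun s => (g s)^*%C) t.
Proof.
move=> [r1 i1]; split.
- rewrite (_ : (fun s => _) = (fun s => Re (g s)))//.
  by apply/funext => s; case: (g s).
- rewrite (_ : (fun s => _) = (fun s => - Im (g s))); last first.
    by apply/funext => s; case: (g s).
  exact: continuousN.
Qed.

Lemma pcont_sqr_modulus g t : pcont g t ->
  {for t, continuous (fun s => modulus (g s) ^+ 2)}.
Proof.
move=> [r1 i1]; rewrite (_ : (fun s => _) =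
    (fun s => Re (g s) * Re (g s) + Im (g s) * Im (g s))); last first.
  by apply/funext => s; rewrite sqr_modulus !expr2.
by apply: continuousD; exact: continuousM.
Qed.

Lemma pcontV g t : g t != 0 -> pcont g t -> pcont (fun s => (g s)^-1) t.
Proof.
move=> g0 gt; have [r1 i1] := gt.
have c : {for t, continuous (fun s => (modulus (g s) ^+ 2)^-1)}.
  apply: cvgV; last exact: pcont_sqr_modulus.
  by rewrite sqrf_eq0 modulus_eq0.
split.
- rewrite (_ : (fun s => _) =
    (fun s => Re (g s) * (modulus (g s) ^+ 2)^-1)); last first.
    by apply/funext => s; rewrite cReV.
  exact: continuousM.
- rewrite (_ : (fun s => _) =
    (fun s => - Im (g s) * (modulus (g s) ^+ 2)^-1)); last first.
    by apply/funext => s; rewrite cImV.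
  exact: (continuousM (continuousN i1) c).
Qed.

Lemma pcont_real (h : R -> R) t : {for t, continuous h} ->
  pcont (fun s => (h s)%:C) t.
Proof. by move=> ht; split => //=; exact: cvg_cst. Qed.

Lemma pcont_sum (I : Type) (r : seq I) (F : I -> R -> R[i]) t :
  (forall i, pcont (F i) t) -> pcont (fun s => \sum_(i <- r) F i s) t.
Proof.
move=> H; elim: r => [|i r IH].
  rewrite (_ : (fun s => _) = fun=> 0); first exact: pcont_cst.
  by apply/funext => s; rewrite big_nil.
rewrite (_ : (fun s => _) = fun s => F i s + \sum_(i <- r) F i s).
  exact: pcontD.
by apply/funext => s; rewrite big_cons.
Qed.

End PathContinuity.

(** * Real and complex integrals over a segment *)

Section RealIntegral.
Variable R : realType.
Local Notation mu := (@lebesgue_measure R).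
Implicit Types (a b c : R) (h : R -> R).

Definition rint a b h : R := (\int[mu]_(x in `[a, b]) h x)%R.

(** Continuity is two-sided even at the endpoints: integrands here are defined on all of R, and the
    pointwise form is closed under algebraic operations. *)
Definition conts a b h := forall t, a <= t <= b -> {for t, continuous h}.

Lemma conts_integrable a b h : conts a b h ->
  mu.-integrable `[a, b] (EFin \o h).
Proof.
move=> hc; apply: continuous_compact_integrable; first exact: segment_compact.
by apply: continuous_in_subspaceT => t; rewrite inE /= in_itv /= => /hc.
Qed.

Lemma rintD a b h1 h2 : conts a b h1 -> conts a b h2 ->
  rint a b (fun x => h1 x + h2 x) = rint a b h1 + rint a b h2.
Proof. by move=> c1 c2; apply: RintegralD => //; exact: conts_integrable. Qed.

Lemma rintB a b h1 h2 : conts a b h1 -> conts a b h2 ->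
  rint a b (fun x => h1 x - h2 x) = rint a b h1 - rint a b h2.
Proof. by move=> c1 c2; apply: RintegralB => //; exact: conts_integrable. Qed.

Lemma rintZ a b h r : conts a b h ->
  rint a b (fun x => r * h x) = r * rint a b h.
Proof. by move=> c1; apply: RintegralZl => //; exact: conts_integrable. Qed.

Lemma eq_rint a b h1 h2 : (forall t, a <= t <= b -> h1 t = h2 t) ->
  rint a b h1 = rint a b h2.
Proof.
by move=> H; apply: eq_Rintegral => t; rewrite inE /= in_itv /= => /H.
Qed.

Lemma rint_cst a b r : a <= b -> rint a b (fun=> r) = r * (b - a).
Proof.
move=> ab; rewrite /rint Rintegral_cst//= lebesgue_measure_itv/= lte_fin.
by move: ab; rewrite le_eqVlt => /predU1P[->|->]//; rewrite ltxx subrr.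
Qed.

Lemma le_rint a b h1 h2 : conts a b h1 -> conts a b h2 ->
  (forall t, a <= t <= b -> h1 t <= h2 t) -> rint a b h1 <= rint a b h2.
Proof.
move=> c1 c2 H; apply: le_Rintegral => //; exact: conts_integrable.
Qed.

Lemma rint_ge0 a b h :
  (forall t, a <= t <= b -> 0 <= h t) -> 0 <= rint a b h.
Proof.
by move=> H; apply: Rintegral_ge0 => t /=; rewrite in_itv /= => /H.
Qed.

Lemma le_norm_rint a b h M : a <= b -> conts a b h ->
  (forall t, a <= t <= b -> `|h t| <= M) -> `|rint a b h| <= M * (b - a).
Proof.
move=> ab ch H; apply: le_trans (le_normr_Rintegral _ _) _ => //.
  exact: conts_integrable.
rewrite -(rint_cst M ab); apply: le_rint => //.
- by move=> t /ch ht; apply: continuous_comp => //; exact: norm_continuous.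
- by move=> t _; exact: cvg_cst.
Qed.

Lemma conts_sub a b a' b' h : a <= a' -> b' <= b -> conts a b h ->
  conts a' b' h.
Proof.
move=> aa bb hc t /andP[ta tb]; apply: hc.
by rewrite (le_trans aa ta) (le_trans tb bb).
Qed.

Lemma rint_split a b c h : a <= c -> c <= b -> conts a b h ->
  rint a b h = rint a c h + rint c b h.
Proof.
move=> ac cb hc; apply/eqP; rewrite addrC -subr_eq; apply/eqP.
rewrite /rint Rintegral_itvB ?bnd_simp//; last exact: conts_integrable.
rewrite Rintegral_itv_obnd_cbnd//.
apply: integrableS (conts_integrable (conts_sub ac (lexx b) hc)) => //.
exact: subset_itv_oc_cc.
Qed.

End RealIntegral.

Section ComplexIntegral.
Variable R : realType.
Implicit Types (a b c : R) (g : R -> R[i]).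

Definition cint a b g : R[i] :=
  rint a b (fun t => Re (g t)) +i* rint a b (fun t => Im (g t)).

Definition pconts a b g := forall t, a <= t <= b -> pcont g t.

Lemma pconts_Re a b g : pconts a b g -> conts a b (fun t => Re (g t)).
Proof. by move=> gc t /gc[]. Qed.

Lemma pconts_Im a b g : pconts a b g -> conts a b (fun t => Im (g t)).
Proof. by move=> gc t /gc[]. Qed.

Hint Resolve pconts_Re pconts_Im : core.

Lemma eq_cint a b g1 g2 : (forall t, a <= t <= b -> g1 t = g2 t) ->
  cint a b g1 = cint a b g2.
Proof. by move=> H; congr (_ +i* _); apply: eq_rint => t /H ->. Qed.

Lemma cintD a b g1 g2 : pconts a b g1 -> pconts a b g2 ->
  cint a b (fun t => g1 t + g2 t) = cint a b g1 + cint a b g2.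
Proof.
move=> c1 c2; apply: complexP => /=; rewrite -rintD; auto; apply: eq_rint => t _.
- by rewrite cReD.
- by rewrite cImD.
Qed.

Lemma cintZ a b g z : pconts a b g ->
  cint a b (fun t => z * g t) = z * cint a b g.
Proof.
move=> c1; have cZ h r : conts a b h -> conts a b (fun t => r * h t).
  by move=> hc t /hc ht; apply: continuousM => //; exact: cvg_cst.
apply: complexP; rewrite /= ?cReM ?cImM /= -!rintZ; auto.
- rewrite -rintB; auto; by apply: eq_rint => t _; rewrite cReM.
- rewrite -rintD; auto; by apply: eq_rint => t _; rewrite cImM.
Qed.

Lemma cintN a b g : pconts a b g -> cint a b (fun t => - g t) = - cint a b g.
Proof.
by move=> c1; rewrite -mulN1r -cintZ//; apply: eq_cint => t _; rewrite mulN1r.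
Qed.

Lemma cintB a b g1 g2 : pconts a b g1 -> pconts a b g2 ->
  cint a b (fun t => g1 t - g2 t) = cint a b g1 - cint a b g2.
Proof.
move=> c1 c2; have c2N : pconts a b (fun t => - g2 t) by move=> t /c2; exact: pcontN.
by rewrite (cintD c1 c2N) (cintN c2).
Qed.

Lemma cint_cst a b z : a <= b -> cint a b (fun=> z) = z * (b - a)%:C.
Proof.
move=> ab; apply: complexP; rewrite /= ?cReM ?cImM /= rint_cst//; first by rewrite mulr0 subr0.
by rewrite mulr0 add0r.
Qed.

Lemma cint_split a b c g : a <= c -> c <= b -> pconts a b g ->
  cint a b g = cint a c g + cint c b g.
Proof. by move=> ac cb gc; apply: complexP => /=; apply: rint_split; auto. Qed.

(** The factor 2 comes from bounding the real and imaginary parts separately; the estimate serves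
    where constant factors are immaterial. *)
Lemma le_modulus_cint a b g M : a <= b -> pconts a b g ->
  (forall t, a <= t <= b -> modulus (g t) <= M) ->
  modulus (cint a b g) <= 2 * M * (b - a).
Proof.
move=> ab gc gM; apply: le_trans (modulus_le _) _ => /=.
rewrite mulrAC mulr_natl mulr2n mulrDl -![_ * M]mulrC.
apply: lerD; apply: le_norm_rint; auto => t /gM; apply: le_trans.
- exact: le_Re_modulus.
- exact: le_Im_modulus.
Qed.

Lemma cint_conj a b g : pconts a b g ->
  cint a b (fun t => (g t)^*%C) = ((cint a b g)^*)%C.
Proof.
move=> gc; apply: complexP => /=.
  by apply: eq_rint => t _; case: (g t).
rewrite -mulN1r -rintZ; auto; apply: eq_rint => t _.
by case: (g t) => ? ? /=; rewrite mulN1r.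
Qed.

End ComplexIntegral.

(** * Cauchy's theorem and mean values *)

Section RectangleInduction.
Variable R : realType.
Implicit Types (a b c d : R).

Lemma half_pow_small (u e : R) : 0 < e -> exists n : nat, u / 2 ^+ n < e.
Proof.
move=> e0; pose n := Num.bound `|u / e|; exists n.
have un : u / e < n%:R.
  by apply: le_lt_trans (ler_norm _) _; exact: archi_boundP.
rewrite ltr_pdivrMr ?exprn_gt0// mulrC -ltr_pdivrMr//.
apply: lt_trans un _; rewrite -natrX ltr_nat; exact: ltn_expl.
Qed.

(* Bisection: a rectangle violating P has a quarter violating P, and the nested
   quarters shrink to a point near which P holds. *)
Lemma rectangle_induction (P : R -> R -> R -> R -> Prop) a b c d :
  a <= b -> c <= d ->
  (forall a' b' c' d', a <= a' -> a' <= b' -> b' <= b ->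
     c <= c' -> c' <= d' -> d' <= d ->
     let m := (a' + b') / 2 in let n := (c' + d') / 2 in
     P a' m c' n -> P m b' c' n -> P a' m n d' -> P m b' n d' ->
     P a' b' c' d') ->
  (forall x y, a <= x <= b -> c <= y <= d -> exists2 e : R, 0 < e &
     forall a' b' c' d', a <= a' -> a' <= x -> x <= b' -> b' <= b ->
     c <= c' -> c' <= y -> y <= d' -> d' <= d ->
     b' - a' < e -> d' - c' < e -> P a' b' c' d') ->
  P a b c d.
Proof.
move=> ab cd Pquarter Plocal; apply: contrapT => nP.
pose u n := (b - a) / 2 ^+ n; pose v n := (d - c) / 2 ^+ n.
have u0 n : 0 <= u n by rewrite divr_ge0 ?subr_ge0// exprn_ge0.
have v0 n : 0 <= v n by rewrite divr_ge0 ?subr_ge0// exprn_ge0.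
have uS n : u n = u n.+1 + u n.+1.
  rewrite /u exprSr; have : (2 : R) ^+ n != 0 by rewrite expf_neq0.
  by move=> ?; field.
have vS n : v n = v n.+1 + v n.+1.
  rewrite /v exprSr; have : (2 : R) ^+ n != 0 by rewrite expf_neq0.
  by move=> ?; field.
(* After n bisections the sides are [u n] and [v n], so a bad rectangle is recorded by its lower
   left corner [p] alone. *)
pose Q n (p : R * R) := [/\ ~ P p.1 (p.1 + u n) p.2 (p.2 + v n),
  a <= p.1, p.1 + u n <= b, c <= p.2 & p.2 + v n <= d].
pose step n (p q : R * R) := [/\ Q n.+1 q, p.1 <= q.1,
  q.1 + u n.+1 <= p.1 + u n, p.2 <= q.2 & q.2 + v n.+1 <= p.2 + v n].
have stepP n p : Q n p -> exists q, step n p q.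
  case=> nPp ap pb cp pd; apply: contrapT => nq; apply: nPp.
  have hu : (p.1 + (p.1 + u n)) / 2 = p.1 + u n.+1 by rewrite uS; field.
  have hv : (p.2 + (p.2 + v n)) / 2 = p.2 + v n.+1 by rewrite vS; field.
  have eu : p.1 + u n = (p.1 + u n.+1) + u n.+1 by rewrite uS; ring.
  have ev : p.2 + v n = (p.2 + v n.+1) + v n.+1 by rewrite vS; ring.
  have := u0 n; have := v0 n; have := u0 n.+1; have := v0 n.+1.
  move=> v1 u1 v2 u2.
  apply: Pquarter; rewrite ?hu ?hv; try lra.
  - apply: contrapT => H; apply: nq; exists (p.1, p.2); split; rewrite /=; try lra.
    by split => //=; lra.
  - apply: contrapT => H; apply: nq; exists (p.1 + u n.+1, p.2).
    split; rewrite /=; try lra.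
    by split => /=; [rewrite -eu|lra..].
  - apply: contrapT => H; apply: nq; exists (p.1, p.2 + v n.+1).
    split; rewrite /=; try lra.
    by split => /=; [rewrite -ev|lra..].
  - apply: contrapT => H; apply: nq; exists (p.1 + u n.+1, p.2 + v n.+1).
    split; rewrite /=; try lra.
    by split => /=; [rewrite -ev -eu|lra..].
pose s := fix s n := if n is m.+1 then xget (s m) (step m (s m)) else (a, c).
have sQ n : Q n (s n).
  elim: n => [|n IH].
    split; rewrite /= ?/u ?/v ?expr0 ?divr1; [|lra..].
    by rewrite ![_ + (_ - _)]addrC !subrK.
  have [q qP] := stepP _ _ IH.
  have : step n (s n) (s n.+1) by apply: xgetPex; exists q.
  by case.
have sS n : step n (s n) (s n.+1).
  by have [q qP] := stepP _ _ (sQ n); apply: xgetPex; exists q.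
(* Lower corners increase and upper corners decrease, so the supremum of the lower ones lies in
   every rectangle of the chain. The statement is generic in [h] to cover both coordinates. *)
have mono (h : R * R -> R) (w : nat -> R) :
    (forall n, 0 <= w n) -> (forall n, h (s n) <= h (s n.+1)) ->
    (forall n, h (s n.+1) + w n.+1 <= h (s n) + w n) ->
    forall n, h (s n) <= sup (range (h \o s)) <= h (s n) + w n.
  move=> w0 h1 h2 n.
  have incr i j : h (s i) <= h (s (i + j)%N).
    by elim: j => [|j IH]; rewrite ?addn0// addnS (le_trans IH).
  have decr i j : h (s (i + j)%N) + w (i + j)%N <= h (s i) + w i.
    by elim: j => [|j IH]; rewrite ?addn0// addnS (le_trans _ IH).
  have ubd i : ubound (range (h \o s)) (h (s i) + w i).
    move=> _ [j _ <-] /=.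
    have [ij|/ltnW ji] := leqP i j.
      rewrite -(subnKC ij); apply: le_trans _ (decr i (j - i)%N).
      by rewrite lerDl.
    rewrite -(subnKC ji); apply: le_trans (incr j (i - j)%N) _.
    by rewrite lerDl.
  apply/andP; split.
    apply: ub_le_sup; last by exists n.
    by exists (h (s 0) + w 0%N); exact: ubd.
  by apply: ge_sup (ubd n); exists (h (s 0)); exists 0%N.
have Hx n := mono fst u u0 (fun n => let: And5 _ h _ _ _ := sS n in h)
  (fun n => let: And5 _ _ h _ _ := sS n in h) n.
have Hy n := mono snd v v0 (fun n => let: And5 _ _ _ h _ := sS n in h)
  (fun n => let: And5 _ _ _ _ h := sS n in h) n.
set x := sup _ in Hx; set y := sup _ in Hy.
have [] := Plocal x y.
- have [_ A1 A2 _ _] := sQ 0%N; have := Hx 0%N; lra.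
- have [_ _ _ A1 A2] := sQ 0%N; have := Hy 0%N; lra.
move=> e e0 He.
have [n ne] := half_pow_small ((b - a) + (d - c)) e0.
have [nPn A1 A2 A3 A4] := sQ n; apply: nPn.
have uv : u n + v n < e by rewrite /u /v -mulrDl.
have un := u0 n; have vn := v0 n; have hx := Hx n; have hy := Hy n.
by apply: He; lra.
Qed.

End RectangleInduction.

(** * Goursat's theorem on rectangles *)

Section Goursat.
Variable R : realType.
Implicit Types (a b c d m n : R) (g : R[i] -> R[i]).

(** The contour integral along the boundary of [a, b] x [c, d], counterclockwise, with opposite
    sides paired. *)
Definition bint g a b c d : R[i] :=
  cint a b (fun x => g (x +i* c) - g (x +i* d)) +
  (0 +i* 1) * cint c d (fun y => g (b +i* y) - g (a +i* y)).

Definition rcont g a b c d := forall x y, a <= x <= b -> c <= y <= d ->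
  ccont g (x +i* y).

Lemma pcont_hline c (x : R) : pcont (fun x => x +i* c) x.
Proof. by split => /=; [exact: cvg_id|exact: cvg_cst]. Qed.

Lemma pcont_vline a (y : R) : pcont (fun y => a +i* y) y.
Proof. by split => /=; [exact: cvg_cst|exact: cvg_id]. Qed.

Lemma rcont_h g a b c d y : rcont g a b c d -> c <= y <= d ->
  pconts a b (fun x => g (x +i* y)).
Proof.
move=> gc yP x xP; apply: (pcont_comp (g := fun x => x +i* y)); first exact: gc.
exact: pcont_hline.
Qed.

Lemma rcont_v g a b c d x : rcont g a b c d -> a <= x <= b ->
  pconts c d (fun y => g (x +i* y)).
Proof.
move=> gc xP y yP; apply: (pcont_comp (g := fun y => x +i* y)); first exact: gc.
exact: pcont_vline.
Qed.

Lemma pcontsB a b (g1 g2 : R -> R[i]) : pconts a b g1 -> pconts a b g2 ->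
  pconts a b (fun t => g1 t - g2 t).
Proof. by move=> h1 h2 t tab; apply: pcontB; [exact: h1|exact: h2]. Qed.

Lemma bint_hsplit g a b c d m : a <= m <= b -> c <= d -> rcont g a b c d ->
  bint g a b c d = bint g a m c d + bint g m b c d.
Proof.
move=> /andP[am mb] cd gc; rewrite /bint.
have ab := le_trans am mb.
rewrite (cint_split am mb); last first.
  by apply: pcontsB; apply: rcont_h gc _; rewrite lexx cd.
have va := rcont_v gc (x := a); have vb := rcont_v gc (x := b).
have vm := rcont_v gc (x := m).
rewrite !(cintB (a := c) (b := d)); try (by apply: va; rewrite lexx ab);
  try (by apply: vb; rewrite lexx ab); try (by apply: vm; rewrite am mb).
ring.
Qed.

Lemma bint_vsplit g a b c d n : c <= n <= d -> a <= b -> rcont g a b c d ->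
  bint g a b c d = bint g a b c n + bint g a b n d.
Proof.
move=> /andP[cn nd] ab gc; rewrite /bint.
have cd := le_trans cn nd.
rewrite (cint_split cn nd (g := fun y => g (b +i* y) - g (a +i* y))); last first.
  by apply: pcontsB; apply: rcont_v gc _; rewrite lexx ab.
have hc := rcont_h gc (y := c); have hd := rcont_h gc (y := d).
have hn := rcont_h gc (y := n).
rewrite !(cintB (a := a) (b := b)); try (by apply: hc; rewrite lexx cd);
  try (by apply: hd; rewrite lexx cd); try (by apply: hn; rewrite cn nd).
ring.
Qed.

Lemma rcont_sub g a b c d a' b' c' d' : a <= a' -> b' <= b -> c <= c' ->
  d' <= d -> rcont g a b c d -> rcont g a' b' c' d'.
Proof. by move=> ? ? ? ? gc x y xP yP; apply: gc; lra. Qed.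

(** An affine function has zero integral along the boundary, so only the deviation from it counts;
    each pair of opposite sides contributes at most 2 (M + M) times its length. *)
Lemma bint_affine_bound g a b c d (al be : R[i]) M : a <= b -> c <= d ->
  rcont g a b c d ->
  (forall x y, a <= x <= b -> c <= y <= d ->
    modulus (g (x +i* y) - (al + be * (x +i* y))) <= M) ->
  modulus (bint g a b c d) <= 4 * M * ((b - a) + (d - c)).
Proof.
move=> ab cd gc gM.
pose e z := g z - (al + be * z).
have inx : a <= b <= b by rewrite lexx ab. have ina : a <= a <= b by rewrite lexx ab.
have inc : c <= c <= d by rewrite lexx cd. have ind : c <= d <= d by rewrite lexx cd.
have affc : rcont e a b c d.
  move=> x y xP yP; have gxy := gc x y xP yP.
  have M0 : 0 < 2 * (1 + modulus be) by have := modulus_ge0 be; lra.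
  move=> eps e0; have [r r0 rP] := gxy (eps / 2) ltac:(lra).
  exists (Num.min r (eps / (2 * (1 + modulus be)))).
    by rewrite lt_min r0 divr_gt0.
  move=> h; rewrite lt_min => /andP[hr he].
  have -> : e (x +i* y + h) - e (x +i* y) =
    (g (x +i* y + h) - g (x +i* y)) - be * h by rewrite /e; ring.
  apply: le_lt_trans (le_modulusB _ _) _.
  have := rP _ hr; rewrite modulusM.
  move: he; rewrite ltr_pdivlMr// => he H.
  have := modulus_ge0 h; have := modulus_ge0 be; nra.
have -> : bint g a b c d = bint e a b c d.
  have E1 x : e (x +i* c) - e (x +i* d) =
      (g (x +i* c) - g (x +i* d)) - (0 +i* 1) * be * (c - d)%:C.
    rewrite /e; have -> : x +i* c = x%:C + (0 +i* 1) * c%:C.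
      by apply: complexP; rewrite /= ?(cReD, cImD, cReM, cImM) /=; ring.
    have -> : x +i* d = x%:C + (0 +i* 1) * d%:C.
      by apply: complexP; rewrite /= ?(cReD, cImD, cReM, cImM) /=; ring.
    by rewrite rmorphB /=; ring.
  have E2 y : e (b +i* y) - e (a +i* y) =
      (g (b +i* y) - g (a +i* y)) - be * (b - a)%:C.
    rewrite /e; have -> : b +i* y = b%:C + (0 +i* 1) * y%:C.
      by apply: complexP; rewrite /= ?(cReD, cImD, cReM, cImM) /=; ring.
    have -> : a +i* y = a%:C + (0 +i* 1) * y%:C.
      by apply: complexP; rewrite /= ?(cReD, cImD, cReM, cImM) /=; ring.
    by rewrite rmorphB /=; ring.
  rewrite /bint (eq_cint (g1 := fun x => e (x +i* c) - e (x +i* d))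
    (fun t _ => E1 t)).
  rewrite (eq_cint (g1 := fun y => e (b +i* y) - e (a +i* y)) (fun t _ => E2 t)).
  have K z u v : pconts u v (fun=> z : R[i]) by move=> t _; exact: pcont_cst.
  rewrite (cintB (pcontsB (rcont_h gc inc) (rcont_h gc ind)) (K _ _ _)).
  rewrite (cintB (pcontsB (rcont_v gc inx) (rcont_v gc ina)) (K _ _ _)).
  by rewrite !cint_cst// !rmorphB /=; ring.
rewrite /bint; apply: le_trans (le_modulusD _ _) _.
rewrite mulrDr; apply: lerD.
  have -> : 4 * M * (b - a) = 2 * (M + M) * (b - a) by ring.
  apply: (le_modulus_cint ab); first by apply: pcontsB; exact: rcont_h affc _.
  by move=> t tP; apply: le_trans (le_modulusB _ _) _; apply: lerD; exact: gM.
rewrite modulusM (_ : modulus (0 +i* 1) = 1) ?mul1r; last first.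
  by rewrite modulusE /= expr0n /= add0r expr1n sqrtr1.
have -> : 4 * M * (d - c) = 2 * (M + M) * (d - c) by ring.
apply: (le_modulus_cint cd); first by apply: pcontsB; exact: rcont_v affc _.
by move=> t tP; apply: le_trans (le_modulusB _ _) _; apply: lerD; exact: gM.
Qed.

(** Bisection with a quadratic bound: near a point g is affine up to k |h|, so a small rectangle
    around it has boundary integral at most 4 k times its squared half perimeter. *)
Lemma goursat g a b c d : a <= b -> c <= d ->
  (forall x y, a <= x <= b -> c <= y <= d -> exists l, has_cderiv g (x +i* y) l) ->
  bint g a b c d = 0.
Proof.
move=> ab cd gd.
have gc : rcont g a b c d.
  by move=> x y xP yP; have [l] := gd x y xP yP; exact: has_cderiv_cont.
apply/eqP; rewrite -modulus_eq0 eq_le modulus_ge0 andbT.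
apply/ler_addgt0Pr => e e0; rewrite add0r.
have L0 : 0 <= (b - a) + (d - c) by lra.
set L := (b - a) + (d - c) in L0.
(* Chosen so that 4 k L^2 <= e; the added 1 covers the degenerate case L = 0. *)
pose k := e / (4 * (L ^+ 2 + 1)).
have k0 : 0 < k by rewrite divr_gt0// mulr_gt0// ltr_wpDl// sqr_ge0.
apply: (@le_trans _ _ (4 * k * L ^+ 2)); last first.
  have D0 : 0 < L ^+ 2 + 1 by rewrite ltr_wpDl// sqr_ge0.
  have -> : 4 * k * L ^+ 2 = e * (L ^+ 2 / (L ^+ 2 + 1)).
    by rewrite /k; field; rewrite gt_eqF.
  rewrite ger_pMr// ler_pdivrMr// mul1r lerDl; exact: ler01.
(* Halving both sides divides this bound by 4, so the bounds of the four quarters add up exactly to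
   that of the whole. *)
pose P a b c d := modulus (bint g a b c d) <= 4 * k * (((b - a) + (d - c)) ^+ 2).
suff : P a b c d by [].
apply: (@rectangle_induction _ P a b c d) => //.
- move=> a' b' c' d' aa ab' bb cc cd' dd m n P1 P2 P3 P4; rewrite /P.
  have gc' : rcont g a' b' c' d' by exact: rcont_sub gc.
  have mP : a' <= m <= b' by rewrite /m; lra.
  have nP : c' <= n <= d' by rewrite /n; lra.
  rewrite (bint_hsplit (m := m))//.
  rewrite (bint_vsplit (n := n))//; last 2 first.
    by case/andP: mP.
    by apply: rcont_sub gc'; lra.
  rewrite (bint_vsplit (b := b') (n := n))//; last 2 first.
    by case/andP: mP.
    by apply: rcont_sub gc'; lra.
  have -> : 4 * k * (b' - a' + (d' - c')) ^+ 2 =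
    (4 * k * ((m - a') + (n - c')) ^+ 2 + 4 * k * ((m - a') + (d' - n)) ^+ 2) +
    (4 * k * ((b' - m) + (n - c')) ^+ 2 + 4 * k * ((b' - m) + (d' - n)) ^+ 2).
    by rewrite /m /n; field.
  apply: le_trans (le_modulusD _ _) _; apply: lerD;
    by apply: le_trans (le_modulusD _ _) _; apply: lerD.
- move=> x y xP yP; have [l lP] := gd x y xP yP.
  (* Two sides below r / 2 keep every point of the rectangle at distance less than r from x + iy. *)
  have [r r0 rP] := lP _ k0; exists (r / 2); first lra.
  move=> a' b' c' d' h1 h2 h3 h4 h5 h6 h7 h8 h9 h10; rewrite /P.
  have -> : 4 * k * (b' - a' + (d' - c')) ^+ 2 =
    4 * (k * (b' - a' + (d' - c'))) * (b' - a' + (d' - c')) by ring.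
  apply: (bint_affine_bound (al := g (x +i* y) - l * (x +i* y)) (be := l)); try lra.
    by apply: rcont_sub gc; lra.
  move=> s t sP tP.
  pose h := (s - x) +i* (t - y).
  have sth : s +i* t = x +i* y + h.
    by apply: complexP; rewrite /= ?cReD ?cImD /=; ring.
  have hb : modulus h <= b' - a' + (d' - c').
    apply: le_trans (modulus_le _) _; apply: lerD => /=; rewrite ler_norml; lra.
  rewrite sth; have -> : g (x +i* y + h) - (g (x +i* y) - l * (x +i* y) + l * (x +i* y + h)) =
    g (x +i* y + h) - g (x +i* y) - l * h by ring.
  apply: le_trans (rP h _) _; first by apply: le_lt_trans hb _; lra.
  by rewrite ler_pM2l.
Qed.

End Goursat.

Section ComplexDerivable.
Variable R : realType.
Implicit Types (f g : R[i] -> R[i]) (z : R[i]).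

Definition cdiff f z := exists l, has_cderiv f z l.

Lemma cdiffP f z : derivable (f : R[i]^o -> R[i]^o) z 1 <-> cdiff f z.
Proof. exact: derivable_cderivP. Qed.

Lemma analytic_cdiff f : analytic_on_disk f <-> forall z, disk z -> cdiff f z.
Proof. by split => H z /H /cdiffP. Qed.

Lemma cdiff_cst (c : R[i]) z : cdiff (fun=> c) z.
Proof. by apply/cdiffP; exact: derivable_cst. Qed.

Lemma cdiff_id z : cdiff id z.
Proof. by apply/cdiffP; exact: derivable_id. Qed.

Lemma cdiffD f g z : cdiff f z -> cdiff g z -> cdiff (fun x => f x + g x) z.
Proof. by move=> /cdiffP fz /cdiffP gz; apply/cdiffP; exact: (derivableD fz gz). Qed.

Lemma cdiffN f z : cdiff f z -> cdiff (fun x => - f x) z.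
Proof. by move=> /cdiffP fz; apply/cdiffP; exact: (derivableN fz). Qed.

Lemma cdiffB f g z : cdiff f z -> cdiff g z -> cdiff (fun x => f x - g x) z.
Proof. by move=> fz gz; exact: (cdiffD fz (cdiffN gz)). Qed.

Lemma cdiffM f g z : cdiff f z -> cdiff g z -> cdiff (fun x => f x * g x) z.
Proof. by move=> /cdiffP fz /cdiffP gz; apply/cdiffP; exact: (derivableM fz gz). Qed.

Lemma cdiffX f n z : cdiff f z -> cdiff (fun x => f x ^+ n) z.
Proof.
move=> fz; elim: n => [|n IH]; first exact: cdiff_cst.
rewrite (_ : (fun s => _) = (fun s => f s * f s ^+ n)); last first.
  by apply/funext => s; rewrite exprS.
exact: (cdiffM fz IH).
Qed.

Lemma cdiffV f z : f z != 0 -> cdiff f z -> cdiff (fun x => (f x)^-1) z.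
Proof. by move=> f0 /cdiffP fz; apply/cdiffP; exact: (derivableV f0 fz). Qed.

Lemma cdiff_sum (I : Type) (r : seq I) (F : I -> R[i] -> R[i]) z :
  (forall i, cdiff (F i) z) -> cdiff (fun x => \sum_(i <- r) F i x) z.
Proof.
move=> H; elim: r => [|i r IH].
  rewrite (_ : (fun s => _) = fun=> 0); first exact: cdiff_cst.
  by apply/funext => s; rewrite big_nil.
rewrite (_ : (fun s => _) = fun s => F i s + \sum_(i <- r) F i s).
  exact: (cdiffD (H i) IH).
by apply/funext => s; rewrite big_cons.
Qed.

Lemma cdiff_comp f g z : cdiff f z -> cdiff g (f z) -> cdiff (fun x => g (f x)) z.
Proof.
move=> [k fk] [l gl]; exists (l * k) => e e0.
have K0 := modulus_ge0 k; have L0 := modulus_ge0 l.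
(* Half of e is left for each remainder: [e1] for that of f, multiplied by |l|, and [e2] for that of
   g, taken at an increment of size at most (1 + |k|) |h|. *)
pose e1 := e / (2 * (1 + modulus l)).
have e10 : 0 < e1 by rewrite divr_gt0//; lra.
pose e2 := e / (2 * (1 + modulus k)).
have e20 : 0 < e2 by rewrite divr_gt0//; lra.
have [r r0 rP] := fk _ e10; have [r' r'0 r'P] := fk _ ltr01.
have [q q0 qP] := gl _ e20.
exists (Num.min (Num.min r r') (q / (1 + modulus k))).
  by rewrite !lt_min r0 r'0 divr_gt0//; lra.
move=> h; rewrite !lt_min => /andP[/andP[/rP h1 /r'P h2]].
rewrite ltr_pdivlMr; last lra.
move=> h3; set w := f (z + h) - f z in h1 h2.
have wb : modulus w <= (1 + modulus k) * modulus h.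
  rewrite (_ : w = (w - k * h) + k * h); last by ring.
  apply: le_trans (le_modulusD _ _) _; rewrite modulusM mulrDl mul1r.
  by rewrite lerD// -[leRHS]mul1r.
have /qP : modulus w < q by apply: le_lt_trans wb _; rewrite mulrC.
rewrite (_ : f z + w = f (z + h)); last by rewrite /w; ring.
move=> h4.
rewrite (_ : g _ - g _ - _ = (g (f (z + h)) - g (f z) - l * w) + l * (w - k * h)); last by ring.
apply: le_trans (le_modulusD _ _) _; rewrite modulusM.
have H0 := modulus_ge0 h.
have A : modulus l * modulus (w - k * h) <= e / 2 * modulus h.
  apply: (@le_trans _ _ (modulus l * (e1 * modulus h))); first by rewrite ler_wpM2l.
  rewrite mulrA ler_wpM2r//.
  rewrite (_ : modulus l * e1 = (e / 2) * (modulus l / (1 + modulus l))); last first.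
    by rewrite /e1; field; lra.
  by rewrite ger_pMr ?ler_pdivrMr; lra.
have B : e2 * modulus w <= e / 2 * modulus h.
  apply: (@le_trans _ _ (e2 * ((1 + modulus k) * modulus h))); first by rewrite ler_pM2l.
  by rewrite mulrA ler_wpM2r// /e2 (_ : _ / _ * _ = e / 2)//; field; lra.
lra.
Qed.

Lemma cdiff_ccont f z : cdiff f z -> ccont f z.
Proof. by case=> l; exact: has_cderiv_cont. Qed.

End ComplexDerivable.

(** * The complex exponential *)

Section ComplexExp.
Variable R : realType.

Lemma is_derive0_eps (f : R -> R) (d : R) : is_derive (0 : R) 1 f d ->
  forall e : R, 0 < e -> exists2 r : R, 0 < r & forall h, `|h| < r ->
    `|f h - f 0 - d * h| <= e * `|h|.
Proof.
move=> [/cvg_ex[/= l lP]] dl e e0.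
have {dl} ld : l = d by rewrite -dl; apply/esym/cvg_lim.
move/cvgrPdist_le: lP => /(_ _ e0).
rewrite near_withinE /= => /nbhs_ballP[/= r r0 rP].
exists r => // h hr; have [->|h0] := eqVneq h 0.
  by rewrite subrr mulr0 subr0 normr0 mulr0.
have := rP h; rewrite -ball_normE /ball_ /= sub0r normrN => /(_ hr h0) H.
rewrite (_ : f h - f 0 - d * h = - ((d - h^-1 *: (f (h *: 1 + 0) - f 0)) * h)).
  by rewrite normrN normrM ler_wpM2r// -ld.
by rewrite /GRing.scale /= mulr1 addr0; field.
Qed.

Definition cexp (z : R[i]) : R[i] :=
  (expR (Re z) * cos (Im z)) +i* (expR (Re z) * sin (Im z)).

Lemma cexpD z1 z2 : cexp (z1 + z2) = cexp z1 * cexp z2.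
Proof.
apply: complexP; rewrite ?cReM ?cImM /= cReD cImD expRD ?cosD ?sinD; ring.
Qed.

(** By the addition formula it suffices to expand at 0, where the real derivatives of exp, cos and
    sin give the first-order terms. *)
Lemma cdiff_cexp z : cdiff cexp z.
Proof.
exists (cexp z) => e e0.
pose k := modulus (cexp z).
have k0 : 0 <= k := modulus_ge0 _.
(* The estimates [A] and [B] below carry coefficients 1 on e' |s| and 3 + 4 + 1 on e' |t|, at most 9
   in all. The cap at 1 gives exp s <= 3 and turns e' |s| into |s| where needed. *)
pose e' := Num.min 1 (e / (9 * (1 + k))).
have e'0 : 0 < e' by rewrite lt_min ltr01 divr_gt0//; lra.
have e'1 : e' <= 1 by rewrite ge_min lexx.
have ke : 9 * k * e' <= e.
  apply: (@le_trans _ _ (9 * k * (e / (9 * (1 + k))))).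
    by rewrite ler_wpM2l ?ge_min ?lexx ?orbT//; lra.
  rewrite (_ : _ * (e / _) = e * (k / (1 + k))); last by field; lra.
  by rewrite ger_pMr ?ler_pdivrMr; lra.
clearbody e'.
have [r1 r10 R1] := is_derive0_eps (is_derive_expR 0) e'0.
have [r2 r20 R2] := is_derive0_eps (is_derive_cos 0) e'0.
have [r3 r30 R3] := is_derive0_eps (is_derive_sin 0) e'0.
exists (Num.min (Num.min e' r1) (Num.min r2 r3)).
  by rewrite !lt_min e'0 r10 r20 r30.
move=> h; rewrite !lt_min => /andP[/andP[he h1] /andP[h2 h3]].
rewrite cexpD (_ : _ - _ - _ = cexp z * (cexp h - 1 - h)); last by ring.
rewrite modulusM -/k.
have := le_Re_modulus h; have := le_Im_modulus h.
set s := Re h; set t := Im h => tm sm.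
have := R1 s (le_lt_trans sm h1); rewrite expR0 mul1r => E1.
have := R2 t (le_lt_trans tm h2); rewrite cos0 sin0 oppr0 mul0r subr0 => E2.
have := R3 t (le_lt_trans tm h3); rewrite sin0 cos0 mul1r subr0 => E3.
have se : `|s| < e' by exact: le_lt_trans he.
suff : modulus (cexp h - 1 - h) <= 9 * e' * modulus h.
  move=> H; apply: le_trans (ler_wpM2l k0 H) _.
  rewrite !mulrA ler_wpM2r ?modulus_ge0//; move: ke; lra.
apply: le_trans (modulus_le _) _; rewrite !cReD !cImD !cReN !cImN /= oppr0 addr0.
rewrite -/s -/t.
have S1 : `|expR s - 1| <= 2 * `|s|.
  rewrite (_ : expR s - 1 = (expR s - 1 - s) + s); last by ring.
  apply: le_trans (ler_normD _ _) _; have := normr_ge0 s; nra.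
have S2 : expR s <= 3.
  have := ler_norm (expR s - 1); have : `|s| <= 1 by lra.
  by lra.
have T1 : `|sin t| <= 2 * `|t|.
  rewrite (_ : sin t = (sin t - t) + t); last by ring.
  apply: le_trans (ler_normD _ _) _; have := normr_ge0 t; nra.
have S0 := normr_ge0 s; have T0 := normr_ge0 t.
have A : `|expR s * cos t - 1 - s| <= e' * `|s| + 3 * (e' * `|t|).
  rewrite (_ : _ - s = (expR s - 1 - s) + expR s * (cos t - 1)); last by ring.
  apply: le_trans (ler_normD _ _) _; apply: lerD => //.
  rewrite normrM ger0_norm ?expR_ge0//.
  by apply: ler_pM => //; exact: expR_ge0.
have B : `|expR s * sin t - t| <= 4 * (e' * `|t|) + e' * `|t|.
  rewrite (_ : _ - t = (expR s - 1) * sin t + (sin t - t)); last by ring.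
  apply: le_trans (ler_normD _ _) _; apply: lerD => //.
  rewrite normrM; apply: (@le_trans _ _ ((2 * `|s|) * (2 * `|t|))).
    by apply: ler_pM.
  nra.
nra.
Qed.

End ComplexExp.

(** * Means over circles *)

Section Circle.
Variable R : realType.
Implicit Types (g : R[i] -> R[i]) (r t : R) (z : R[i]).

Definition pt r t : R[i] := r * cos t +i* (r * sin t).

Lemma modulus_pt r t : 0 <= r -> modulus (pt r t) = r.
Proof.
move=> r0; rewrite modulusE /= !exprMn -mulrDr cos2Dsin2 mulr1 sqrtr_sqr.
exact: ger0_norm.
Qed.

Lemma cexp_pt r t : 0 < r -> cexp (ln r +i* t) = pt r t.
Proof. by move=> r0; rewrite /cexp /= lnK. Qed.

Lemma pcont_pt r t : pcont (pt r) t.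
Proof.
split => /=; apply: continuousM; try exact: cvg_cst.
- exact: continuous_cos.
- exact: continuous_sin.
Qed.

Lemma pt_2pi r : pt r (2 * pi) = pt r 0.
Proof. by rewrite /pt mulr_natl cos2pi sin2pi cos0 sin0. Qed.

Let pi20 : 0 <= 2 * pi :> R. Proof. by rewrite mulr_ge0// pi_ge0. Qed.

Definition cmean g r : R[i] := ((2 * pi)^-1)%:C * cint 0 (2 * pi) (g \o pt r).

Definition ccirc g r := forall z, modulus z = r -> ccont g z.

Lemma ccirc_pconts g r a b : 0 <= r -> ccirc g r -> pconts a b (g \o pt r).
Proof.
move=> r0 gc t _; apply: pcont_comp; last exact: pcont_pt.
by apply: gc; rewrite modulus_pt.
Qed.

Lemma le_modulus_cmean g r M : pconts 0 (2 * pi) (g \o pt r) ->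
  (forall t, modulus (g (pt r t)) <= M) -> modulus (cmean g r) <= 2 * M.
Proof.
move=> gc gM; rewrite /cmean modulusM modulus_real ger0_norm ?invr_ge0//.
rewrite ler_pdivrMl ?mulr_gt0 ?pi_gt0//.
have -> : 2 * pi * (2 * M) = 2 * M * (2 * pi - 0) by ring.
exact: (le_modulus_cint pi20 gc (fun t _ => gM t)).
Qed.

Lemma cmean_cst (c : R[i]) r : cmean (fun=> c) r = c.
Proof.
rewrite /cmean cint_cst// subr0 mulrCA -rmorphM mulVf ?mulr1//.
by rewrite mulf_neq0 ?gt_eqF// pi_gt0.
Qed.

Lemma cmeanB g1 g2 r : pconts 0 (2 * pi) (g1 \o pt r) ->
  pconts 0 (2 * pi) (g2 \o pt r) ->
  cmean (fun z => g1 z - g2 z) r = cmean g1 r - cmean g2 r.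
Proof. by move=> h1 h2; rewrite /cmean -mulrBr -cintB. Qed.

Lemma cmeanD g1 g2 r : pconts 0 (2 * pi) (g1 \o pt r) ->
  pconts 0 (2 * pi) (g2 \o pt r) ->
  cmean (fun z => g1 z + g2 z) r = cmean g1 r + cmean g2 r.
Proof. by move=> h1 h2; rewrite /cmean -mulrDr -cintD. Qed.

Lemma cmeanZ g c r : pconts 0 (2 * pi) (g \o pt r) ->
  cmean (fun z => c * g z) r = c * cmean g r.
Proof. by move=> h1; rewrite /cmean mulrCA -(cintZ c h1). Qed.

Lemma cmean_conj g r : pconts 0 (2 * pi) (g \o pt r) ->
  cmean (fun z => (g z)^*%C) r = (cmean g r)^*%C.
Proof.
move=> h1; rewrite /cmean (cint_conj h1) rmorphM; congr (_ * _).
by apply: complexP => //=; rewrite oppr0.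
Qed.

Lemma eq_cmean g1 g2 r : 0 <= r -> (forall z, modulus z = r -> g1 z = g2 z) ->
  cmean g1 r = cmean g2 r.
Proof.
move=> r0 H; rewrite /cmean; congr (_ * _); apply: eq_cint => t _ /=.
by apply: H; rewrite modulus_pt.
Qed.

(** The exponential maps [ln r1, ln r2] x [0, 2 pi] onto the annulus. Applying [goursat] to g o exp
    there, the horizontal sides cancel by periodicity and the vertical sides are the two circle
    integrals. *)
Lemma cmean_radius g (r0 r1 r2 : R) : 0 < r1 -> r1 <= r2 -> r2 < r0 ->
  (forall z, 0 < modulus z < r0 -> cdiff g z) -> cmean g r1 = cmean g r2.
Proof.
move=> r10 r12 r20 gd; congr (_ * _).
have r2p := lt_le_trans r10 r12.
have lnr : ln r1 <= ln r2 by rewrite ler_ln ?posrE.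
have : bint (g \o @cexp R) (ln r1) (ln r2) 0 (2 * pi) = 0.
  apply: goursat => // x y xP yP.
  apply: cdiff_comp; first exact: cdiff_cexp.
  apply: gd; rewrite -[x]expRK cexp_pt ?expR_gt0// modulus_pt ?expR_ge0// expR_gt0 /=.
  apply: le_lt_trans r20; case/andP: xP => _.
  by rewrite -ler_expR (lnK r2p).
rewrite /bint (eq_cint (g1 := fun x => _ (_ +i* 0) - _) (g2 := fun=> 0)); last first.
  move=> t _; rewrite /= -[t]expRK.
  by rewrite !cexp_pt ?expR_gt0// pt_2pi subrr.
rewrite cint_cst// mul0r add0r => /eqP; rewrite mulf_eq0 eq_complex /= oner_eq0 andbF /=.
rewrite (eq_cint (g2 := fun t => (g \o pt r2) t - (g \o pt r1) t)); last first.
  by move=> t _; rewrite /= !cexp_pt.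
rewrite cintB.
- by rewrite subr_eq0 => /eqP ->.
- apply: ccirc_pconts; first exact: ltW.
  by move=> z zr; apply: cdiff_ccont; apply: gd; rewrite zr r2p.
- apply: ccirc_pconts; first exact: ltW.
  move=> z zr; apply: cdiff_ccont; apply: gd; rewrite zr r10.
  exact: le_lt_trans r20.
Qed.

(** The mean does not change when the radius shrinks, and on a small circle g is close to g 0. *)
Lemma cmean_value g (r0 r : R) : 0 < r -> r < r0 ->
  (forall z, modulus z < r0 -> cdiff g z) -> cmean g r = g 0.
Proof.
move=> rp rr0 gd; apply/eqP; rewrite -subr_eq0 -modulus_eq0 eq_le modulus_ge0.
rewrite andbT; apply/ler_addgt0Pr => e e0; rewrite add0r.
have r00 := lt_trans rp rr0.
have e20 : 0 < e / 2 by rewrite divr_gt0.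
have m0 : modulus (0 : R[i]) < r0 by rewrite modulus0.
have [q q0 qP] := cdiff_ccont (gd 0 m0) e20.
pose s := Num.min r (q / 2).
have s0 : 0 < s by rewrite lt_min rp divr_gt0.
have sr : s <= r by rewrite ge_min lexx.
have sq : s < q by rewrite gt_min; apply/orP; right; lra.
have gs : pconts 0 (2 * pi) (g \o pt s).
  apply: ccirc_pconts; first exact: ltW.
  by move=> z zs; apply: cdiff_ccont; apply: gd; rewrite zs; lra.
rewrite -(cmean_radius s0 sr rr0); last by move=> z /andP[_]; exact: gd.
rewrite -(cmean_cst (g 0) s) -cmeanB//; last by move=> t _; exact: pcont_cst.
rewrite (_ : e = 2 * (e / 2)); last by field.
apply: le_modulus_cmean.
  by apply: pcontsB => // t _; exact: pcont_cst.
move=> t; apply: ltW; rewrite -[pt s t]add0r; apply: qP.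
by rewrite modulus_pt// ltW.
Qed.

End Circle.

(** * Power series and Parseval's identity *)

Section SquareMean.
Variable R : realType.
Implicit Types (f g h : R[i] -> R[i]) (r : R) (z : R[i]).

Definition M2 h r : R :=
  (2 * pi)^-1 * rint 0 (2 * pi) (fun t => modulus (h (pt r t)) ^+ 2).

Definition circ h r := pconts 0 (2 * pi) (h \o pt r).

Let pi20 : 0 <= 2 * pi :> R. Proof. by rewrite mulr_ge0// pi_ge0. Qed.
Let pi2p : 0 < 2 * pi :> R. Proof. by rewrite mulr_gt0// pi_gt0. Qed.

Lemma circ_cst c r : circ (fun=> c) r.
Proof. by move=> t _; exact: pcont_cst. Qed.

Lemma circ_id r : circ id r.
Proof. by move=> t _; exact: pcont_pt. Qed.

Lemma circD g h r : circ g r -> circ h r -> circ (fun z => g z + h z) r.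
Proof. by move=> gc hc t tP; apply: pcontD; [exact: gc|exact: hc]. Qed.

Lemma circB g h r : circ g r -> circ h r -> circ (fun z => g z - h z) r.
Proof. by move=> gc hc t tP; apply: pcontB; [exact: gc|exact: hc]. Qed.

Lemma circM g h r : circ g r -> circ h r -> circ (fun z => g z * h z) r.
Proof. by move=> gc hc t tP; apply: pcontM; [exact: gc|exact: hc]. Qed.

Lemma circX h r n : circ h r -> circ (fun z => h z ^+ n) r.
Proof. by move=> hc t tP; apply: pcontX; exact: hc. Qed.

Lemma circ_conj h r : circ h r -> circ (fun z => (h z)^*%C) r.
Proof. by move=> hc t tP; apply: pcont_conj; exact: hc. Qed.

Lemma circV h r : 0 <= r -> (forall z, modulus z = r -> h z != 0) -> circ h r ->
  circ (fun z => (h z)^-1) r.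
Proof.
move=> r0 h0 hc t tP; apply: pcontV; last exact: hc.
by rewrite /= h0// modulus_pt.
Qed.

Lemma circ_sum (I : Type) (s : seq I) (F : I -> R[i] -> R[i]) r :
  (forall i, circ (F i) r) -> circ (fun z => \sum_(i <- s) F i z) r.
Proof. by move=> H t tP; apply: pcont_sum => i; exact: H. Qed.

Lemma circ_cdiff h r : 0 <= r -> (forall z, modulus z = r -> cdiff h z) ->
  circ h r.
Proof. by move=> r0 H; apply: ccirc_pconts => // z /H; exact: cdiff_ccont. Qed.

Lemma conts_sqr_modulus h r : circ h r ->
  conts 0 (2 * pi) (fun t => modulus (h (pt r t)) ^+ 2).
Proof. by move=> hc t tP; apply: pcont_sqr_modulus; exact: hc. Qed.

Lemma M2_ge0 h r : 0 <= M2 h r.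
Proof.
by rewrite mulr_ge0 ?invr_ge0//; apply: rint_ge0 => t _; rewrite sqr_ge0.
Qed.

Lemma le_M2 g h r : circ g r -> circ h r -> 0 <= r ->
  (forall z, modulus z = r -> modulus (g z) <= modulus (h z)) ->
  M2 g r <= M2 h r.
Proof.
move=> gc hc r0 gh; rewrite ler_wpM2l ?invr_ge0//.
apply: le_rint; try exact: conts_sqr_modulus.
by move=> t _; rewrite ler_pXn2r ?nnegrE ?modulus_ge0// gh// modulus_pt.
Qed.

Lemma eq_M2 g h r : 0 <= r -> (forall z, modulus z = r -> g z = h z) ->
  M2 g r = M2 h r.
Proof.
move=> r0 gh; rewrite /M2; congr (_ * _); apply: eq_rint => t _.
by rewrite gh// modulus_pt.
Qed.

Lemma M2_cst (c : R[i]) r : M2 (fun=> c) r = modulus c ^+ 2.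
Proof. by rewrite /M2 rint_cst// subr0 mulrCA mulVf ?mulr1// gt_eqF. Qed.

Lemma M2Z c h r : circ h r -> M2 (fun z => c * h z) r = modulus c ^+ 2 * M2 h r.
Proof.
move=> hc; rewrite /M2 mulrCA -(rintZ _ (conts_sqr_modulus hc)).
by congr (_ * _); apply: eq_rint => t _; rewrite modulusM exprMn.
Qed.

Lemma M2E h r : cmean (fun z => h z * (h z)^*%C) r = (M2 h r)%:C.
Proof.
rewrite /cmean /M2 rmorphM; congr (_ * _).
apply: complexP => /=.
  by apply: eq_rint => t _; rewrite conjM_modulus.
rewrite (eq_rint (h2 := fun=> 0)); last first.
  by move=> t _ /=; rewrite conjM_modulus.
by rewrite rint_cst// mul0r.
Qed.

(** The n-th Fourier coefficient of h on the circle divided by r^n, which for analytic h is the n-th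
    Taylor coefficient. *)
Definition fcoef h n r := cmean (fun z => h z * (z ^+ n)^-1) r.
Arguments fcoef : simpl never.

Lemma conj_circle z r : modulus z = r -> z^*%C * z = (r ^+ 2)%:C.
Proof. by move=> <-; rewrite mulrC conjM_modulus. Qed.

Lemma conj_circleV z r : 0 < r -> modulus z = r ->
  z^*%C = (r ^+ 2)%:C * z^-1.
Proof.
move=> r0 zr; rewrite -(conj_circle zr) mulfK//.
by rewrite -modulus_eq0 zr gt_eqF.
Qed.

Lemma circ_neq0 z r : 0 < r -> modulus z = r -> z != 0.
Proof. by move=> r0 zr; rewrite -modulus_gt0 zr. Qed.

Lemma circ_fcoef h n r : 0 < r -> circ h r -> circ (fun z => h z * (z ^+ n)^-1) r.
Proof.
move=> r0 hc; apply: (circM hc); apply: circV; first exact: ltW.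
  by move=> z zr; rewrite expf_neq0// (circ_neq0 r0).
by apply: circX; exact: circ_id.
Qed.

Lemma cmeanX n r : 0 < r -> cmean (fun z => z ^+ n) r = (n == 0%N)%:R.
Proof.
move=> r0; rewrite (@cmean_value _ _ (r + 1))//; first by rewrite expr0n.
  by rewrite ltrDl.
by move=> z _; apply: cdiffX; exact: cdiff_id.
Qed.

(** On the circle 1 / z is the conjugate of z divided by r^2, which reduces to the conjugate of
    [cmeanX]. *)
Lemma cmeanXV n r : 0 < r -> cmean (fun z => (z ^+ n)^-1) r = (n == 0%N)%:R.
Proof.
move=> r0; have r00 := ltW r0.
have cr : circ (fun z => z ^+ n) r by apply: circX; exact: circ_id.
have rn : ((r ^+ 2)%:C ^+ n : R[i]) != 0.
  by rewrite expf_neq0// -modulus_gt0 modulus_real normr_gt0 expf_neq0// gt_eqF.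
rewrite (@eq_cmean _ _ (fun z => ((r ^+ 2)%:C ^+ n)^-1 * (z ^+ n)^*%C))//.
  rewrite cmeanZ; last exact: circ_conj.
  rewrite cmean_conj// cmeanX//; case: n rn {cr} => [|n] rn.
    by rewrite expr0 invr1 mul1r; exact: (conj_real (1 : R)).
  by rewrite (_ : conjc _ = 0) ?mulr0//; exact: (conj_real (0 : R)).
move=> z zr; rewrite conjX (conj_circleV r0 zr) exprMn mulKf//.
by rewrite exprVn.
Qed.

Lemma fcoefX m n r : 0 < r -> fcoef (fun z => z ^+ m) n r = (m == n)%:R.
Proof.
move=> r0; rewrite /fcoef; have [nm|mn] := leqP n m.
  rewrite (@eq_cmean _ _ (fun z => z ^+ (m - n)))//; last 2 first.
    exact: ltW.
    by move=> z /(circ_neq0 r0) z0; rewrite expfB_cond ?(negbTE z0).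
  by rewrite cmeanX// subn_eq0 eqn_leq nm andbT.
rewrite (@eq_cmean _ _ (fun z => (z ^+ (n - m))^-1)); last 2 first.
  exact: ltW.
  move=> z /(circ_neq0 r0) z0; rewrite -{1}(subnK (ltnW mn)) exprD invfM mulrC.
  by rewrite -mulrA mulVf ?mulr1// expf_neq0.
by rewrite cmeanXV// subn_eq0 leqNgt mn /=; case: ltngtP mn.
Qed.

Lemma fcoefB g h n r : 0 < r -> circ g r -> circ h r ->
  fcoef (fun z => g z - h z) n r = fcoef g n r - fcoef h n r.
Proof.
move=> r0 gc hc; rewrite /fcoef -cmeanB; try exact: circ_fcoef.
by apply: eq_cmean; [exact: ltW|move=> z _; rewrite mulrBl].
Qed.

Lemma fcoefZ c h n r : 0 < r -> circ h r ->
  fcoef (fun z => c * h z) n r = c * fcoef h n r.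
Proof.
move=> r0 hc; rewrite /fcoef -cmeanZ; last exact: circ_fcoef.
by apply: eq_cmean; [exact: ltW|move=> z _; rewrite mulrA].
Qed.

(** Pythagoras: c z^n with c = [fcoef h n r] is the orthogonal projection of h on z^n, whose squared
    norm on the circle is r^(2n). *)
Lemma M2_sub_monomial h n r : 0 < r -> circ h r ->
  M2 (fun z => h z - fcoef h n r * z ^+ n) r =
  M2 h r - modulus (fcoef h n r) ^+ 2 * r ^+ (2 * n).
Proof.
move=> r0 hc; have r00 := ltW r0; have [c cE] : {c | fcoef h n r = c} by exists (fcoef h n r).
rewrite !cE.
have xc : circ (fun z => z ^+ n) r by apply: circX; exact: circ_id.
apply: (@complexI R); rewrite -M2E realcB realcM -M2E.
(* On the circle this is h z times the conjugate of c z^n, the cross term of the square; written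
   with z^-n its mean is visibly a multiple of [fcoef]. *)
pose u z := (r ^+ (2 * n))%:C * c^*%C * (h z * (z ^+ n)^-1).
rewrite (@eq_cmean _ _ (fun z => h z * (h z)^*%C - (u z + (u z)^*%C) +
    (modulus c ^+ 2)%:C * (r ^+ (2 * n))%:C))//; last first.
  move=> z zr; rewrite conjB conjM conjX.
  have zn : z^*%C ^+ n = (r ^+ (2 * n))%:C * (z ^+ n)^-1.
    by rewrite (conj_circleV r0 zr) exprMn exprM exprVn !realcX.
  have zz : z ^+ n * z^*%C ^+ n = (r ^+ (2 * n))%:C.
    by rewrite -exprMn mulrC (conj_circle zr) exprM !realcX.
  have z0 := circ_neq0 r0 zr.
  have -> : (u z)^*%C = c * (h z)^*%C * z ^+ n.
    rewrite /u !conjM conjV conjX conj_real -zz conjcK.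
    have : z^*%C != 0 by rewrite conj_eq0.
    move: (z^*%C) ((h z)^*%C) => w k w0.
    by rewrite -!mulrA; field; rewrite expf_neq0.
  rewrite /u; have -> : (r ^+ (2 * n))%:C * c^*%C * (h z * (z ^+ n)^-1) =
    c^*%C * h z * z^*%C ^+ n by rewrite zn; ring.
  by rewrite -conjM_modulus -zz; ring.
have uc : circ u r.
  by apply: circM; [exact: circ_cst|exact: circ_fcoef].
have ucc : circ (fun z => (u z)^*%C) r by exact: circ_conj.
have hh : circ (fun z => h z * (h z)^*%C) r.
  exact: (circM hc (circ_conj hc)).
have uuc : circ (fun z => u z + (u z)^*%C) r by exact: circD.
rewrite (cmeanD (circB hh uuc) (circ_cst _ _)) (cmeanB hh uuc) (cmeanD uc ucc).
rewrite cmean_cst (cmean_conj uc).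
have -> : cmean u r = (r ^+ (2 * n))%:C * (modulus c ^+ 2)%:C.
  rewrite /u cmeanZ; last exact: circ_fcoef.
  by rewrite -/(fcoef h n r) cE -mulrA [c^*%C * c]mulrC conjM_modulus.
by rewrite conjM !conj_real; ring.
Qed.

Definition psum (b : nat -> R[i]) N z := \sum_(n < N) b n * z ^+ n.

Lemma circ_psum b N r : circ (psum b N) r.
Proof.
apply: circ_sum => i; apply: circM; first exact: circ_cst.
by apply: circX; exact: circ_id.
Qed.

Lemma psumS b N z : psum b N.+1 z = psum b N z + b N * z ^+ N.
Proof. by rewrite /psum big_ord_recr. Qed.

Lemma fcoef_psum b N n r : 0 < r -> fcoef (psum b N) n r = if (n < N)%N then b n else 0.
Proof.
move=> r0; elim: N => [|N IH].
  rewrite /fcoef (@eq_cmean _ _ (fun=> 0)) ?cmean_cst//; first exact: ltW.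
  by move=> z _; rewrite /psum big_ord0 mul0r.
rewrite /fcoef (@eq_cmean _ _ (fun z => psum b N z * (z ^+ n)^-1 + b N * (z ^+ N * (z ^+ n)^-1))).
- have xc : circ (fun z => z ^+ N) r by apply: circX; exact: circ_id.
  rewrite cmeanD; last 2 first.
  + by apply: circ_fcoef => //; exact: circ_psum.
  + by apply: circM; [exact: circ_cst|exact: circ_fcoef].
  rewrite cmeanZ; last exact: circ_fcoef.
  rewrite -/(fcoef (psum b N) n r) IH -/(fcoef (fun z => z ^+ N) n r) fcoefX// ltnS.
  have [->|nN] := eqVneq N n; first by rewrite ltnn leqnn mulr1 add0r.
  by rewrite mulr0 addr0 [(n < N)%N]ltn_neqAle eq_sym nN.
- exact: ltW.
- by move=> z _; rewrite psumS; ring.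
Qed.

(** Subtracting the first N monomials leaves the N-th coefficient unchanged, so [M2_sub_monomial]
    can be applied repeatedly. *)
Lemma bessel h N r : 0 < r -> circ h r ->
  M2 (fun z => h z - psum (fun n => fcoef h n r) N z) r =
  M2 h r - \sum_(n < N) modulus (fcoef h n r) ^+ 2 * r ^+ (2 * n).
Proof.
move=> r0 hc; elim: N => [|N IH].
  rewrite big_ord0 subr0; apply: eq_M2; first exact: ltW.
  by move=> z _; rewrite /psum big_ord0 subr0.
rewrite big_ord_recr /= opprD addrA -IH.
have pc := circ_psum (fun n => fcoef h n r) N r.
set p := psum (fun n => fcoef h n r) N in pc *.
have e : fcoef (fun z => h z - p z) N r = fcoef h N r.
  by rewrite fcoefB// fcoef_psum// ltnn subr0.
rewrite -e -M2_sub_monomial//; last exact: circB.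
apply: eq_M2; first exact: ltW.
by move=> z _; rewrite e psumS opprD addrA.
Qed.

Lemma bessel_le h N r : 0 < r -> circ h r ->
  \sum_(n < N) modulus (fcoef h n r) ^+ 2 * r ^+ (2 * n) <= M2 h r.
Proof. by move=> r0 hc; rewrite -subr_ge0 -bessel// M2_ge0. Qed.

Lemma bounded_sum_cvg0 (u : nat -> R) B : (forall n, 0 <= u n) ->
  (forall N, \sum_(n < N) u n <= B) -> u @ \oo --> 0.
Proof.
move=> u0 uB; apply: cvg_series_cvg_0.
apply: nondecreasing_is_cvgn.
  apply/nondecreasing_seqP => n; rewrite /series /= big_nat_recr//= lerDl//.
exists B => _ [N _ <-]; rewrite /series /= big_mkord; exact: uB.
Qed.

(** The Riemann-Lebesgue lemma, from Bessel's inequality. Only indices n >= 0 are covered; the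
    others are reached by conjugating h. *)
Lemma fcoef_cvg0 h r : 0 < r -> circ h r ->
  (fun n => modulus (fcoef h n r) * r ^+ n) @ \oo --> 0.
Proof.
move=> r0 hc.
have : (fun n => modulus (fcoef h n r) ^+ 2 * r ^+ (2 * n)) @ \oo --> 0.
  apply: bounded_sum_cvg0 (fun N => bessel_le N r0 hc) => n.
  by rewrite mulr_ge0 ?sqr_ge0// exprn_ge0// ltW.
move/cvgrPdist_lt => H; apply/cvgrPdist_lt => e e0.
have e20 : 0 < e ^+ 2 by rewrite exprn_gt0.
apply: filterS (H _ e20) => n; rewrite !sub0r !normrN.
rewrite mulnC exprM -exprMn ger0_norm ?sqr_ge0//.
rewrite -real_normK ?num_real// ltr_pXn2r ?nnegrE//; exact: ltW.
Qed.

End SquareMean.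
Arguments fcoef : simpl never.
Arguments M2 : simpl never.
Arguments cmean : simpl never.

(** * Taylor series in the disk and Parseval's identity *)

Section PowerSeries.
Variable R : realType.
Implicit Types (f g h : R[i] -> R[i]) (r : R) (z : R[i]) (b : nat -> R[i]).

Lemma cdiff_an f z : analytic_on_disk f -> disk z -> cdiff f z.
Proof. by move/analytic_cdiff; exact. Qed.

(** The value at z0 is a parameter; taking it to be the derivative makes the quotient continuous
    there. *)
Definition diffq f l z0 z := if z == z0 then l else (f z - f z0) / (z - z0).

Lemma diffqM f l z0 z : f z - f z0 = diffq f l z0 z * (z - z0).
Proof.
rewrite /diffq; case: eqVneq => [->|zz]; first by rewrite !subrr mulr0.
by rewrite divfK// subr_eq0.
Qed.

Lemma ccont_eq_near f g z (r : R) : 0 < r ->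
  (forall w, modulus w < r -> f (z + w) = g (z + w)) -> ccont g z -> ccont f z.
Proof.
move=> r0 fg gz e /gz[q q0 qP]; exists (Num.min q r); first by rewrite lt_min q0.
move=> h; rewrite lt_min => /andP[/qP H hr].
by rewrite -[in f z](addr0 z) !fg ?addr0// modulus0.
Qed.

Lemma ccont_diffq f l z0 z : has_cderiv f z0 l -> cdiff f z ->
  ccont (diffq f l z0) z.
Proof.
move=> fl fz; have [->|zz0] := eqVneq z z0.
  move=> e e0; have e20 : 0 < e / 2 by rewrite divr_gt0.
  have [r r0 rP] := fl _ e20; exists r => // h /rP H.
  rewrite /diffq eqxx; case: eqVneq => [|hz]; first by rewrite subrr modulus0.
  have h0 : h != 0 by apply: contra hz => /eqP ->; rewrite addr0.
  rewrite [z0 + h - z0]addrC addKr.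
  apply: (@le_lt_trans _ _ (e / 2)); last by rewrite ltr_pdivrMr// ltr_pMr// ltr1n.
  rewrite -(ler_pM2r (_ : 0 < modulus h)) ?modulus_gt0// -modulusM.
  by rewrite mulrBl divfK.
have d0 : 0 < modulus (z - z0) by rewrite modulus_gt0 subr_eq0.
apply: (ccont_eq_near (g := fun z => (f z - f z0) * (z - z0)^-1) d0).
  move=> h hr; rewrite /diffq; case: eqVneq => // e.
  move: hr; rewrite (_ : h = z0 - z); last by rewrite -e addrC addKr.
  by rewrite modulusC ltxx.
apply: cdiff_ccont.
apply: (@cdiffM _ (fun z => f z - f z0) (fun z => (z - z0)^-1)).
  exact: (cdiffB fz (cdiff_cst (f z0) z)).
apply: (cdiffV (f := fun z => z - z0)); first by rewrite subr_eq0.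
exact: (cdiffB (cdiff_id z) (cdiff_cst z0 z)).
Qed.

(* The radius is immaterial: see fcoef_scoef. *)
Definition scoef f n : R[i] := fcoef f n 2^-1.

Lemma fcoef_scoef f n r : analytic_on_disk f -> 0 < r -> r < 1 ->
  fcoef f n r = scoef f n.
Proof.
move=> fa r0 r1; rewrite /scoef /fcoef.
have H z : 0 < modulus z < 1 -> cdiff (fun z => f z * (z ^+ n)^-1) z.
  move=> /andP[z0 z1]; apply: cdiffM; first exact: (cdiff_an fa).
  apply: (cdiffV (f := fun z => z ^+ n)).
    by rewrite expf_neq0// -modulus_gt0.
  by apply: cdiffX; exact: cdiff_id.
have h1 : (2^-1 : R) < 1 by rewrite invf_lt1// ltr1n.
have h0 : (0 : R) < 2^-1 by rewrite invr_gt0.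
have [rh|/ltW hr] := leP r 2^-1.
  exact: (cmean_radius r0 rh h1 H).
by apply/esym; exact: (cmean_radius h0 hr r1 H).
Qed.

Lemma circ_analytic f r : analytic_on_disk f -> 0 <= r -> r < 1 -> circ f r.
Proof.
by move=> fa r0 r1; apply: circ_cdiff => // z zr; apply: (cdiff_an fa); rewrite /disk /= zr.
Qed.

(* Chernoff's proof of the pointwise convergence of Fourier series: writing
   f z - f z0 = k z * (z - z0) with k continuous on the circle through z0 turns
   the partial sums into a telescope. *)
Lemma psum_scoef_telescope f z0 l N : analytic_on_disk f -> has_cderiv f z0 l ->
  0 < modulus z0 -> modulus z0 < 1 ->
  psum (scoef f) N.+1 z0 - f z0 = - (z0 ^+ N.+1 * fcoef (diffq f l z0) N (modulus z0)).
Proof.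
move=> fa fl; set r := modulus z0 => r0 r1; have r00 := ltW r0.
pose k := diffq f l z0.
have kc : circ k r.
  apply: ccirc_pconts => // z zr; apply: ccont_diffq => //; apply: (cdiff_an fa).
  by rewrite /disk /= zr.
have fc : circ f r by exact: circ_analytic.
pose kap n := fcoef k n r.
(* For m >= 1 these are the coefficients of [k] of negative index -m. They have to vanish for the
   telescope to close, although [k] is only known to be continuous at z0. *)
pose nu m := cmean (fun z => k z * z ^+ m) r.
have xc m : circ (fun z => z ^+ m) r by apply: circX; exact: circ_id.
have kxc m : circ (fun z => k z * z ^+ m) r by exact: circM.
have fcoefc n (c : R[i]) : fcoef (fun=> c) n r = c * (n == 0%N)%:R.
  rewrite /fcoef cmeanZ ?cmeanXV//.
  by apply: (circV r00 _ (xc n)) => z zr; rewrite expf_neq0// (circ_neq0 r0).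
have Ea n : scoef f n.+1 = kap n - z0 * kap n.+1.
  rewrite -(fcoef_scoef _ fa r0 r1).
  have -> : fcoef f n.+1 r = fcoef (fun z => f z - f z0) n.+1 r.
    by rewrite fcoefB ?fcoefc ?mulr0 ?subr0//; exact: circ_cst.
  rewrite /kap -fcoefZ// /fcoef -cmeanB; last 2 first.
  - exact: circ_fcoef.
  - exact: (circ_fcoef _ r0 (circM (circ_cst _ _) kc)).
  apply: eq_cmean => // z zr; rewrite (diffqM f l) -/(k z) exprS.
  by field; rewrite expf_neq0 ?(circ_neq0 r0 zr).
have E0 : scoef f 0 - f z0 = nu 1%N - z0 * kap 0%N.
  rewrite -(fcoef_scoef _ fa r0 r1).
  have -> : fcoef f 0 r - f z0 = fcoef (fun z => f z - f z0) 0 r.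
    by rewrite fcoefB ?fcoefc ?mulr1//; exact: circ_cst.
  rewrite /kap -fcoefZ// /fcoef /nu -(cmeanB (kxc 1%N)); last first.
    exact: (circ_fcoef _ r0 (circM (circ_cst _ _) kc)).
  apply: eq_cmean => // z zr; rewrite (diffqM f l) -/(k z) expr0 invr1 expr1.
  by ring.
(* k z (z - z0) is f z - f z0, so the difference of the two sides is the mean of (f z - f z0)
   z^(m+1), an analytic function vanishing at 0. *)
have En m : nu m.+2 = z0 * nu m.+1.
  apply/eqP; rewrite -subr_eq0; apply/eqP.
  rewrite /nu -(cmeanZ _ (kxc _)) -(cmeanB (kxc _)); last exact: (circM (circ_cst _ _) (kxc _)).
  rewrite (@eq_cmean _ _ (fun z => (f z - f z0) * z ^+ m.+1))//; last first.
    by move=> z zr; rewrite (diffqM f l) -/(k z) (exprS _ m.+1); ring.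
  rewrite (@cmean_value _ _ 1)//; first by rewrite expr0n mulr0.
  move=> z z1; apply: cdiffM; last by apply: cdiffX; exact: cdiff_id.
  exact: (cdiffB (cdiff_an fa z1) (cdiff_cst (f z0) z)).
have nuE m : nu m.+1 = z0 ^+ m * nu 1%N.
  by elim: m => [|m IH]; rewrite ?mul1r// En IH exprS mulrA.
(* Since |z0| = r, the recursion makes |nu (m+1)| / r^(m+1) constant in m, while Riemann-Lebesgue
   for the conjugate of [k] makes it tend to 0. *)
have nu0 : nu 1%N = 0.
  have := fcoef_cvg0 r0 (circ_conj kc).
  have E m : fcoef (fun z => (k z)^*%C) m.+1 r =
      ((r ^+ 2)%:C ^+ m.+1)^-1 * (nu m.+1)^*%C.
    rewrite /fcoef /nu -(cmean_conj (kxc _)) -(cmeanZ _ (circ_conj (kxc _))).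
    apply: eq_cmean => // z zr; rewrite conjM conjX (conj_circleV r0 zr).
    have rC : (r ^+ 2)%:C != 0 :> R[i].
      by rewrite -modulus_gt0 modulus_real normr_gt0 expf_neq0// gt_eqF.
    rewrite exprMn exprVn; move: ((k z)^*%C) => w.
    have : (r ^+ 2)%:C ^+ m.+1 != 0 :> R[i] by rewrite expf_neq0.
    by move: ((r ^+ 2)%:C ^+ m.+1) => a a0; rewrite (mulrCA w a) mulKf.
  move=> C; apply/eqP; rewrite -modulus_eq0; apply/eqP.
  have : (fun m => modulus (nu 1%N) / r) @ \oo --> 0.
    move: C; rewrite -cvg_shiftS => C; apply: cvg_trans C.
    apply: near_eq_cvg; apply: nearW => m; rewrite /= E modulusM modulusV modulusX.
    rewrite modulus_real modulus_conj nuE modulusM modulusX -/r.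
    rewrite ger0_norm ?sqr_ge0// -exprM mulnC exprM !exprS expr0 mulr1.
    have : r ^+ m != 0 by rewrite expf_neq0 ?gt_eqF.
    by move: (modulus (nu 1%N)) (r ^+ m) => w a a0; field; rewrite a0 gt_eqF.
  move/(cvg_lim (@Rhausdorff R)); rewrite lim_cst => [/eqP|//].
  by rewrite mulf_eq0 invr_eq0 (gt_eqF r0) orbF => /eqP.
elim: N => [|N IH].
  rewrite /psum big_ord1 expr0 mulr1 E0 nu0 sub0r expr1; congr (- _).
rewrite psumS addrAC IH Ea -/(kap N) -/(kap N.+1) -/k !exprS; ring.
Qed.

(** The telescoped remainder is r times r^N |coefficient of the quotient|, which tends to 0 by
    Riemann-Lebesgue. The center is treated apart, as its circle is degenerate. *)
Lemma psum_cvg f z0 : analytic_on_disk f -> modulus z0 < 1 ->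
  (fun N => modulus (psum (scoef f) N z0 - f z0)) @ \oo --> 0.
Proof.
move=> fa z1; have [->|z00] := eqVneq z0 0.
  rewrite -cvg_shiftS (_ : (fun n : nat => _) = fun=> 0); first exact: cvg_cst.
  apply/funext => N; rewrite /psum big_ord_recl big1 => [|i _]; last first.
    by rewrite expr0n mulr0.
  rewrite addr0 expr0 mulr1 -(fcoef_scoef _ fa (r := 2^-1)) ?invr_gt0// ?invf_lt1 ?ltr1n//.
  rewrite /fcoef (@cmean_value _ _ 1) ?invr_gt0 ?invf_lt1 ?ltr1n//.
    by rewrite expr0 invr1 mulr1 subrr modulus0.
  move=> z hz; apply: cdiffM; first exact: (cdiff_an fa).
  rewrite (_ : (fun _ => _) = fun=> 1); first exact: cdiff_cst.
  by apply/funext => x; rewrite expr0 invr1.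
have r0 : 0 < modulus z0 by rewrite modulus_gt0.
have [l fl] := cdiff_an fa (z1 : disk z0).
have kc : circ (diffq f l z0) (modulus z0).
  apply: ccirc_pconts => [|z zr]; first exact: ltW.
  by apply: ccont_diffq => //; apply: (cdiff_an fa); rewrite /disk /= zr.
rewrite -cvg_shiftS; pose u n := modulus (fcoef (diffq f l z0) n (modulus z0)).
rewrite (_ : (fun n : nat => _) =
    (fun n => modulus z0 * (u n * modulus z0 ^+ n))); last first.
  apply/funext => N; rewrite (psum_scoef_telescope N fa fl)// modulusN modulusM.
  by rewrite modulusX exprS -/(u N); ring.
have := cvgM (cvg_cst (modulus z0)) (fcoef_cvg0 r0 kc).
by rewrite mulr0; exact.
Qed.

Lemma scoef_le f n r : analytic_on_disk f -> 0 < r -> r < 1 ->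
  modulus (scoef f n) ^+ 2 * r ^+ (2 * n) <= M2 f r.
Proof.
move=> fa r0 r1; rewrite -(fcoef_scoef _ fa r0 r1).
apply: le_trans (bessel_le n.+1 r0 (circ_analytic fa (ltW r0) r1)).
rewrite big_ord_recr /= lerDr; apply: sumr_ge0 => i _.
by rewrite mulr_ge0 ?sqr_ge0// exprn_ge0// ltW.
Qed.

(** The first clause says that the radius of convergence is at least 1; it upgrades the pointwise
    convergence of the second to uniform convergence on smaller disks. *)
Definition has_pseries f b :=
  (forall r, 0 < r -> r < 1 -> exists C, forall n, modulus (b n) * r ^+ n <= C) /\
  (forall z, disk z -> (fun N => modulus (psum b N z - f z)) @ \oo --> 0).

Lemma analytic_has_pseries f : analytic_on_disk f -> has_pseries f (scoef f).
Proof.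
move=> fa; split; last by move=> z z1; exact: psum_cvg.
move=> r r0 r1; exists (Num.sqrt (M2 f r)) => n.
rewrite -(ler_pXn2r (n := 2)) ?nnegrE ?sqrtr_ge0//; last first.
  by rewrite mulr_ge0 ?modulus_ge0// exprn_ge0// ltW.
by rewrite sqr_sqrtr ?M2_ge0// exprMn -exprM mulnC scoef_le.
Qed.

(** With q between r and 1, the terms on |z| <= r are dominated by the geometric sequence C (r /
    q)^n. *)
Lemma has_pseries_unif f b r : has_pseries f b -> 0 < r -> r < 1 ->
  exists2 u : nat -> R, u @ \oo --> 0 &
    forall N z, modulus z <= r -> modulus (f z - psum b N z) <= u N.
Proof.
move=> [bC bf] r0 r1; pose q := (r + 1) / 2.
have q0 : 0 < q by rewrite /q; lra. have q1 : q < 1 by rewrite /q; lra.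
have rq : r < q by rewrite /q; lra.
have [C CP] := bC q q0 q1.
have C0 : 0 <= C.
  by apply: le_trans (CP 0%N); rewrite mulr_ge0 ?modulus_ge0.
pose s := r / q; have s0 : 0 < s by rewrite divr_gt0.
have s1 : s < 1 by rewrite ltr_pdivrMr ?mul1r.
exists (fun N => C / (1 - s) * s ^+ N).
  have sn1 : `|s| < 1 by rewrite ger0_norm// ltW.
  have := cvgM (cvg_cst (C / (1 - s))) (cvg_expr sn1).
  by rewrite mulr0; exact.
move=> N z zr.
have term n : modulus (b n * z ^+ n) <= C * s ^+ n.
  rewrite modulusM modulusX /s exprMn exprVn mulrA.
  rewrite ler_pdivlMr ?exprn_gt0//.
  rewrite mulrAC; apply: ler_pM; rewrite ?exprn_ge0 ?modulus_ge0//.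
    by rewrite mulr_ge0 ?modulus_ge0// exprn_ge0// ltW.
  by rewrite lerXn2r ?nnegrE ?modulus_ge0// ltW.
(* With the factor 1 - s^M this is the exact geometric sum, so the induction closes by an
   identity. *)
have tail M : modulus (psum b (N + M) z - psum b N z) <=
    C / (1 - s) * s ^+ N * (1 - s ^+ M).
  elim: M => [|M IH]; first by rewrite addn0 subrr modulus0 expr0 subrr mulr0.
  rewrite addnS psumS addrAC; apply: le_trans (le_modulusD _ _) _.
  apply: le_trans (lerD IH (term _)) _.
  rewrite exprD (exprS _ M) le_eqVlt; apply/orP; left; apply/eqP; field.
  by rewrite subr_eq0 gt_eqF.
apply/ler_addgt0Pr => e e0.
have z1 : disk z by rewrite /disk /=; exact: le_lt_trans r1.
have := bf z z1 => /cvgrPdist_lt/(_ _ e0)[M _ MP].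
have := MP (N + M)%N (leq_addl _ _); rewrite sub0r normrN ger0_norm ?modulus_ge0//.
move=> H.
rewrite (_ : f z - _ = - (psum b (N + M) z - f z) + (psum b (N + M) z - psum b N z)); last by ring.
apply: le_trans (le_modulusD _ _) _; rewrite modulusN addrC; apply: lerD; last exact: ltW.
apply: le_trans (tail M) _; rewrite -[leRHS]mulr1 ler_wpM2l//.
  apply: mulr_ge0; last by rewrite exprn_ge0// ltW.
  by rewrite divr_ge0// subr_ge0 ltW.
by rewrite gerBl exprn_ge0// ltW.
Qed.

(** The n-th coefficient of f minus a long partial sum is the difference of the two coefficients,
    and it is small by uniform convergence. *)
Lemma has_pseries_scoef f b n : analytic_on_disk f -> has_pseries f b ->
  scoef f n = b n.
Proof.
move=> fa fb; have r0 : (0 : R) < 2^-1 by rewrite invr_gt0.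
have r1 : (2^-1 : R) < 1 by rewrite invf_lt1// ltr1n.
have [u u0 uP] := has_pseries_unif fb r0 r1.
have fc := circ_analytic fa (ltW r0) r1.
apply/eqP; rewrite -subr_eq0 -modulus_eq0 eq_le modulus_ge0 andbT.
apply/ler_addgt0Pr => e e0; rewrite add0r.
(* The factor 1/2 pays for the 2 in [le_modulus_cmean], and 2^-n for |z^-n| on the circle of radius
   1/2. *)
have e'0 : 0 < e / 2 * 2^-1 ^+ n by rewrite mulr_gt0 ?divr_gt0 ?exprn_gt0.
move/cvgrPdist_lt : u0 => /(_ _ e'0) [N _ NP].
(* N + n + 1 is beyond the threshold N and also long enough for the partial sum to contain index
   n. *)
have := NP (N + n.+1)%N (leq_addr _ _); rewrite sub0r normrN => Hu.
have -> : scoef f n - b n = fcoef (fun z => f z - psum b (N + n.+1) z) n 2^-1.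
  rewrite fcoefB// ?fcoef_psum//; last exact: circ_psum.
  by rewrite -/(scoef f n) ltn_addl.
rewrite /fcoef (_ : e = 2 * (e / 2)); last by field.
apply: le_modulus_cmean.
  exact: (circ_fcoef _ r0 (circB fc (circ_psum _ _ _))).
move=> t; rewrite modulusM modulusV modulusX modulus_pt; last exact: ltW.
rewrite ler_pdivrMr ?exprn_gt0//; apply: le_trans (ltW Hu).
apply: le_trans (ler_norm _).
by apply: uP; rewrite modulus_pt// ltW.
Qed.

(* Unification would otherwise unfold scoef down to an integral. *)
#[local] Opaque scoef.

Lemma M2_le_sqr h r M : circ h r -> 0 <= r ->
  (forall z, modulus z = r -> modulus (h z) <= M) -> M2 h r <= M ^+ 2.
Proof.
move=> hc r0 hM; have M0 : 0 <= M.
  by apply: le_trans (hM (pt r 0) _); rewrite ?modulus_ge0// modulus_pt.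
rewrite -(ger0_norm M0) -modulus_real -(M2_cst M%:C r).
apply: le_M2 => //; first exact: circ_cst.
by move=> z /hM; rewrite modulus_real ger0_norm.
Qed.

Lemma M2_sub_psum f N r : analytic_on_disk f -> 0 < r -> r < 1 ->
  M2 (fun z => f z - psum (scoef f) N z) r =
  M2 f r - \sum_(n < N) modulus (scoef f n) ^+ 2 * r ^+ (2 * n).
Proof.
move=> fa r0 r1; have E : (fun n => fcoef f n r) = scoef f.
  by apply/funext => n; exact: fcoef_scoef.
have fc := circ_analytic fa (ltW r0) r1.
rewrite -E.
rewrite bessel.
by [].
by [].
by[].
Qed.

(** The defect in Bessel's identity is the mean square of the Taylor remainder, which is uniformly
    small on the circle. *)
Lemma parseval f r : analytic_on_disk f -> 0 < r -> r < 1 ->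
  (fun N => \sum_(n < N) modulus (scoef f n) ^+ 2 * r ^+ (2 * n)) @ \oo -->
  M2 f r.
Proof.
move=> fa r0 r1; have [u u0 uP] := has_pseries_unif (analytic_has_pseries fa) r0 r1.
have fc := circ_analytic fa (ltW r0) r1.
have : (fun N => u N * u N) @ \oo --> 0.
  by have := cvgM u0 u0; rewrite mulr0; exact.
move/cvgrPdist_lt => H; apply/cvgrPdist_lt => e e0.
apply: filterS (H _ e0) => N; rewrite sub0r normrN -(M2_sub_psum _ fa r0 r1).
rewrite -expr2 ger0_norm ?sqr_ge0// ger0_norm ?M2_ge0//.
apply: le_lt_trans; apply: M2_le_sqr; rewrite ?ltW//.
  by apply: circB => //; exact: circ_psum.
by move=> z zr; apply: uP; rewrite zr.
Qed.

Lemma M2_sub_psum_le f N r T : analytic_on_disk f -> 0 < r -> r < 1 ->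
  (forall M, \sum_(N <= n < M) modulus (scoef f n) ^+ 2 * r ^+ (2 * n) <= T) ->
  M2 (fun z => f z - psum (scoef f) N z) r <= T.
Proof.
move=> fa r0 r1 H; rewrite M2_sub_psum// lerBlDl.
apply: (ler_cvg_to (parseval fa r0 r1) (cvg_cst _)).
exists N => // M /= NM; rewrite -!(big_mkord xpredT (fun n => modulus (scoef f n) ^+ 2 * r ^+ (2 * n))).
by rewrite (big_cat_nat (leq0n N) NM) lerD2l.
Qed.

(** The rotation multiplies the n-th coefficient by u^n, of modulus 1, so Parseval gives both sides
    the same series. *)
Lemma M2_rot f u r : analytic_on_disk f -> modulus u = 1 -> 0 <= r -> r < 1 ->
  M2 (fun z => f (u * z)) r = M2 f r.
Proof.
move=> fa u1; rewrite le_eqVlt => /predU1P[<-|r0] r1.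
  rewrite /M2; congr (_ * _); apply: eq_rint => t _.
  by rewrite (_ : pt 0 t = 0) ?mulr0//; apply: complexP; rewrite /= mul0r.
pose g z := f (u * z).
have dg z : disk z -> disk (u * z) by rewrite /disk /= modulusM u1 mul1r.
have ga : analytic_on_disk g.
  apply/analytic_cdiff => z z1; apply: (cdiff_comp (f := fun z => u * z)).
    by apply: cdiffM; [exact: cdiff_cst|exact: cdiff_id].
  by apply: cdiff_an => //; exact: dg.
have [fC fl] := analytic_has_pseries fa.
have gb : has_pseries g (fun n => scoef f n * u ^+ n).
  split=> [q q0 q1|z /dg /fl].
    have [C CP] := fC q q0 q1; exists C => n.
    by rewrite modulusM modulusX u1 expr1n mulr1.
  have E N : psum (fun n => scoef f n * u ^+ n) N z = psum (scoef f) N (u * z).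
    by rewrite /psum; apply: eq_bigr => i _; rewrite exprMn mulrA.
  by under [X in _ -> X @ _ --> _]eq_fun do rewrite E.
have := parseval ga r0 r1.
rewrite (_ : (fun N => _) =
  (fun N => \sum_(n < N) modulus (scoef f n) ^+ 2 * r ^+ (2 * n))).
  move/(cvg_lim (@Rhausdorff R)) => <-.
  by apply/cvg_lim => //; exact: parseval.
apply/funext => N; apply: eq_bigr => i _.
by rewrite (has_pseries_scoef _ ga gb) modulusM modulusX u1 expr1n mulr1.
Qed.

End PowerSeries.

(** * Poisson formula and Littlewood's inequality *)

Section Poisson.
Variable R : realType.
Implicit Types (f g : R[i] -> R[i]) (r rho : R) (z w zeta : R[i]).

Lemma Re_cmean g r :
  Re (cmean g r) = (2 * pi)^-1 * rint 0 (2 * pi) (fun t => Re (g (pt r t))).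
Proof. by rewrite /cmean cReM /= mul0r subr0. Qed.

Lemma le_Re_cmean g h r : circ g r -> circ h r -> 0 <= r ->
  (forall z, modulus z = r -> Re (g z) <= Re (h z)) ->
  Re (cmean g r) <= Re (cmean h r).
Proof.
move=> gc hc r0 gh; rewrite !Re_cmean ler_wpM2l//.
  by rewrite invr_ge0 mulr_ge0// pi_ge0.
apply: le_rint; try exact: pconts_Re.
by move=> t _; apply: gh; rewrite modulus_pt.
Qed.

Lemma circ_sub_neq0 zeta z rho : modulus zeta = rho -> modulus z < rho ->
  zeta - z != 0.
Proof.
by move=> zr zl; rewrite subr_eq0; apply: contraTN zl => /eqP <-; rewrite zr ltxx.
Qed.

Lemma circ_cauchy_kernel z rho : 0 <= rho -> modulus z < rho ->
  circ (fun zeta => zeta / (zeta - z)) rho.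
Proof.
move=> r0 zr; apply: circM; first exact: circ_id.
apply: (circV r0); first by move=> zeta H; exact: circ_sub_neq0 zr.
by apply: circB; [exact: circ_id|exact: circ_cst].
Qed.

(** The uniform remainder estimate for the empty partial sum is a bound on f itself. *)
Lemma analytic_circ_bounded f r : analytic_on_disk f -> 0 < r -> r < 1 ->
  exists2 M, 0 <= M & forall z, modulus z <= r -> modulus (f z) <= M.
Proof.
move=> fa r0 r1.
have [u _ uP] := has_pseries_unif (analytic_has_pseries fa) r0 r1.
have H z : modulus z <= r -> modulus (f z) <= u 0%N.
  by move=> /(uP 0%N); rewrite /psum big_ord0 subr0.
exists (u 0%N) => //; apply: le_trans (H 0 _); rewrite ?modulus_ge0// modulus0.
exact: ltW.
Qed.

(** The kernel K = zeta / (zeta - z) satisfies K = 1 + (z / zeta) K. Iterating peels off the Taylor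
    polynomial and leaves z^N times the N-th coefficient of f K, of order (|z| / rho)^N. *)
Lemma cauchy_formula f z rho : analytic_on_disk f -> modulus z < rho -> rho < 1 ->
  cmean (fun zeta => f zeta * (zeta / (zeta - z))) rho = f z.
Proof.
move=> fa zr r1; have r0 : 0 < rho := le_lt_trans (modulus_ge0 z) zr.
have r00 := ltW r0; have fc := circ_analytic fa r00 r1.
have [M M0 fM] := analytic_circ_bounded fa r0 r1.
have kc := circ_cauchy_kernel r00 zr.
pose d := rho - modulus z; have d0 : 0 < d by rewrite subr_gt0.
pose q := modulus z / rho.
have q1 : `|q| < 1.
  by rewrite ger0_norm ?divr_ge0 ?modulus_ge0// ltr_pdivrMr ?mul1r.
set I := cmean _ _.
have E N : I - psum (scoef f) N z =
    z ^+ N * fcoef (fun zeta => f zeta * (zeta / (zeta - z))) N rho.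
  have tc n : circ (fun zeta => f zeta * (zeta / (zeta - z)) * (zeta ^+ n)^-1) rho.
    exact: (circ_fcoef _ r0 (circM fc kc)).
  have fn n : circ (fun zeta => f zeta * (zeta ^+ n)^-1) rho by exact: circ_fcoef.
  elim: N => [|N IH].
    rewrite /psum big_ord0 subr0 expr0 mul1r /fcoef; apply: eq_cmean => // x _.
    by rewrite expr0 invr1 mulr1.
  rewrite psumS opprD addrA IH -(fcoef_scoef _ fa r0 r1) /fcoef.
  rewrite [fcoef f N rho * _]mulrC -mulrBr -(cmeanB (tc N) (fn N)) exprSr -mulrA.
  congr (_ * _); rewrite -(cmeanZ _ (tc N.+1)); apply: eq_cmean => // x xr.
  have x0 := circ_neq0 r0 xr; have xz := circ_sub_neq0 xr zr.
  by rewrite exprS; field; rewrite ?expf_neq0// ?x0 ?xz.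
apply/eqP; rewrite -subr_eq0 -modulus_eq0 eq_le modulus_ge0 andbT.
apply/ler_addgt0Pr => e e0; rewrite add0r.
have e20 : 0 < e / 2 by rewrite divr_gt0.
have z1 : modulus z < 1 := lt_trans zr r1.
move/cvgrPdist_lt : (psum_cvg fa z1) => /(_ _ e20)[N1 _ H1].
have : (fun n => 2 * (M * (rho / d)) * q ^+ n) @ \oo --> 0.
  by have := cvgM (cvg_cst (2 * (M * (rho / d)))) (cvg_expr q1); rewrite mulr0; exact.
move/cvgrPdist_lt => /(_ _ e20)[N2 _ H2].
have {H1} := H1 (N1 + N2)%N (leq_addr _ _).
have {H2} := H2 (N1 + N2)%N (leq_addl _ _).
move: (N1 + N2)%N => N; rewrite !sub0r !normrN => H2 H1.
rewrite (_ : I - f z = (I - psum (scoef f) N z) + (psum (scoef f) N z - f z)); last by ring.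
apply: le_trans (le_modulusD _ _) _; rewrite [leRHS]splitr; apply: lerD; last first.
  by apply: le_trans (ler_norm _) _; exact: ltW.
apply: le_trans (ltW H2); apply: le_trans (ler_norm _).
rewrite /= E modulusM modulusX /q exprMn exprVn.
rewrite -[leLHS]mulrC [leRHS]mulrA.
have zN : 0 <= modulus z ^+ N by rewrite exprn_ge0// modulus_ge0.
rewrite [leRHS]mulrAC ler_wpM2r//.
rewrite (_ : _ / _ = 2 * (M * (rho / d) * (rho ^+ N)^-1)); last by ring.
apply: le_modulus_cmean; first exact: (circ_fcoef _ r0 (circM fc kc)).
move=> t; have tr : modulus (pt rho t) = rho by exact: modulus_pt.
rewrite !modulusM !modulusV modulusX tr.
rewrite ler_wpM2r ?invr_ge0 ?exprn_ge0//.
apply: ler_pM; rewrite ?modulus_ge0 ?divr_ge0 ?modulus_ge0//.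
  by apply: fM; rewrite tr.
rewrite ler_wpM2l// lef_pV2 ?posrE//.
  by rewrite /d -[X in X - _]tr ge_modulusB.
by rewrite modulus_gt0 (circ_sub_neq0 tr zr).
Qed.

(** The Poisson kernel of the disk of radius rho, for zeta on its boundary and z inside. *)
Definition pk rho zeta z : R := (rho ^+ 2 - modulus z ^+ 2) / modulus (zeta - z) ^+ 2.

(** The Cauchy kernel plus a function of zeta that is analytic across the disk and vanishes at 0, so
    that times f it has mean zero. *)
Lemma pkE rho zeta z : modulus zeta = rho -> modulus z < rho ->
  (pk rho zeta z)%:C =
  zeta / (zeta - z) + z^*%C * zeta / ((rho ^+ 2)%:C - z^*%C * zeta).
Proof.
move=> zr zl; have r0 : 0 < rho := le_lt_trans (modulus_ge0 z) zl.
have n1 := circ_sub_neq0 zr zl; have n2 := circ_neq0 r0 zr.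
have n3 : zeta^*%C - z^*%C != 0 by rewrite -conjB conj_eq0.
rewrite /pk realcM realcV realcB -!conjM_modulus -(conj_circle zr) conjB.
move: (z^*%C) (zeta^*%C) n3 => a b n3.
field; rewrite n1 n3 /= -mulrBl mulf_neq0//.
Qed.

Lemma pkRe rho zeta z : modulus zeta = rho -> modulus z < rho ->
  pk rho zeta z = Re ((zeta + z) / (zeta - z)).
Proof.
move=> zr zl; rewrite cReM cReV cImV /pk -zr; move: (modulus (zeta - z) ^+ 2) => N.
by rewrite !sqr_modulus !cReD !cImD !cReN !cImN; ring.
Qed.

Lemma circ_pk rho z : 0 <= rho -> modulus z < rho ->
  circ (fun zeta => (pk rho zeta z)%:C) rho.
Proof.
move=> r0 zr t _; apply: pcont_real; apply: cvgM; first exact: cvg_cst.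
apply: cvgV.
  by rewrite expf_neq0// modulus_eq0 (circ_sub_neq0 _ zr)// modulus_pt.
apply: (pcont_sqr_modulus (g := fun t => pt rho t - z)).
by apply: pcontB; [exact: pcont_pt|exact: pcont_cst].
Qed.

Lemma poisson_formula f z rho : analytic_on_disk f -> modulus z < rho -> rho < 1 ->
  cmean (fun zeta => f zeta * (pk rho zeta z)%:C) rho = f z.
Proof.
move=> fa zr r1; have r0 : 0 < rho := le_lt_trans (modulus_ge0 z) zr.
have r00 := ltW r0; have fc := circ_analytic fa r00 r1.
have kc := circ_cauchy_kernel r00 zr.
pose h zeta := f zeta * (z^*%C * zeta / ((rho ^+ 2)%:C - z^*%C * zeta)).
pose m := (modulus z + rho) / 2; have m0 : 0 < m.
  by rewrite /m; have := modulus_ge0 z; lra.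
have zm : modulus z < m by rewrite /m; lra.
have mr : m < rho by rewrite /m; lra.
(* The second summand has its pole at modulus rho^2 / |z|; replacing |z| by the larger [m] < rho
   avoids dividing by zero and still leaves room beyond rho. *)
pose r1' := Num.min 1 (rho ^+ 2 / m).
have rr : rho < r1'.
  by rewrite lt_min r1 /= ltr_pdivlMr// expr2 ltr_pM2l.
have hd x : modulus x < r1' -> cdiff h x.
  rewrite lt_min => /andP[x1 x2].
  apply: cdiffM; first exact: (cdiff_an fa).
  apply: (cdiffM (f := fun x => z^*%C * x)).
    by apply: cdiffM; [exact: cdiff_cst|exact: cdiff_id].
  apply: (cdiffV (f := fun x => (rho ^+ 2)%:C - z^*%C * x)).
    rewrite subr_eq0; apply: contraTN x2 => /eqP /(congr1 (@modulus R)).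
    rewrite modulusM modulus_real modulus_conj ger0_norm ?sqr_ge0// => e.
    rewrite -leNgt ler_pdivrMr// e mulrC ler_wpM2l ?modulus_ge0//; exact: ltW.
  apply: cdiffB; first exact: cdiff_cst.
  by apply: cdiffM; [exact: cdiff_cst|exact: cdiff_id].
have hc : circ h rho.
  by apply: circ_cdiff => // x xr; apply: hd; rewrite xr.
rewrite (@eq_cmean _ _ (fun x => f x * (x / (x - z)) + h x))//; last first.
  by move=> x xr; rewrite pkE// mulrDr.
rewrite (cmeanD (circM fc (circ_cauchy_kernel r00 zr)) hc).
rewrite cauchy_formula// (cmean_value r0 rr hd) /h.
by rewrite mulr0 mul0r mulr0 addr0.
Qed.

Lemma le_pk rho zeta z : modulus zeta = rho -> modulus z < rho ->
  (rho - modulus z) / (rho + modulus z) <= pk rho zeta z.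
Proof.
move=> zr zl; have z0 := modulus_ge0 z; have r0 : 0 < rho by lra.
have d0 : 0 < modulus (zeta - z) by rewrite modulus_gt0 (circ_sub_neq0 zr zl).
have d1 : modulus (zeta - z) <= rho + modulus z by rewrite -zr le_modulusB.
rewrite /pk ler_pdivlMr ?exprn_gt0// mulrAC ler_pdivrMr; last lra.
rewrite subr_sqr -mulrA -expr2; apply: ler_wpM2l; first lra.
by apply: lerXn2r; rewrite // nnegrE; lra.
Qed.

Lemma pk_le rho zeta z : modulus zeta = rho -> modulus z < rho ->
  pk rho zeta z <= (rho + modulus z) / (rho - modulus z).
Proof.
move=> zr zl; have z0 := modulus_ge0 z; have r0 : 0 < rho by lra.
have d0 : 0 < modulus (zeta - z) by rewrite modulus_gt0 (circ_sub_neq0 zr zl).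
have d1 : rho - modulus z <= modulus (zeta - z) by rewrite -zr ge_modulusB.
rewrite /pk ler_pdivrMr ?exprn_gt0// mulrAC ler_pdivlMr; last lra.
rewrite subr_sqr mulrAC -expr2 mulrC; apply: ler_wpM2l; first lra.
by apply: lerXn2r; rewrite // nnegrE; lra.
Qed.

Lemma pk_ge0 rho zeta z : modulus zeta = rho -> modulus z < rho ->
  0 <= pk rho zeta z.
Proof.
move=> zr zl; apply: le_trans (le_pk zr zl); have z0 := modulus_ge0 z.
by apply: divr_ge0; lra.
Qed.

(** With c = f z, the Poisson integral of |f - c|^2 is nonnegative; expanding it by
    [poisson_formula] gives the Poisson integral of |f|^2 minus |c|^2. *)
Lemma submean f z rho : analytic_on_disk f -> modulus z < rho -> rho < 1 ->
  modulus (f z) ^+ 2 <=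
  Re (cmean (fun x => (modulus (f x) ^+ 2)%:C * (pk rho x z)%:C) rho).
Proof.
move=> fa zr r1; have r0 : 0 < rho := le_lt_trans (modulus_ge0 z) zr.
have r00 := ltW r0; have fc := circ_analytic fa r00 r1.
have pc := circ_pk r00 zr; set c := f z.
have m2c : circ (fun x => (modulus (f x) ^+ 2)%:C) rho.
  by move=> t tP; apply: pcont_real; apply: pcont_sqr_modulus; exact: fc.
have p1 : cmean (fun x => (pk rho x z)%:C) rho = 1.
  have := poisson_formula (f := fun=> 1) _ zr r1.
  move=> <-; first by apply: eq_cmean => // x _; rewrite mul1r.
  by apply/analytic_cdiff => x _; exact: cdiff_cst.
have pf := poisson_formula fa zr r1.
have fpc : circ (fun x => f x * (pk rho x z)%:C) rho by exact: circM.
have fpcc : circ (fun x => (f x * (pk rho x z)%:C)^*%C) rho by exact: circ_conj.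
rewrite -subr_ge0.
have -> : Re (cmean (fun x => (modulus (f x) ^+ 2)%:C * (pk rho x z)%:C) rho) -
    modulus c ^+ 2 =
  Re (cmean (fun x => (modulus (f x - c) ^+ 2 * pk rho x z)%:C) rho).
  rewrite (@eq_cmean _ (fun x => (modulus (f x - c) ^+ 2 * pk rho x z)%:C)
    (fun x => (modulus (f x) ^+ 2)%:C * (pk rho x z)%:C -
    (c^*%C * (f x * (pk rho x z)%:C) + c * (f x * (pk rho x z)%:C)^*%C) +
    (modulus c ^+ 2)%:C * (pk rho x z)%:C))//; last first.
    move=> x _; rewrite realcM -!conjM_modulus conjB conjM conj_real.
    by move: (c^*%C) ((f x)^*%C) (pk rho x z) => a b d; ring.
  have h1 : circ (fun x => (modulus (f x) ^+ 2)%:C * (pk rho x z)%:C) rho by exact: circM.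
  have h2 : circ (fun x => c^*%C * (f x * (pk rho x z)%:C)) rho.
    exact: (circM (circ_cst _ _) fpc).
  have h3 : circ (fun x => c * (f x * (pk rho x z)%:C)^*%C) rho.
    exact: (circM (circ_cst _ _) fpcc).
  have h4 : circ (fun x => (modulus c ^+ 2)%:C * (pk rho x z)%:C) rho.
    exact: (circM (circ_cst _ _) pc).
  rewrite (cmeanD (circB h1 (circD h2 h3)) h4) (cmeanB h1 (circD h2 h3)).
  rewrite (cmeanD h2 h3) (cmeanZ _ fpc) (cmeanZ _ fpcc) (cmean_conj fpc) pf.
  rewrite (cmeanZ _ pc) p1 mulr1 -/c [c^*%C * c]mulrC conjM_modulus.
  by rewrite !cReD cReN cReD /=; ring.
rewrite Re_cmean mulr_ge0 ?invr_ge0 ?mulr_ge0 ?pi_ge0//.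
apply: rint_ge0 => t _ /=; rewrite mulr_ge0 ?sqr_ge0//.
by apply: pk_ge0 => //; exact: modulus_pt.
Qed.

(* Harnack's inequality for the positive harmonic functions
   Re (1 - conj zeta * phi), |zeta| = 1, replaces the Schwarz-Pick lemma. *)
Lemma self_map_harnack phi z : analytic_on_disk phi ->
  (forall x, disk x -> disk (phi x)) -> disk z ->
  (1 - modulus (phi 0)) * (1 - modulus z) / 4 <= 1 - modulus (phi z).
Proof.
move=> pa pd z1; have z0 := modulus_ge0 z.
have d0 : disk (0 : R[i]) by rewrite /disk /= modulus0.
have a1 : modulus (phi 0) < 1 := pd 0 d0.
have a0 := modulus_ge0 (phi 0); rewrite /disk /= in z1.
have [->|pz0] := eqVneq (phi z) 0.
  by rewrite modulus0 subr0; nra.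
pose rho := (1 + modulus z) / 2.
have zr : modulus z < rho by rewrite /rho; lra.
have r1 : rho < 1 by rewrite /rho; lra.
have r0 : 0 < rho by rewrite /rho; lra.
have r00 := ltW r0.
have m0 : modulus (phi z) != 0 by rewrite modulus_eq0.
(* The unimodular factor with c phi(z) = |phi(z)|, so that Re (1 - c phi) equals 1 - |phi| at z and
   dominates it everywhere. *)
pose c := (phi z)^*%C / (modulus (phi z))%:C.
have c1 : modulus c = 1.
  by rewrite modulusM modulusV modulus_conj modulus_real ger0_norm ?modulus_ge0// divff.
pose h x := 1 - c * phi x.
have ha : analytic_on_disk h.
  apply/analytic_cdiff => x x1; apply: cdiffB; first exact: cdiff_cst.
  by apply: cdiffM; [exact: cdiff_cst|exact: cdiff_an].
have hz : Re (h z) = 1 - modulus (phi z).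
  rewrite /h /c (_ : _ / _ * _ = (phi z * (phi z)^*%C) / (modulus (phi z))%:C); last by ring.
  by rewrite conjM_modulus -realcV -realcM expr2 mulfK// cReD cReN.
have h_ge x : disk x -> 1 - modulus (phi x) <= Re (h x).
  move=> x1; rewrite /h cReD cReN /= lerD2l lerN2.
  by apply: le_trans (ler_norm _) _; apply: le_trans (le_Re_modulus _) _; rewrite modulusM c1 mul1r.
rewrite -hz -(poisson_formula ha zr r1).
(* The lower bound of the Poisson kernel. For rho = (1 + |z|) / 2 it equals (1 - |z|) / (1 + 3 |z|),
   whence the 1/4. *)
set k := (rho - modulus z) / (rho + modulus z).
have k0 : 0 <= k by rewrite divr_ge0; lra.
have hc := circ_analytic ha r00 r1.
apply: (@le_trans _ _ (Re (cmean (fun x => k%:C * h x) rho))).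
  rewrite cmeanZ// (cmean_value (r0 := 1))//; last by move=> x; exact: cdiff_an.
  rewrite cReM /= mul0r subr0; apply: le_trans (ler_wpM2l k0 (h_ge _ d0)).
  rewrite mulrAC -mulrA mulrC ler_wpM2r//; first lra.
  rewrite /k ler_pdivlMr; last lra.
  by rewrite /rho; nra.
apply: le_Re_cmean; [exact: (circM (circ_cst _ _) hc)|exact: (circM hc (circ_pk r00 zr))|exact: r00|].
move=> x xr; rewrite mulrC !cReM /= !mulr0 !subr0 ler_wpM2l//; last exact: le_pk.
have x1 : disk x by rewrite /disk /= xr.
by apply: le_trans (h_ge x x1); rewrite subr_ge0 ltW//; exact: pd.
Qed.

(** An analytic function of w whose real part is the Poisson integral of |f|^2. Being analytic, it
    stays so after composition with phi, and the mean value property of analytic functions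
    applies. *)
Definition herglotz f rho w : R[i] :=
  cmean (fun x => (modulus (f x) ^+ 2)%:C * ((x + w) / (x - w))) rho.

Lemma circ_sqr_modulus f r : circ f r -> circ (fun x => (modulus (f x) ^+ 2)%:C) r.
Proof.
by move=> fc t tP; apply: pcont_real; apply: pcont_sqr_modulus; exact: fc.
Qed.

Lemma circ_herglotz f rho w : circ f rho -> 0 <= rho -> modulus w < rho ->
  circ (fun x => (modulus (f x) ^+ 2)%:C * ((x + w) / (x - w))) rho.
Proof.
move=> fc r0 wr; apply: circM; first exact: circ_sqr_modulus.
apply: circM; first by apply: circD; [exact: circ_id|exact: circ_cst].
apply: (circV r0); first by move=> x xr; exact: circ_sub_neq0 wr.
by apply: circB; [exact: circ_id|exact: circ_cst].
Qed.

Lemma Re_herglotz f rho w : circ f rho -> 0 <= rho -> modulus w < rho ->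
  Re (herglotz f rho w) =
  Re (cmean (fun x => (modulus (f x) ^+ 2)%:C * (pk rho x w)%:C) rho).
Proof.
move=> fc r0 wr; rewrite !Re_cmean; congr (_ * _); apply: eq_rint => t _.
by rewrite !cRe_realM pkRe// modulus_pt.
Qed.

(** Differentiation under the integral: the kernel (x + w) / (x - w) has derivative 2x / (x - w)^2
    in w, with the exact remainder 2x h^2 / ((x - w - h) (x - w)^2). *)
Lemma cdiff_herglotz f rho w M : circ f rho -> 0 < rho -> modulus w < rho ->
  (forall x, modulus x = rho -> modulus (f x) <= M) -> cdiff (herglotz f rho) w.
Proof.
move=> fc r0 wr fM; have r00 := ltW r0.
have M0 : 0 <= M by apply: le_trans (fM (pt rho 0) _); rewrite ?modulus_ge0// modulus_pt.
pose d := rho - modulus w; have d0 : 0 < d by rewrite subr_gt0.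
pose m x := (modulus (f x) ^+ 2)%:C.
have mc : circ m rho by exact: circ_sqr_modulus.
pose D x := m x * (2 * x / (x - w) ^+ 2).
have w0 := modulus_ge0 w.
have Dc : circ D rho.
  apply: (circM mc); apply: circM.
    by apply: circM; [exact: circ_cst|exact: circ_id].
  apply: (circV r00).
    by move=> x xr; rewrite expf_neq0//; exact: circ_sub_neq0 wr.
  by apply: circX; apply: circB; [exact: circ_id|exact: circ_cst].
exists (cmean D rho) => e e0.
(* M^2 bounds the density, |x - w| >= d and |x - w - h| >= d / 2 the denominators; the leading 2 is
   that of [le_modulus_cmean]. *)
pose C := 2 * (M ^+ 2 * (2 * rho / (d / 2 * d ^+ 2))).
have C0 : 0 <= C.
  by rewrite mulr_ge0// mulr_ge0 ?sqr_ge0// divr_ge0 ?mulr_ge0 ?sqr_ge0//; lra.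
exists (Num.min (d / 2) (e / (C + 1))).
  by rewrite lt_min !divr_gt0//; lra.
move=> h; rewrite lt_min => /andP[hd he].
have h0 := modulus_ge0 h.
have whr : modulus (w + h) < rho.
  by apply: le_lt_trans (le_modulusD _ _) _; rewrite /d in hd; lra.
rewrite /herglotz -(cmeanB (circ_herglotz fc r00 whr) (circ_herglotz fc r00 wr)).
have hDc : circ (fun x => h * D x) rho by apply: circM => //; exact: circ_cst.
rewrite [cmean D rho * h]mulrC -(cmeanZ _ Dc).
rewrite -(cmeanB (circB (circ_herglotz fc r00 whr) (circ_herglotz fc r00 wr)) hDc).
apply: (@le_trans _ _ (2 * (M ^+ 2 * (2 * rho / (d / 2 * d ^+ 2)) * modulus h ^+ 2))).
  apply: le_modulus_cmean.
    exact: (circB (circB (circ_herglotz fc r00 whr) (circ_herglotz fc r00 wr)) hDc).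
  move=> t; set x := pt rho t; have xr : modulus x = rho by exact: modulus_pt.
  have n1 := circ_sub_neq0 xr wr; have n2 := circ_sub_neq0 xr whr.
  rewrite /D -/(m x) (_ : _ - _ = m x * (2 * x * h ^+ 2 / ((x - (w + h)) * (x - w) ^+ 2))); last first.
    by field; rewrite n1 n2.
  have q1 : d <= modulus (x - w) by rewrite /d -xr ge_modulusB.
  have q2 : d / 2 <= modulus (x - (w + h)).
    by rewrite opprD addrA; apply: le_trans (ge_modulusB _ _); lra.
  have hA : modulus (2 * x * h ^+ 2) = 2 * rho * modulus h ^+ 2.
    rewrite modulusM modulusX modulusM xr; congr (_ * _ * _).
    by rewrite (_ : 2 = (2 : R)%:C) ?modulus_real ?ger0_norm//; apply: complexP => //=; rewrite addr0.
  have hB : d / 2 * d ^+ 2 <= modulus ((x - (w + h)) * (x - w) ^+ 2).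
    rewrite modulusM modulusX; apply: ler_pM; rewrite ?sqr_ge0//; first lra.
    by apply: lerXn2r; rewrite ?nnegrE ?modulus_ge0//; lra.
  have B0 : 0 < d / 2 * d ^+ 2 by rewrite mulr_gt0 ?exprn_gt0//; lra.
  rewrite (_ : M ^+ 2 * _ * _ = M ^+ 2 * (2 * rho * modulus h ^+ 2 / (d / 2 * d ^+ 2))); last by ring.
  rewrite [leLHS]modulusM; apply: ler_pM; rewrite ?modulus_ge0//.
    rewrite /m modulus_real ger0_norm ?sqr_ge0//.
    by apply: lerXn2r; rewrite ?nnegrE ?modulus_ge0//; exact: fM.
  rewrite modulusM modulusV hA ler_wpM2l//.
    by rewrite mulr_ge0 ?sqr_ge0// mulr_ge0.
  by rewrite lef_pV2 ?posrE//; exact: lt_le_trans hB.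
have -> : 2 * (M ^+ 2 * (2 * rho / (d / 2 * d ^+ 2)) * modulus h ^+ 2) =
  C * modulus h * modulus h by rewrite /C; ring.
rewrite ler_wpM2r//; apply: (@le_trans _ _ (C * (e / (C + 1)))).
  by rewrite ler_wpM2l// ltW.
rewrite (_ : C * _ = e * (C / (C + 1))); last by ring.
by rewrite ger_pMr// ler_pdivrMr; lra.
Qed.

(** By [submean], |f o phi|^2 is at most the real part of U o phi, whose mean over the circle is its
    value at 0; there the Poisson kernel at phi(0) is bounded by [pk_le]. *)
Lemma littlewood f phi r r0 rho : analytic_on_disk f ->
  0 < r -> r < r0 -> rho < 1 ->
  (forall z, modulus z < r0 -> cdiff phi z) ->
  (forall z, modulus z < r0 -> modulus (phi z) < rho) ->
  M2 (f \o phi) r <=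
  (rho + modulus (phi 0)) / (rho - modulus (phi 0)) * M2 f rho.
Proof.
move=> fa rp rr0 r1 pd pr.
have m0 : modulus (0 : R[i]) < r0 by rewrite modulus0; exact: lt_trans rr0.
have p0 := pr 0 m0; have a0 := modulus_ge0 (phi 0).
have rho0 : 0 < rho by lra.
have rho00 := ltW rho0; have r00 := ltW rp.
have fc := circ_analytic fa rho00 r1.
have [M M0 fM] := analytic_circ_bounded fa rho0 r1.
pose U := herglotz f rho.
have Ud z : modulus z < r0 -> cdiff (U \o phi) z.
  move=> zr; apply: cdiff_comp; first exact: pd.
  by apply: (cdiff_herglotz (M := M)) => //; [exact: pr|move=> x xr; apply: fM; rewrite xr].
have Uc : circ (U \o phi) r.
  by apply: circ_cdiff => // z zr; apply: Ud; rewrite zr.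
have fpc : circ (f \o phi) r.
  apply: circ_cdiff => // z zr; have zr0 : modulus z < r0 by rewrite zr.
  apply: cdiff_comp; first exact: pd.
  by apply: (cdiff_an fa); exact: lt_trans (pr z zr0) r1.
have -> : M2 (f \o phi) r = Re (cmean (fun x => (modulus (f (phi x)) ^+ 2)%:C) r).
  by rewrite Re_cmean.
apply: (@le_trans _ _ (Re (cmean (U \o phi) r))).
  apply: le_Re_cmean => //; first exact: (circ_sqr_modulus fpc).
  move=> z zr; have zr0 : modulus z < r0 by rewrite zr.
  rewrite -[(U \o phi) z]/(herglotz f rho (phi z)) (Re_herglotz fc rho00 (pr z zr0)).
  by apply: submean => //; exact: pr.
rewrite (cmean_value rp rr0 Ud) -[(U \o phi) 0]/(herglotz f rho (phi 0)) (Re_herglotz fc rho00 p0).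
set k := _ / _.
have -> : k * M2 f rho = Re (cmean (fun x => k%:C * (modulus (f x) ^+ 2)%:C) rho).
  rewrite cmeanZ; last exact: circ_sqr_modulus.
  by rewrite cReM Re_cmean /= mul0r subr0.
apply: le_Re_cmean; last 2 first.
- exact: rho00.
- move=> z zr; rewrite !cReM /= !mul0r !subr0 mulrC ler_wpM2r ?sqr_ge0//.
  exact: pk_le.
- by apply: circM; [exact: circ_sqr_modulus|exact: circ_pk].
- by apply: circM; [exact: circ_cst|exact: circ_sqr_modulus].
Qed.

End Poisson.

(** * Integration in polar coordinates *)

Section PlanarMeasure.
Variable R : realType.
Local Notation mu := (@lebesgue_measure R).
Local Notation mu2 := (mu \x mu)%E.
Local Notation R1 := (measurableTypeR R).
Local Notation RR := (R1 * R1)%type.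
Local Open Scope ereal_scope.

Lemma measurable_affine (a b : R) :
  measurable_fun [set: measurableTypeR R]
    (fun x => (a * x + b)%R : measurableTypeR R).
Proof.
by apply: measurable_funD => //; apply: measurable_funM.
Qed.

(** The image of Lebesgue measure under x -> a x + b, scaled by a, gives half-open intervals their
    length, so it is Lebesgue measure by uniqueness. *)
Lemma lebesgue_affine (a b : R) (h : R1 -> \bar R) : (0 < a)%R ->
  measurable_fun [set: R1] h -> (forall x, 0 <= h x) ->
  \int[mu]_x h (a * x + b)%R = (a^-1)%:E * \int[mu]_x h x.
Proof.
move=> a0 mh h0.
pose phi (x : measurableTypeR R) : measurableTypeR R := (a * x + b)%R.
have mphi : measurable_fun setT phi := measurable_affine a b.
pose aN : {nonneg R} := NngNum (ltW a0).
have @m : {measure set (measurableTypeR R) -> \bar R}.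
  by refine (mscale aN (pushforward mu phi)); exact: mphi.
have E : \int[mu]_x h x = \int[m]_x h x.
  apply: eq_measure_integral => A mA _; apply: lebesgue_measure_unique => //.
  move=> _ [[l u] _ <-] /=.
  rewrite -[m _]/(a%:E * mu (phi @^-1` `]l, u])).
  have -> : phi @^-1` `]l, u] = `]((l - b) / a)%R, ((u - b) / a)%R]%classic.
    apply/seteqP; split => x /=; rewrite /phi !in_itv /=.
      by rewrite ltr_pdivrMr// ler_pdivlMr// ltrBlDr lerBrDr mulrC.
    by rewrite ltr_pdivrMr// ler_pdivlMr// ltrBlDr lerBrDr mulrC.
  rewrite !lebesgue_measure_itv /= !lte_fin ltr_pM2r ?invr_gt0// ltrD2r.
  case: ifPn => _; last by rewrite mule0.
  by rewrite -!EFinB -EFinM; congr EFin; field; rewrite gt_eqF.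
rewrite E ge0_integral_mscale//= ge0_integral_pushforward//.
rewrite muleA -EFinM mulVf ?mul1e ?gt_eqF//.
Qed.

Lemma lebesgue_translate (b : R) (h : R1 -> \bar R) :
  measurable_fun [set: R1] h -> (forall x, 0 <= h x) ->
  \int[mu]_x h (x + b)%R = \int[mu]_x h x.
Proof.
move=> mh h0; have := lebesgue_affine b ltr01 mh h0.
by rewrite invr1 mul1e => <-; apply: eq_integral => x _; rewrite mul1r.
Qed.

Implicit Types G : RR -> \bar R.

(** For fixed second coordinate a shear is a translation of the first; Tonelli does the rest. *)
Lemma integral_shear_fst (k : R) G : measurable_fun setT G ->
  (forall p, 0 <= G p) ->
  \int[mu2]_p G (p.1 + k * p.2, p.2)%R = \int[mu2]_p G p.
Proof.
move=> mG G0; pose G' (p : RR) := G (p.1 + k * p.2, p.2)%R.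
have mG' : measurable_fun setT G'.
  apply: measurableT_comp => //; apply: measurable_fun_pair => //.
  by apply: measurable_funD => //; apply: measurable_funM.
have G0' p : 0 <= G' p by exact: G0.
rewrite -[LHS]/(\int[mu2]_p G' p) (fubini_tonelli2 G' mG' G0').
rewrite (fubini_tonelli2 G mG G0); apply: eq_integral => y _.
rewrite /fubini_G /= (lebesgue_translate (k * y) (h := fun x => G (x, y)))//.
exact: measurableT_comp.
Qed.

Lemma integral_shear_snd (k : R) G : measurable_fun setT G ->
  (forall p, 0 <= G p) ->
  \int[mu2]_p G (p.1, p.2 + k * p.1)%R = \int[mu2]_p G p.
Proof.
move=> mG G0; pose G' (p : RR) := G (p.1, p.2 + k * p.1)%R.
have mG' : measurable_fun setT G'.
  apply: measurableT_comp => //; apply: measurable_fun_pair => //.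
  by apply: measurable_funD => //; apply: measurable_funM.
have G0' p : 0 <= G' p by exact: G0.
rewrite -[LHS]/(\int[mu2]_p G' p) (fubini_tonelli1 G' mG' G0').
rewrite (fubini_tonelli1 G mG G0); apply: eq_integral => x _.
rewrite /fubini_F /= (lebesgue_translate (k * x) (h := fun y => G (x, y)))//.
exact: measurableT_comp.
Qed.

Lemma integral_dilation (a : R) G : (0 < a)%R -> measurable_fun setT G ->
  (forall p, 0 <= G p) ->
  \int[mu2]_p G (a * p.1, a * p.2)%R = ((a ^+ 2)^-1)%:E * \int[mu2]_p G p.
Proof.
move=> a0 mG G0; pose G' (p : RR) := G (a * p.1, a * p.2)%R.
have mG' : measurable_fun setT G'.
  apply: measurableT_comp => //; apply: measurable_fun_pair => //;
  by apply: measurable_funM.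
have G0' p : 0 <= G' p by exact: G0.
rewrite -[LHS]/(\int[mu2]_p G' p) (fubini_tonelli1 G' mG' G0').
rewrite (fubini_tonelli1 G mG G0).
have mF : measurable_fun setT (fubini_F mu G) by exact: measurable_fun_fubini_tonelli_F.
have F0 x : 0 <= fubini_F mu G x by apply: integral_ge0.
transitivity (\int[mu]_x ((a^-1)%:E * fubini_F mu G (a * x + 0)%R)).
  apply: eq_integral => x _; rewrite /fubini_F /=.
  rewrite -(lebesgue_affine 0 a0 (h := fun y => G ((a * x + 0)%R, y)))//; last exact: measurableT_comp.
  by apply: eq_integral => y _; rewrite !addr0.
have mFa : measurable_fun setT (fun x => fubini_F mu G (a * x + 0)%R).
  exact: (measurableT_comp mF (measurable_affine a 0)).
have ai0 : 0 <= (a^-1)%:E by rewrite lee_fin invr_ge0 ltW.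
rewrite (ge0_integralZl mu measurableT mFa (fun x _ => F0 (a * x + 0)%R) ai0).
rewrite (lebesgue_affine 0 a0 mF F0) muleA -EFinM; congr (_%:E * _).
by rewrite expr2 invfM.
Qed.

Definition rotate (t : R) (p : RR) : RR :=
  (cos t * p.1 - sin t * p.2, sin t * p.1 + cos t * p.2)%R.

(* A rotation by an angle with nonzero sine is a product of three shears. *)
Lemma integral_rotate t G : measurable_fun setT G -> (forall p, 0 <= G p) ->
  \int[mu2]_p G (rotate t p) = \int[mu2]_p G p.
Proof.
pose rot (c s : R) (p : RR) := (c * p.1 - s * p.2, s * p.1 + c * p.2)%R.
have mrot c s : measurable_fun setT (rot c s).
  by apply: measurable_fun_pair; [apply: measurable_funB|apply: measurable_funD];
    apply: measurable_funM.
have main c s H : (c ^+ 2 + s ^+ 2 = 1)%R -> s != 0%R -> measurable_fun setT H ->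
    (forall p, 0 <= H p) -> \int[mu2]_p H (rot c s p) = \int[mu2]_p H p.
  (* For c = cos t and s = sin t this is -tan (t / 2), the classical coefficient of the two outer
     shears. *)
  move=> cs s0 mH H0; pose k := ((c - 1) / s)%R.
  rewrite -(integral_shear_fst k mH H0).
  have mA : measurable_fun setT (fun p : RR => H (p.1 + k * p.2, p.2)%R).
    apply: measurableT_comp => //; apply: measurable_fun_pair => //.
    by apply: measurable_funD => //; apply: measurable_funM.
  rewrite -(integral_shear_snd s mA)//=.
  have mB : measurable_fun setT
      (fun p : RR => H (p.1 + k * (p.2 + s * p.1), p.2 + s * p.1)%R).
    apply: (measurableT_comp mA (g := fun p : RR => (p.1, p.2 + s * p.1)%R)).
    apply: measurable_fun_pair => //.
    by apply: measurable_funD => //; apply: measurable_funM.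
  rewrite -(integral_shear_fst k mB)//=.
  apply: eq_integral => -[x y] _ /=; congr (H (_, _)); rewrite /rot /k /=; last by field.
  have -> : (c * x - s * y = c * x + (c ^+ 2 - 1) / s * y)%R.
    have -> : (c ^+ 2 - 1 = - s ^+ 2)%R by rewrite -cs; ring.
    by field.
  by field.
move=> mG G0; have cs : (cos t ^+ 2 + sin t ^+ 2 = 1)%R by exact: cos2Dsin2.
have [s0|s0] := eqVneq (sin t) 0%R; last exact: (main _ _ _ cs).
have : (cos t ^+ 2 = 1)%R by rewrite -cs s0 expr0n addr0.
move/eqP; rewrite sqrf_eq1 => /orP[/eqP c1|/eqP c1].
  by apply: eq_integral => -[x y] _; rewrite /rotate c1 s0 /= !mul1r !mul0r subr0 add0r.
(* The half turn has zero sine, and is treated as two quarter turns. *)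
have r1 : ((0 : R) ^+ 2 + 1 ^+ 2 = 1)%R by rewrite expr0n expr1n add0r.
rewrite -(main _ _ _ r1 (oner_neq0 _) mG G0).
have mH : measurable_fun setT (fun p => G (rot 0%R 1%R p)) by apply: measurableT_comp.
rewrite -(main _ _ _ r1 (oner_neq0 _) mH)//.
apply: eq_integral => -[x y] _; rewrite /rotate /rot c1 s0 /=.
by congr (G (_, _)); ring.
Qed.

Definition sqn (p : RR) : R := (p.1 ^+ 2 + p.2 ^+ 2)%R.

Lemma measurable_sqn : measurable_fun setT sqn.
Proof. by apply: measurable_funD; apply: measurable_funX. Qed.

Lemma measurable_sqn_lt (t : R) : measurable [set p : RR | (sqn p < t)%R].
Proof.
rewrite (_ : [set _ | _] = setT `&` sqn @^-1` `]-oo, t[); last first.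
  by rewrite setTI; apply/seteqP; split => p /=; rewrite in_itv.
exact: measurable_sqn.
Qed.

(** The area of the unit disk, kept as a symbol; later arguments use its finiteness. *)
Definition kappa : \bar R := mu2 [set p : RR | (sqn p < 1)%R].

Lemma kappa_lty : kappa < +oo.
Proof.
apply: (@le_lt_trans _ _ (mu2 (`[(-1)%R, 1%R] `*` `[(-1)%R, 1%R]))).
  apply: le_measure; rewrite ?inE.
  - exact: measurable_sqn_lt.
  - exact: measurableX.
  move=> [x y]; rewrite /sqn /= !in_itv /= => H; split; nra.
have mI : measurable (`[(-1)%R, 1%R]%classic : set R1) by [].
have muI : mu `[(-1)%R, 1%R] = (1 - -1)%:E.
  by rewrite lebesgue_measure_itv /= lte_fin ifT//; lra.
have -> : mu2 (`[(-1)%R, 1%R] `*` `[(-1)%R, 1%R]) = (1 - -1)%:E * (1 - -1)%:E.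
  by rewrite -muI; exact: (product_measure1E mu mu mI mI).
by rewrite -EFinM ltry.
Qed.

Lemma measure_sqn_lt (t : R) : (0 < t)%R ->
  mu2 [set p : RR | (sqn p < t)%R] = t%:E * kappa.
Proof.
move=> t0; pose a := (Num.sqrt t)^-1%R.
have a0 : (0 < a)%R by rewrite invr_gt0 sqrtr_gt0.
have a2 : (a ^+ 2 = t^-1)%R by rewrite exprVn sqr_sqrtr// ltW.
pose G (p : RR) : \bar R := (\1_[set p : RR | (sqn p < 1)%R] p)%:E.
have mG : measurable_fun setT G.
  by apply/measurable_EFinP; apply: measurable_indic; exact: measurable_sqn_lt.
have G0 p : 0 <= G p by rewrite lee_fin.
have := integral_dilation a0 mG G0.
rewrite a2 invrK [X in _ = _ * X]integral_indic//; last exact: measurable_sqn_lt.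
rewrite setIT => <-; rewrite -[in LHS](setIT [set p : RR | _]) -integral_indic//; last exact: measurable_sqn_lt.
apply: eq_integral => -[x y] _; rewrite /G !indicE; congr ((_ : bool)%:R%:E).
apply/idP/idP; rewrite !inE /sqn /= !exprMn -mulrDr a2 ltr_pdivrMl// mulr1//.
Qed.

(* By dilation the disk |z|^2 < t has measure t * kappa, which determines the
   image of planar measure under |z|^2. *)
Lemma integral_radial (h : R1 -> \bar R) :
  measurable_fun (`[0%R, 1%R[%classic : set R1) h -> (forall s, 0 <= h s) ->
  \int[mu2]_(p in [set p : RR | (sqn p < 1)%R]) h (sqn p) =
  kappa * \int[mu]_(s in `[0%R, 1%R[) h s.
Proof.
move=> mh h0.
pose q : RR -> measurableTypeR R := sqn.
have kf : kappa \is a fin_num.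
  by rewrite ge0_fin_numE; [exact: kappa_lty|exact: measure_ge0].
have k0 : (0 <= fine kappa)%R by apply: fine_ge0; exact: measure_ge0.
pose kN : {nonneg R} := NngNum k0.
have mI : measurable (`[0%R, 1%R[%classic : set (measurableTypeR R)) by [].
have @mq : {measure set (measurableTypeR R) -> \bar R}.
  by refine (pushforward mu2 q); exact: measurable_sqn.
(* Restricting both measures to [0, 1[ makes them finite, so that agreement on the rays ]-oo, x[, a
   generating family stable under intersection, forces equality. *)
pose m1 : {measure set R1 -> \bar R} := mrestr mq mI.
pose m2 : {measure set R1 -> \bar R} := mscale kN (mrestr mu mI).
have m1E X : m1 X = mu2 (q @^-1` (X `&` `[0%R, 1%R[)) by [].
have m2E X : m2 X = (fine kappa)%:E * mu (X `&` `[0%R, 1%R[) by [].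
have E (A : set R1) : measurable A -> m1 A = m2 A.
  apply: (@measure_unique _ R R1 (@RGenInftyO.G R) (fun k => `]-oo, (k%:R)%R[%classic)).
  - exact: RGenInftyO.measurableE.
  - move=> _ _ [x ->] [y ->]; exists (Num.min x y).
    by apply/seteqP; split => z /=; rewrite !in_itv /= lt_min => /andP.
  - by move=> k; exists k%:R%R.
  - apply/seteqP; split => // x _; exists (Num.bound `|x|%R) => //=.
    rewrite in_itv /=; apply: le_lt_trans (ler_norm _) _; exact: archi_boundP.
  - move=> _ [x ->]; rewrite m1E m2E.
    have [x0|x0] := leP x 0%R.
      rewrite (_ : `]-oo, x[ `&` `[0%R, 1%R[ = set0); last first.
        apply/seteqP; split => // z /=; rewrite !in_itv /= => -[zx /andP[z0 _]].
        by have := lt_le_trans zx x0; rewrite ltNge z0.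
      by rewrite preimage_set0 !measure0 mule0.
    pose y := Num.min x 1%R; have y0 : (0 < y)%R by rewrite lt_min x0 ltr01.
    have -> : `]-oo, x[%classic `&` `[0%R, 1%R[%classic = `[0%R, y[%classic.
      apply/seteqP; split => z /=; rewrite !in_itv /= lt_min.
        by move=> [-> /andP[-> ->]].
      by move=> /andP[-> /andP[-> ->]].
    have -> : q @^-1` `[0%R, y[%classic = [set p : RR | (sqn p < y)%R].
      apply/seteqP; split => p /=; rewrite in_itv /=; first by move=> /andP[].
      by move=> ->; rewrite andbT addr_ge0// sqr_ge0.
    rewrite measure_sqn_lt// lebesgue_measure_itv /= lte_fin y0 sube0 fineK//.
    by rewrite muleC.
  - move=> k; rewrite m1E.
    apply: (@le_lt_trans _ _ kappa); last exact: kappa_lty.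
    apply: le_measure; rewrite ?inE.
    + rewrite -[X in measurable X]setTI; apply: measurable_sqn => //.
      by apply: measurableI.
    + exact: measurable_sqn_lt.
    by move=> p /= [_]; rewrite in_itv /= => /andP[].
transitivity (\int[mq]_(s in `[0%R, 1%R[) h s).
  transitivity (\int[mu2]_(p in q @^-1` `[0%R, 1%R[) (h \o q) p); last first.
    by apply/esym; apply: ge0_integral_pushforward => //; exact: measurable_sqn.
  congr (integral _ _ _); apply/seteqP; split => p /=; rewrite in_itv /=.
    by move=> ->; rewrite andbT addr_ge0// sqr_ge0.
  by move=> /andP[].
transitivity (\int[m2]_(s in `[0%R, 1%R[) h s).
  apply: (@eq_measure_integral _ R1 R _ m2 mq h).
  move=> A mA A01.
  exact: etrans (esym (congr1 (fun X => mu2 (q @^-1` X)) (setIidl A01))) (E A mA).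
transitivity ((fine kappa)%:E * \int[mrestr mu mI]_(s in `[0%R, 1%R[) h s).
  exact: (ge0_integral_mscale (mrestr mu mI) mI kN mh (fun x _ => h0 x)).
rewrite (fineK kf); congr (_ * _).
apply: (@eq_measure_integral _ R1 R _ mu (mrestr mu mI) h) => A mA A01.
have e : A `&` `[0%R, 1%R[%classic = A by exact: setIidl.
by transitivity (mu (A `&` `[0%R, 1%R[%classic)); [by []|rewrite e].
Qed.

End PlanarMeasure.

(* The product of two sigma-finite measures is not inferred to be sigma-finite by
   the library, and Tonelli's theorem on R x (R x R) requires it. *)
Definition plane_measure (R : realType) :
    set (measurableTypeR R * measurableTypeR R) -> \bar R :=
  (@lebesgue_measure R \x @lebesgue_measure R)%E.

HB.instance Definition _ (R : realType) := Measure.on (@plane_measure R).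

Lemma plane_measure_sigma_finite (R : realType) :
  sigma_finite setT (@plane_measure R).
Proof.
pose I n : set (measurableTypeR R) := `[- (n%:R : R), n%:R]%classic.
have mI n : measurable (I n) by exact: measurable_itv.
exists (fun n => I n `*` I n).
  apply/seteqP; split => // -[x y] _.
  pose n := Num.bound (`|x| + `|y|); exists n => //.
  have nP : `|x| + `|y| < n%:R by apply: archi_boundP; rewrite addr_ge0.
  have := ler_norm x; have := ler_norm (- x); rewrite normrN.
  have := ler_norm y; have := ler_norm (- y); rewrite normrN => h1 h2 h3 h4.
  by split; rewrite /I /= in_itv /=; apply/andP; split; have := normr_ge0 x; have := normr_ge0 y; lra.
move=> n; split; first exact: measurableX.
rewrite [X in (X < _)%E](product_measure1E lebesgue_measure lebesgue_measure (mI n) (mI n)).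
have [c cE] : exists c : R, lebesgue_measure (I n) = c%:E.
  by rewrite /I lebesgue_measure_itv; case: ifP => _; eexists; rewrite ?EFinN -?EFinD.
by rewrite [X in (X * X)%E]cE -EFinM ltry.
Qed.

HB.instance Definition _ (R : realType) :=
  Measure_isSigmaFinite.Build _ _ R (@plane_measure R)
    (@plane_measure_sigma_finite R).

(** * Area integrals over the disk as radial integrals of circle means *)

Section BergmanRadial.
Variable R : realType.
Local Notation mu := (@lebesgue_measure R).
Local Notation mu2 := (mu \x mu)%E.
Local Notation R1 := (measurableTypeR R).
Local Notation RR := (R1 * R1)%type.
Implicit Types (f g : R[i] -> R[i]).

Definition cz (p : RR) : R[i] := p.1 +i* p.2.

Lemma sqr_modulus_cz p : modulus (cz p) ^+ 2 = sqn p.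
Proof. by rewrite sqr_modulus. Qed.

Lemma modulus_cz p : modulus (cz p) = Num.sqrt (sqn p).
Proof. by rewrite -sqr_modulus_cz sqrtr_sqr ger0_norm ?modulus_ge0. Qed.

Lemma disk_cz p : disk (cz p) <-> sqn p < 1.
Proof.
rewrite -sqr_modulus_cz /disk /=; split=> H.
  by rewrite expr_lt1// modulus_ge0.
by move: H; rewrite expr_lt1// modulus_ge0.
Qed.

Lemma measurable_czX n :
  measurable_fun (setT : set RR) (fun p => Re (cz p ^+ n)) /\
  measurable_fun (setT : set RR) (fun p => Im (cz p ^+ n)).
Proof.
elim: n => [|n [IH1 IH2]].
  by split; apply: measurable_cst.
split.
- rewrite (_ : (fun p => _) =
      (fun p : RR => p.1 * Re (cz p ^+ n) - p.2 * Im (cz p ^+ n))); last first.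
    by apply/funext => p; rewrite exprS cReM.
  by apply: measurable_funB; apply: measurable_funM.
- rewrite (_ : (fun p => _) =
      (fun p : RR => p.1 * Im (cz p ^+ n) + p.2 * Re (cz p ^+ n))); last first.
    by apply/funext => p; rewrite exprS cImM.
  by apply: measurable_funD; apply: measurable_funM.
Qed.

Lemma measurable_psum b N :
  measurable_fun (setT : set RR) (fun p => Re (psum b N (cz p))) /\
  measurable_fun (setT : set RR) (fun p => Im (psum b N (cz p))).
Proof.
elim: N => [|N [IH1 IH2]].
  by split; under eq_fun do rewrite /psum big_ord0; apply: measurable_cst.
have [m1 m2] := measurable_czX N.
split.
- rewrite (_ : (fun p => _) = (fun p : RR => Re (psum b N (cz p)) +
      (Re (b N) * Re (cz p ^+ N) - Im (b N) * Im (cz p ^+ N)))); last first.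
    by apply/funext => p; rewrite psumS cReD cReM.
  by apply: measurable_funD => //; apply: measurable_funB; apply: measurable_funM.
- rewrite (_ : (fun p => _) = (fun p : RR => Im (psum b N (cz p)) +
      (Re (b N) * Im (cz p ^+ N) + Im (b N) * Re (cz p ^+ N)))); last first.
    by apply/funext => p; rewrite psumS cImD cImM.
  by apply: measurable_funD => //; apply: measurable_funD; apply: measurable_funM.
Qed.

Lemma modulus_cvg (u : nat -> R[i]) l : (fun n => modulus (u n - l)) @ \oo --> 0 ->
  (fun n => modulus (u n)) @ \oo --> modulus l.
Proof.
move/cvgrPdist_lt => H; apply/cvgrPdist_lt => e /H; apply: filterS => n.
rewrite sub0r normrN; apply: le_lt_trans; apply: le_trans (ler_norm _).
rewrite ler_norml; have := ge_modulusB (u n) l; have := ge_modulusB l (u n).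
by rewrite (modulusC l) => h1 h2; apply/andP; split; lra.
Qed.

(** On the disk f is the pointwise limit of its Taylor polynomials, which are measurable; outside it
    f is arbitrary, hence the restricted domain. *)
Lemma measurable_sqr_modulus f : analytic_on_disk f ->
  measurable_fun [set p : RR | sqn p < 1] (fun p => modulus (f (cz p)) ^+ 2).
Proof.
move=> fa; apply: (measurable_fun_cvg (h := fun N p => modulus (psum (scoef f) N (cz p)) ^+ 2)).
  move=> N; apply: (measurable_funS measurableT) => //.
  have [m1 m2] := measurable_psum (scoef f) N.
  under eq_fun do rewrite sqr_modulus.
  by apply: measurable_funD; apply: measurable_funX.
move=> p /disk_cz pd; have := modulus_cvg (psum_cvg fa pd).
by move=> H; exact: (cvgM H H).
Qed.

Lemma parseval_ge0 f r : analytic_on_disk f -> 0 <= r -> r < 1 ->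
  (fun N => \sum_(n < N) modulus (scoef f n) ^+ 2 * r ^+ (2 * n)) @ \oo -->
  M2 f r.
Proof.
move=> fa; rewrite le_eqVlt => /predU1P[<- _|]; last exact: parseval.
have -> : M2 f 0 = modulus (scoef f 0) ^+ 2.
  rewrite -(M2_cst _ 0); apply: eq_M2 => // z /eqP; rewrite modulus_eq0 => /eqP ->.
  have z1 : disk (0 : R[i]) by rewrite /disk /= modulus0.
  have /cvgrPdist_lt H := psum_cvg fa z1.
  apply/eqP; rewrite -subr_eq0 -modulus_eq0 eq_le modulus_ge0 andbT.
  apply/ler_addgt0Pr => e e0; rewrite add0r.
  have [N _ NP] := H _ e0.
  have := NP N.+1 (leqnSn _); rewrite sub0r normrN ger0_norm ?modulus_ge0//.
  rewrite /psum big_ord_recl big1; last by move=> i _; rewrite expr0n mulr0.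
  by rewrite expr0 mulr1 addr0 modulusC => /ltW.
rewrite -cvg_shiftS (_ : (fun n : nat => _) = fun=> modulus (scoef f 0) ^+ 2).
  exact: cvg_cst.
apply/funext => N; rewrite big_ord_recl big1; last by move=> i _; rewrite expr0n mulr0.
by rewrite muln0 expr0 mulr1 addr0.
Qed.

(** In the variable s = r^2, Parseval presents the circle mean as a pointwise limit of polynomials
    in s. *)
Lemma measurable_M2_sqrt f : analytic_on_disk f ->
  measurable_fun (`[0, 1[%classic : set R1) (fun s => M2 f (Num.sqrt s)).
Proof.
move=> fa; apply: (measurable_fun_cvg (h := fun N (s : R1) =>
  \sum_(n < N) modulus (scoef f n) ^+ 2 * s ^+ n)).
  move=> N; apply: (measurable_funS measurableT) => //.
  apply: measurable_sum => n; apply: measurable_funM => //.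
move=> s /=; rewrite in_itv /= => /andP[s0 s1].
have := parseval_ge0 fa (sqrtr_ge0 s).
rewrite (_ : (fun N : nat => _) = (fun N => \sum_(n < N) modulus (scoef f n) ^+ 2 * s ^+ n)).
  by apply; rewrite -sqrtr1 ltr_sqrt.
by apply/funext => N; apply: eq_bigr => n _; rewrite exprM (sqr_sqrtr s0).
Qed.

Lemma integral_conts a b h : conts a b h ->
  (\int[mu]_(t in `[a, b]) (h t)%:E = (rint a b h)%:E)%E.
Proof.
by move=> hc; rewrite /rint /Rintegral fineK//; apply: integrable_fin_num => //; exact: conts_integrable.
Qed.

Lemma circle_mean2E f r : analytic_on_disk f -> 0 <= r -> r < 1 ->
  circle_mean2 f r = (M2 f r)%:E.
Proof.
move=> fa r0 r1; rewrite /circle_mean2 /M2 EFinM; congr (_ * _)%E.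
exact: (integral_conts (conts_sqr_modulus (circ_analytic fa r0 r1))).
Qed.

Lemma cz_rotate t (p : RR) : cz (rotate t p) = cz p * pt 1 t.
Proof.
by apply: complexP; rewrite ?cReM ?cImM /cz /rotate /pt /=; ring.
Qed.

Lemma sqn_rotate t (p : RR) : sqn (rotate t p) = sqn p.
Proof.
by rewrite -!sqr_modulus_cz cz_rotate modulusM modulus_pt// mulr1.
Qed.

(** The orbit of p under rotations is its circle, traversed from the argument of p; [M2_rot] removes
    that starting angle. *)
Lemma rint_rotate f (p : RR) : analytic_on_disk f -> sqn p < 1 ->
  rint 0 (2 * pi) (fun t => modulus (f (cz (rotate t p))) ^+ 2) =
  2 * pi * M2 f (Num.sqrt (sqn p)) /\
  conts 0 (2 * pi) (fun t => modulus (f (cz (rotate t p))) ^+ 2).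
Proof.
move=> fa p1; set r := Num.sqrt _.
have [u u1 pE] : exists2 u : R[i], modulus u = 1 & cz p = u * r%:C.
  have [r0|r0] := eqVneq r 0.
    exists 1; first exact: modulus1.
    by rewrite mul1r r0; apply/eqP; rewrite -modulus_eq0 modulus_cz -/r r0.
  exists (cz p / r%:C).
    by rewrite modulusM modulusV modulus_cz modulus_real ger0_norm ?sqrtr_ge0// divff.
  rewrite divfK// -modulus_eq0 modulus_real normr_eq0//.
have r0 : 0 <= r := sqrtr_ge0 _.
have r1 : r < 1 by rewrite -sqrtr1 ltr_sqrt.
have E t : cz (rotate t p) = u * pt r t.
  rewrite cz_rotate pE -mulrA; congr (_ * _).
  by apply: complexP; rewrite ?cReM ?cImM /=; ring.
have uc : circ (fun z => f (u * z)) r.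
  apply: circ_cdiff => // z zr; apply: (cdiff_comp (f := fun z => u * z)).
    by apply: cdiffM; [exact: cdiff_cst|exact: cdiff_id].
  by apply: (cdiff_an fa); rewrite /disk /= modulusM u1 mul1r zr.
split.
  rewrite -(M2_rot fa u1 r0 r1) /M2 mulrA divff ?mul1r; last first.
    by rewrite mulf_neq0// gt_eqF// pi_gt0.
  by apply: eq_rint => t _; rewrite E.
rewrite (_ : (fun t => _) = (fun t => modulus (f (u * pt r t)) ^+ 2)).
  exact: (conts_sqr_modulus uc).
by apply/funext => t; rewrite E.
Qed.

(** Every rotation preserves the area integral, so integrating over the angle multiplies it by 2 pi.
    After exchanging the integrals the angular one is 2 pi times the circle mean, a radial function
    to which [integral_radial] applies. *)
Lemma integral_disk_radial f (W : R1 -> R) : analytic_on_disk f ->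
  measurable_fun setT W -> (forall s, 0 <= W s) ->
  (\int[mu2]_(p in [set p : RR | (sqn p < 1)%R])
     (modulus (f (cz p)) ^+ 2 * W (sqn p))%:E =
   kappa R * \int[mu]_(s in `[0%R, 1%R[) (M2 f (Num.sqrt s) * W s)%:E)%E.
Proof.
move=> fa mW W0; have pi20 : (0 < 2 * pi :> R) by rewrite mulr_gt0// pi_gt0.
have mD := measurable_sqn_lt (1 : R).
pose F (p : RR) := modulus (f (cz p)) ^+ 2 * W (sqn p).
have mWq : measurable_fun (setT : set RR) (fun p => W (sqn p)).
  exact: measurableT_comp mW (@measurable_sqn R).
have mF : measurable_fun [set p : RR | sqn p < 1] F.
  apply: measurable_funM; first exact: measurable_sqr_modulus.
  exact: (measurable_funS measurableT).
pose G : RR -> \bar R := (EFin \o F) \_ [set p : RR | sqn p < 1].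
have mG : measurable_fun setT G.
  by apply/(measurable_restrictT _ mD); exact/measurable_EFinP.
have F0 p : 0 <= F p by rewrite mulr_ge0 ?sqr_ge0.
have G0 p : (0 <= G p)%E.
  by rewrite /G /patch; case: ifP => // _; rewrite lee_fin.
rewrite integral_mkcond -/G.
pose I2 : set R1 := `[0, 2 * pi]%classic.
(* The indicator of [0, 2 pi] and the extension of [G] by zero allow Tonelli on the whole product
   space. *)
pose H (tp : R1 * RR) : \bar R := ((\1_I2 tp.1)%:E * G (rotate tp.1 tp.2))%E.
have mI2 : measurable I2 by exact: measurable_itv.
have mH : measurable_fun setT H.
  have m1 : measurable_fun (setT : set (R1 * RR)) fst by exact: measurable_fst.
  have m2 : measurable_fun (setT : set (R1 * RR)) snd by exact: measurable_snd.
  have mi : measurable_fun (setT : set R1) (\1_I2 : R1 -> R).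
    exact: measurable_indic.
  apply: emeasurable_funM.
    apply/measurable_EFinP; exact: (measurableT_comp mi m1).
  apply: (measurableT_comp mG).
  have mx : measurable_fun (setT : set (R1 * RR)) (fun tp => tp.2.1 : R).
    exact: (measurableT_comp (@measurable_fst _ _ R1 R1) m2).
  have my : measurable_fun (setT : set (R1 * RR)) (fun tp => tp.2.2 : R).
    exact: (measurableT_comp (@measurable_snd _ _ R1 R1) m2).
  have mc : measurable_fun (setT : set (R1 * RR)) (fun tp => cos tp.1 : R).
    apply: (measurableT_comp (f := @cos R)) => //.
    by apply: continuous_measurable_fun; exact: continuous_cos.
  have ms : measurable_fun (setT : set (R1 * RR)) (fun tp => sin tp.1 : R).
    apply: (measurableT_comp (f := @sin R)) => //.
    by apply: continuous_measurable_fun; exact: continuous_sin.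
  apply: measurable_fun_pair.
    by apply: measurable_funB; apply: measurable_funM.
  by apply: measurable_funD; apply: measurable_funM.
have H0 tp : (0 <= H tp)%E by rewrite mule_ge0// lee_fin.
have mGt t : measurable_fun (setT : set RR) (fun p => G (rotate t p)).
  apply: (measurableT_comp mG); apply: measurable_fun_pair.
    by apply: measurable_funB; apply: measurable_funM.
  by apply: measurable_funD; apply: measurable_funM.
have ton := fubini_tonelli (m1 := mu) (m2 := @plane_measure R) H mH H0.
have pos0 : (0 <= (2 * pi)%:E :> \bar R)%E by rewrite lee_fin ltW.
have lhs : (\int[mu]_t \int[mu2]_p H (t, p) = (2 * pi)%:E * \int[mu2]_p G p)%E.
  transitivity (\int[mu]_t ((\int[mu2]_p G p) * (\1_I2 t)%:E))%E.
    apply: eq_integral => t _; rewrite /H /=.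
    have i0 : (0 <= (\1_I2 t)%:E :> \bar R)%E by rewrite lee_fin.
    rewrite (ge0_integralZl mu2 measurableT (mGt t) (fun p _ => G0 _) i0).
    by rewrite integral_rotate// muleC.
  have mi : measurable_fun (setT : set R1) (fun t => (\1_I2 t)%:E : \bar R).
    by apply/measurable_EFinP; exact: measurable_indic.
  have i0 t : setT t -> (0 <= (\1_I2 t)%:E :> \bar R)%E by rewrite lee_fin.
  have I0 : (0 <= \int[mu2]_p G p)%E by apply: integral_ge0.
  rewrite (ge0_integralZl mu measurableT mi i0 I0) integral_indic// setIT muleC.
  have muI2 : mu I2 = (2 * pi)%:E.
    by rewrite /I2 lebesgue_measure_itv /= lte_fin pi20 sube0.
  by rewrite -muI2.
pose h (s : R1) : \bar R := (2 * pi * (M2 f (Num.sqrt s) * W s))%:E.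
have h0 s : (0 <= h s)%E by rewrite lee_fin mulr_ge0 ?(ltW pi20)// mulr_ge0 ?M2_ge0.
have mMW : measurable_fun (`[0, 1[%classic : set R1)
    (fun s => (M2 f (Num.sqrt s) * W s)%:E).
  apply/measurable_EFinP; apply: measurable_funM; first exact: measurable_M2_sqrt.
  exact: (measurable_funS measurableT).
have mh : measurable_fun (`[0, 1[%classic : set R1) h.
  apply/measurable_EFinP; apply: measurable_funM => //.
  exact/measurable_EFinP.
have rhs : (\int[mu2]_p \int[mu]_t H (t, p) =
    \int[mu2]_(p in [set p : RR | (sqn p < 1)%R]) h (sqn p))%E.
  rewrite [RHS]integral_mkcond; apply: eq_integral => p _.
  have [pD|pD] := pselect (sqn p < 1); rewrite [in RHS]/patch; last first.
    rewrite [in RHS]memNset//.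
    rewrite [LHS]integral0_eq// => t _; rewrite /H /G /patch /= memNset ?mule0//=.
    by rewrite sqn_rotate.
  rewrite [in RHS]mem_set//; have [rE rc] := rint_rotate fa pD.
  transitivity (\int[mu]_(t in I2) (modulus (f (cz (rotate t p))) ^+ 2 * W (sqn p))%:E)%E.
    rewrite [RHS]integral_mkcond; apply: eq_integral => t _.
    rewrite /H /= /G {1}/patch mem_set /= ?sqn_rotate// /F /= sqn_rotate.
    rewrite /patch indicE; case: ifPn => _; first by rewrite mul1e.
    by rewrite mul0e.
  rewrite integral_conts; last first.
    by move=> t tP; apply: continuousM; [exact: rc|exact: cvg_cst].
  congr EFin; rewrite (eq_rint (h2 := fun t => W (sqn p) * modulus (f (cz (rotate t p))) ^+ 2)).
    by rewrite rintZ// rE; ring.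
  by move=> t _; rewrite mulrC.
have := ton; rewrite [X in X = _ -> _]lhs [X in _ = X -> _]rhs.
rewrite integral_radial// /h.
under [X in (kappa R * X)%E]eq_integral do rewrite EFinM.
rewrite ge0_integralZl//; last by move=> s _; rewrite lee_fin mulr_ge0 ?M2_ge0.
rewrite muleCA => /(congr1 (mule ((2 * pi)^-1)%:E)).
by rewrite !muleA -EFinM mulVf ?mul1e// gt_eqF.
Qed.

End BergmanRadial.

(** * The norms as functions of circle means *)

Section SelfMap.
Variable R : realType.
Implicit Types (f phi : R[i] -> R[i]).

Lemma littlewood_disk phi : analytic_on_disk phi ->
  (forall z, disk z -> disk (phi z)) ->
  exists c K : R, [/\ 0 < c, c <= 1, 0 <= K &
    forall f s, analytic_on_disk f -> 0 < s -> s < 1 ->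
      M2 (f \o phi) (Num.sqrt s) <= K * M2 f (Num.sqrt (1 - c * (1 - s)))].
Proof.
move=> pa pd; set a := modulus (phi 0).
have a0 : 0 <= a := modulus_ge0 _.
have a1 : a < 1 by apply: (pd 0); rewrite /disk /= modulus0.
(* If |z|^2 < (1 + s) / 2 then 1 - |z| > (1 - s) / 4, and the 1/4 of [self_map_harnack] gives 1 -
   |phi z| > c (1 - s). Moreover rho >= 1 - c makes rho - a at least 15/16 of 1 - a, so (rho + a) /
   (rho - a) <= 4 / (1 - a). *)
pose c := (1 - a) / 16; exists c, (4 / (1 - a)).
have c0 : 0 < c by rewrite /c; lra.
have c1 : c <= 1 by rewrite /c; lra.
split=> //; first by rewrite divr_ge0; lra.
move=> f s fa s0 s1; set rho2 := 1 - c * (1 - s); set rho := Num.sqrt rho2.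
have rho20 : 0 < rho2 by rewrite /rho2; nra.
have rho21 : rho2 < 1 by rewrite /rho2; nra.
have rE : rho ^+ 2 = rho2 by rewrite sqr_sqrtr// ltW.
have r0 : 0 < rho by rewrite sqrtr_gt0.
have r1 : rho < 1 by rewrite -sqrtr1 ltr_sqrt.
have rr : rho2 <= rho by rewrite -rE expr2 ger_pMr// ltW.
have sc : (15 / 16) <= rho2 by rewrite /rho2 /c; nra.
(* [littlewood] needs phi controlled beyond the circle of radius sqrt s; the squared radius is taken
   halfway between s and 1. *)
pose R0 := Num.sqrt ((1 + s) / 2).
have ss0 : 0 < Num.sqrt s by rewrite sqrtr_gt0.
have sR0 : Num.sqrt s < R0 by rewrite ltr_sqrt; lra.
have R00 : 0 <= (1 + s) / 2 by lra.
have R01 : R0 < 1 by rewrite -sqrtr1 ltr_sqrt; lra.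
have pr z : modulus z < R0 -> modulus (phi z) < rho.
  move=> zR; have z1 : disk z by exact: lt_trans R01.
  have H := self_map_harnack pa pd z1; rewrite -/a in H.
  have z0 := modulus_ge0 z; have m1 := modulus_ge0 (phi z).
  have z2 : modulus z ^+ 2 < (1 + s) / 2.
    by rewrite -(sqr_sqrtr R00) ltr_pXn2r ?nnegrE ?sqrtr_ge0.
  have p1 : modulus (phi z) < 1 := pd z z1.
  rewrite -(ltr_pXn2r (n := 2)) ?nnegrE ?modulus_ge0 ?(ltW r0)// rE.
  rewrite /disk /= in z1.
  apply: (@le_lt_trans _ _ (modulus (phi z))).
    by rewrite expr2 -[leRHS]mulr1 ler_wpM2l// ltW.
  rewrite /rho2 /c; nra.
have := littlewood fa ss0 sR0 r1 (fun z zR => cdiff_an pa (lt_trans zR R01)) pr.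
rewrite -/a => H; apply: le_trans H _; rewrite ler_wpM2r ?M2_ge0//.
have ra : a < rho by rewrite /rho2 /c in sc rr *; nra.
rewrite ler_pdivrMr; last lra.
rewrite mulrAC ler_pdivlMr; last lra.
rewrite /rho2 /c in sc rr; nra.
Qed.

End SelfMap.

Section Gauge.
Variable R : realType.
Local Notation mu := (@lebesgue_measure R).
Local Notation R1 := (measurableTypeR R).
Implicit Types (f g h phi : R[i] -> R[i]).

(* The squared norms of H^2 and A^2_beta depend on f only through its circle
   means M2 f; the chaos argument only uses the following five properties. *)
Record gauge (Phi : (R[i] -> R[i]) -> \bar R) : Prop := {
  gauge_ge0 : forall f, (0 <= Phi f)%E;
  gauge_le : forall f g h (a b : R), analytic_on_disk f -> analytic_on_disk g ->
    analytic_on_disk h -> 0 <= a -> 0 <= b ->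
    (forall r, 0 < r -> r < 1 -> M2 f r <= a * M2 g r + b * M2 h r) ->
    (Phi f <= a%:E * Phi g + b%:E * Phi h)%E;
  gauge_one : (Phi (fun=> 1%R) < +oo)%E;
  gauge_comp : forall phi, analytic_on_disk phi ->
    (forall z, disk z -> disk (phi z)) -> exists2 K : R, 0 <= K &
    forall f, analytic_on_disk f -> (Phi (f \o phi) <= K%:E * Phi f)%E;
  gauge_dense : forall f, analytic_on_disk f -> (Phi f < +oo)%E ->
    forall e : R, 0 < e ->
    exists N, (Phi (fun z => f z - psum (scoef f) N z)%R < e%:E)%E }.

Lemma analytic_cst (c : R[i]) : analytic_on_disk (fun=> c).
Proof. by apply/analytic_cdiff => z _; exact: cdiff_cst. Qed.

Lemma analytic_psum b N : analytic_on_disk (psum b N : R[i] -> R[i]).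
Proof.
apply/analytic_cdiff => z _.
apply: (@cdiff_sum _ _ _ (fun (i : 'I_N) x => b i * x ^+ i)) => i.
by apply: cdiffM; [exact: cdiff_cst|apply: cdiffX; exact: cdiff_id].
Qed.

Lemma analyticB f g : analytic_on_disk f -> analytic_on_disk g ->
  analytic_on_disk (fun z => f z - g z).
Proof.
move=> fa ga; apply/analytic_cdiff => z z1.
by apply: cdiffB; [exact: cdiff_an|exact: cdiff_an].
Qed.

Lemma analyticD f g : analytic_on_disk f -> analytic_on_disk g ->
  analytic_on_disk (fun z => f z + g z).
Proof.
move=> fa ga; apply/analytic_cdiff => z z1.
by apply: cdiffD; [exact: cdiff_an|exact: cdiff_an].
Qed.

Lemma analyticM f g : analytic_on_disk f -> analytic_on_disk g ->
  analytic_on_disk (fun z => f z * g z).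
Proof.
move=> fa ga; apply/analytic_cdiff => z z1.
by apply: cdiffM; [exact: cdiff_an|exact: cdiff_an].
Qed.

Lemma analytic_comp f phi : analytic_on_disk f -> analytic_on_disk phi ->
  (forall z, disk z -> disk (phi z)) -> analytic_on_disk (f \o phi).
Proof.
move=> fa pa pd; apply/analytic_cdiff => z z1.
apply: cdiff_comp; first exact: cdiff_an.
by apply: cdiff_an => //; exact: pd.
Qed.

Definition hardy_gauge f : \bar R :=
  ereal_sup [set (M2 f r)%:E | r in `]0, 1[%classic].

Lemma hardy_norm_gauge f : analytic_on_disk f ->
  hardy_norm f = poweR (hardy_gauge f) 2^-1.
Proof.
move=> fa; congr (poweR (ereal_sup _) _); apply/seteqP; split => _ /= [r rI <-];
  exists r => //; move: rI; rewrite /= in_itv /= => /andP[r0 r1].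
- by rewrite circle_mean2E// ltW.
- by rewrite circle_mean2E// ltW.
Qed.

Lemma le_hardy_gauge f r : 0 < r -> r < 1 -> ((M2 f r)%:E <= hardy_gauge f)%E.
Proof.
by move=> r0 r1; apply: ereal_sup_ubound; exists r => //=; rewrite in_itv /= r0.
Qed.

Lemma hardy_gauge_le f (M : \bar R) :
  (forall r, 0 < r -> r < 1 -> ((M2 f r)%:E <= M)%E) -> (hardy_gauge f <= M)%E.
Proof.
move=> H; apply: ge_ereal_sup => _ [r rI <-]; move: rI; rewrite /= in_itv /= => /andP[r0 r1].
exact: H.
Qed.

Lemma half_itv : (0 : R) < 2^-1 /\ (2^-1 : R) < 1.
Proof. by rewrite invr_gt0 invf_lt1 ?ltr1n. Qed.

Lemma hardy_gauge_ge0 f : (0 <= hardy_gauge f)%E.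
Proof.
have [h0 h1] := half_itv; apply: le_trans (le_hardy_gauge f h0 h1).
by rewrite lee_fin M2_ge0.
Qed.

(** For r < 1 the finite sum weighted by r^(2n) is at most M2 f r; being a polynomial in r, it
    passes to the limit along r = 1 - 2^-(k+1). *)
Lemma modulus_scoef_sum_le f B N : analytic_on_disk f ->
  (forall r, 0 < r -> r < 1 -> M2 f r <= B) ->
  \sum_(n < N) modulus (scoef f n) ^+ 2 <= B.
Proof.
move=> fa fB; pose P (x : R) := \sum_(n < N) modulus (scoef f n) ^+ 2 * x ^+ (2 * n).
have PE : \sum_(n < N) modulus (scoef f n) ^+ 2 = P 1.
  by apply: eq_bigr => n _; rewrite expr1n mulr1.
have h : (fun k => 1 - (2^-1 : R) ^+ k.+1) @ \oo --> (1 : R).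
  have h2 : `|2^-1 : R| < 1 by rewrite ger0_norm// invf_lt1 ?ltr1n.
  have : (fun k => 1 - (2^-1 : R) ^+ k) @ \oo --> (1 : R).
    by have := cvgB (cvg_cst (1 : R)) (cvg_expr h2); rewrite subr0; exact.
  by rewrite -(cvg_shiftS (fun k => 1 - (2^-1 : R) ^+ k)); exact.
have hX m : (fun k => (1 - (2^-1 : R) ^+ k.+1) ^+ m) @ \oo --> (1 : R) ^+ m.
  elim: m => [|m IH]; first exact: cvg_cst.
  by under eq_fun do rewrite exprS; rewrite exprS; exact: cvgM.
have Pc : (fun k => P (1 - (2^-1 : R) ^+ k.+1)) @ \oo --> P 1.
  rewrite /P; elim: (N) => [|n IH].
    by under eq_fun do rewrite big_ord0; rewrite big_ord0; exact: cvg_cst.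
  under eq_fun do rewrite big_ord_recr; rewrite big_ord_recr.
  by apply: cvgD => //; apply: cvgM => //; exact: cvg_cst.
rewrite PE; apply: (ler_cvg_to Pc (cvg_cst B)); apply: nearW => k.
have [h0 h1] := half_itv.
have e0 : 0 < (2^-1 : R) ^+ k.+1 by rewrite exprn_gt0.
have e1 : (2^-1 : R) ^+ k.+1 < 1 by rewrite exprn_ilt1// ltW.
have r0 : 0 < 1 - (2^-1 : R) ^+ k.+1 by rewrite subr_gt0.
have r1 : 1 - (2^-1 : R) ^+ k.+1 < 1 by rewrite gtrBl.
apply: le_trans (fB _ r0 r1); rewrite -subr_ge0 -M2_sub_psum//; exact: M2_ge0.
Qed.

Lemma hardy_gaugeP : gauge hardy_gauge.
Proof.
split.
- exact: hardy_gauge_ge0.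
- move=> f g h a b fa ga ha a0 b0 H; apply: hardy_gauge_le => r r0 r1.
  apply: (@le_trans _ _ (a%:E * (M2 g r)%:E + b%:E * (M2 h r)%:E)%E).
    by rewrite -!EFinM -EFinD lee_fin; exact: H.
  by apply: leeD; apply: lee_wpmul2l; rewrite ?lee_fin//; exact: le_hardy_gauge.
- apply: (@le_lt_trans _ _ 1%:E); last exact: ltry.
  by apply: hardy_gauge_le => r _ _; rewrite M2_cst modulus1 expr1n.
- move=> phi pa pd; have [c [K [c0 c1 K0 H]]] := littlewood_disk pa pd.
  exists K => // f fa; apply: hardy_gauge_le => r r0 r1.
  have s0 : 0 < r ^+ 2 by rewrite exprn_gt0.
  have s1 : r ^+ 2 < 1 by rewrite expr_lt1// ltW.
  have := H f _ fa s0 s1; rewrite sqrtr_sqr ger0_norm ?(ltW r0)// => H1.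
  apply: (@le_trans _ _ (K%:E * (M2 f (Num.sqrt (1 - c * (1 - r ^+ 2))))%:E)%E).
    by rewrite -EFinM lee_fin.
  apply: lee_wpmul2l; first by rewrite lee_fin.
  apply: le_hardy_gauge; first by rewrite sqrtr_gt0; nra.
  by rewrite -[ltRHS]sqrtr1 ltr_sqrt// gtrBl mulr_gt0// subr_gt0.
- move=> f fa fy e e0.
  have ff : hardy_gauge f \is a fin_num by rewrite ge0_fin_numE// hardy_gauge_ge0.
  pose u n := modulus (scoef f n) ^+ 2.
  have u0 n : 0 <= u n by rewrite sqr_ge0.
  have uB N : \sum_(n < N) u n <= fine (hardy_gauge f).
    apply: modulus_scoef_sum_le => // r r0 r1.
    by rewrite -lee_fin fineK//; exact: le_hardy_gauge.
  have /cvg_ex[/= l /cvgrPdist_lt Hl] : cvg (series u @ \oo).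
    apply: nondecreasing_is_cvgn.
      by apply/nondecreasing_seqP => n; rewrite /series /= big_nat_recr//= lerDl.
    by exists (fine (hardy_gauge f)) => _ [N _ <-]; rewrite /series /= big_mkord.
  (* Two partial sums within e / 4 of the limit differ by less than e / 2, which bounds the
     remainder on all circles at once; the supremum is then at most e / 2 < e. *)
  have [N _ NP] := Hl (e / 4) ltac:(lra); exists N.
  apply: (@le_lt_trans _ _ (e / 2)%:E); last by rewrite lte_fin; lra.
  apply: hardy_gauge_le => r r0 r1; rewrite lee_fin.
  apply: M2_sub_psum_le => // M; have [MN|NM] := leqP M N.
    by rewrite big_geq//; lra.
  apply: (@le_trans _ _ (\sum_(N <= n < M) u n)).
    rewrite !big_nat; apply: ler_sum => n _; rewrite -[leRHS]mulr1 ler_wpM2l ?sqr_ge0//.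
    by rewrite exprn_ile1// ltW.
  have -> : \sum_(N <= n < M) u n = series u M - series u N.
    by rewrite /series /= (big_cat_nat (leq0n N) (ltnW NM))/=; ring.
  have := NP N (leqnn _); have := NP M (ltnW NM).
  by rewrite !ltr_norml => /andP[? ?] /andP[? ?]; lra.
Qed.

End Gauge.

(** * Integrability of (1 - s)^b for b > -1 *)

Section PowerIntegral.
Variable R : realType.
Local Notation mu := (@lebesgue_measure R).
Local Notation R1 := (measurableTypeR R).

Lemma measurable_onem_powR (b : R) :
  measurable_fun (setT : set R1) (fun s => (1 - s) `^ b).
Proof.
apply: (measurableT_comp (f := @powR R ^~ b) (g := fun s : R1 => 1 - s : R)).
  exact: measurable_powR.
by apply: measurable_funB => //; exact: measurable_id.
Qed.

(* J_n, the integral over (0, 1 - 2^-n], satisfies J_(n+1) <= q (1 + J_n) with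
   q = 2^(-b-1) < 1, by the substitution s = (1 + s') / 2. *)
Lemma integral_onem_powR_neg (b : R) : -1 < b -> b < 0 ->
  (\int[mu]_(s in `]0%R, 1%R[) ((1 - s) `^ b)%:E < +oo)%E.
Proof.
move=> b1 b0; pose p (s : R1) : R := (1 - s) `^ b.
have mp : measurable_fun (setT : set R1) p by exact: measurable_onem_powR.
have p0 s : 0 <= p s by exact: powR_ge0.
pose I n : set R1 := `]0, 1 - 2^-1 ^+ n]%classic.
have mI n : measurable (I n) by exact: measurable_itv.
pose H n (s : R1) : \bar R := ((\1_(I n) s)%:E * (p s)%:E)%E.
have mH n : measurable_fun setT (H n).
  apply: emeasurable_funM; last exact/measurable_EFinP.
  by apply/measurable_EFinP; exact: measurable_indic.
have H0 n s : (0 <= H n s)%E by rewrite mule_ge0// lee_fin.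
pose two_b : R := 2^-1 `^ b.
have tb0 : 0 < two_b by rewrite powR_gt0// invr_gt0.
pose q : R := two_b / 2.
have q0 : 0 < q by rewrite divr_gt0.
have n2 : ((2^-1 : R) == 0) = false by rewrite invr_eq0 pnatr_eq0.
have q1 : q < 1.
  have -> : q = 2^-1 `^ (b + 1).
    by rewrite powRD ?powRr1// ?invr_ge0//; apply/implyP => _; rewrite invr_eq0.
  have h01 : 0 < (2^-1 : R) <= 1 by apply/andP; split; lra.
  rewrite /powR n2 -[ltRHS]expR0 ltr_expR pmulr_rlt0; last lra.
  by apply: ln_lt0; apply/andP; split; lra.
(* The fixed point of x -> q (1 + x), hence a bound preserved by the recursion. *)
pose B : R := q / (1 - q).
have BE : q * (1 + B) = B by rewrite /B; field; lra.
have J n : (\int[mu]_s H n s <= B%:E)%E.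
  elim: n => [|n IH].
    rewrite integral0_eq; first by rewrite lee_fin divr_ge0; lra.
    move=> s _; rewrite /H indicE memNset ?mul0e// /I expr0 subrr /= in_itv /=.
    by move=> /andP[s0 s1]; have := lt_le_trans s0 s1; rewrite ltxx.
  pose A : set R1 := `]0, 2^-1]%classic.
  have mA : measurable A by exact: measurable_itv.
  have mG : measurable_fun (setT : set R1) (fun s => (two_b * \1_A s)%R%:E).
    by apply/measurable_EFinP; apply: measurable_funM => //; exact: measurable_indic.
  have mH' : measurable_fun (setT : set R1) (fun s => H n (2 * s + -1)%R).
    exact: (measurableT_comp (mH n) (measurable_affine 2 (-1))).
  (* On ]0, 1/2] the power is at most 2^-b since b < 0; on the rest s' = 2 s - 1 satisfies 1 - s =
     (1 - s') / 2. *)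
  have HS s : (H n.+1 s <= (two_b * \1_A s)%R%:E + two_b%:E * H n (2 * s + -1)%R)%E.
    have r0 : (0 <= (two_b * \1_A s)%R%:E :> \bar R)%E by rewrite lee_fin mulr_ge0 ?(ltW tb0).
    have r1 : (0 <= two_b%:E * H n (2 * s + -1)%R)%E by rewrite mule_ge0// lee_fin ltW.
    rewrite [in leLHS]/H indicE; have [/set_mem|_] := boolP (s \in I n.+1); last first.
      by rewrite mul0e adde_ge0.
    rewrite mul1e /I /= in_itv /= => /andP[s0 s1].
    have [s2|s2] := leP s 2^-1.
      apply: le_trans (_ : (two_b * \1_A s)%R%:E <= _)%E; last by rewrite leeDl.
      rewrite lee_fin indicE mem_set ?mulr1; last by rewrite /A /= in_itv /= s0 s2.
      rewrite /p /two_b /powR n2.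
      have h : 2^-1 <= 1 - s by lra.
      have h0 : (0 : R) < 2^-1 by rewrite invr_gt0.
      rewrite gt_eqF; last by lra.
      rewrite ler_expR ler_nM2l// ler_ln// posrE; lra.
    apply: le_trans (_ : two_b%:E * H n (2 * s + -1)%R <= _)%E; last by rewrite leeDr.
    rewrite /H indicE mem_set; last first.
      rewrite /I /= in_itv /=; move: s1; rewrite exprS => s1; apply/andP; split; lra.
    rewrite mul1e -EFinM lee_fin /p /two_b -powRM; [|lra|].
      by rewrite (_ : 2^-1 * (1 - (2 * s + -1)%R) = 1 - s)//; field.
    have e0 : 0 <= (2^-1 : R) ^+ n.+1 by rewrite exprn_ge0// invr_ge0.
    lra.
  apply: (@le_trans _ _ (\int[mu]_s ((two_b * \1_A s)%R%:E + two_b%:E * H n (2 * s + -1)%R)))%E.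
    apply: ge0_le_integral => //.
    by apply: emeasurable_funD => //; exact: measurable_funeM.
  rewrite ge0_integralD//; last 3 first.
  - by move=> s _; rewrite lee_fin mulr_ge0 ?(ltW tb0).
  - by move=> s _; rewrite mule_ge0// lee_fin ltW.
  - exact: measurable_funeM.
  rewrite (ge0_integralZl mu measurableT mH'); [|by []|by rewrite lee_fin ltW].
  rewrite (lebesgue_affine (-1) (ltr0n R 2) (mH n) (H0 n)).
  have -> : (\int[mu]_s (two_b * \1_A s)%R%:E = q%:E)%E.
    under eq_integral do rewrite EFinM.
    have mA1 : measurable_fun (setT : set R1) (fun s => (\1_A s)%:E : \bar R).
      by apply/measurable_EFinP; exact: measurable_indic.
    have A0 s : setT s -> (0 <= (\1_A s)%:E :> \bar R)%E by rewrite lee_fin.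
    have t0 : (0 <= two_b%:E :> \bar R)%E by rewrite lee_fin ltW.
    rewrite (ge0_integralZl mu measurableT mA1 A0 t0) integral_indic// setIT.
    have muA : mu A = (2^-1)%:E.
      by rewrite /A lebesgue_measure_itv /= lte_fin invr_gt0 ltr0n sube0.
    by rewrite /q EFinM -muA.
  rewrite -BE mulrDr mulr1 EFinD; apply: leeD => //.
  rewrite muleA -EFinM -/q [X in (_ <= X)%E]EFinM; apply: lee_wpmul2l => //.
  by rewrite lee_fin ltW.
have cv := cvg_monotone_convergence (mu := mu) measurableT mH (fun n s _ => H0 n s).
have nd s : {homo H ^~ s : n m / (n <= m)%N >-> (n <= m)%E}.
  move=> n m nm; rewrite /H; apply: lee_wpmul2r; first by rewrite lee_fin.
  rewrite lee_fin !indicE; case: (boolP (s \in I n)) => // /set_mem.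
  rewrite /I /= in_itv /= => /andP[s0 s1]; rewrite mem_set// /= in_itv /= s0 /=.
  apply: le_trans s1 _; rewrite lerD2l lerN2.
  by apply: ler_wiXn2l => //; lra.
have {}cv := cv (fun s _ => nd s).
have -> : (\int[mu]_(s in `]0%R, 1%R[) ((1 - s) `^ b)%:E =
    \int[mu]_s limn (H ^~ s))%E.
  rewrite [LHS]integral_mkcond; apply: eq_integral => s _; apply/esym/cvg_lim => //.
  rewrite /patch; case: ifPn => [/set_mem|sI].
    rewrite /= in_itv /= => /andP[s0 s1].
    have h2 : `|2^-1 : R| < 1 by rewrite ger0_norm// invf_lt1 ?ltr1n.
    have s1' : 0 < 1 - s by rewrite subr_gt0.
    have /cvgrPdist_lt/(_ _ s1')[N _ NP] := cvg_expr h2.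
    apply: cvg_near_cst; exists N => // n /= /NP; rewrite sub0r normrN => Hn.
    have sIn : I n s.
      rewrite /I /= in_itv /= s0 /=.
      by have := ler_norm ((2^-1 : R) ^+ n); lra.
    by rewrite /H indicE mem_set// mul1e.
  rewrite (_ : H ^~ s = fun=> 0%E); first exact: cvg_cst.
  apply/funext => n; rewrite /H indicE memNset ?mul0e// => sIn.
  move/negP: sI; apply; rewrite mem_set//=; move: sIn; rewrite /I /= !in_itv /=.
  move=> /andP[-> s1] /=; apply: le_lt_trans s1 _; rewrite gtrBl exprn_gt0//.
have H1 := cvg_lim (@ereal_hausdorff R) cv; rewrite -H1.
apply: (@le_lt_trans _ _ B%:E); last exact: ltry.
apply: lime_le; first by apply/cvg_ex; eexists; exact: cv.
by apply: nearW => n; exact: J.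
Qed.

(** As 0 < 1 - s < 1, lowering the exponent to min(b, -1/2) only increases the integrand. *)
Lemma integral_onem_powR (b : R) : -1 < b ->
  (\int[mu]_(s in `]0%R, 1%R[) ((1 - s) `^ b)%:E < +oo)%E.
Proof.
move=> b1; pose b' := Num.min b (- 2^-1).
have h0 : (0 : R) < 2^-1 by rewrite invr_gt0.
have h1 : (2^-1 : R) < 1 by rewrite invf_lt1// ltr1n.
have b'1 : -1 < b' by rewrite lt_min b1 ltrN2.
have b'0 : b' < 0 by rewrite gt_min oppr_lt0 h0 orbT.
apply: le_lt_trans (integral_onem_powR_neg b'1 b'0).
apply: ge0_le_integral => //.
- by move=> s _; rewrite lee_fin powR_ge0.
- by apply/measurable_EFinP; apply: (measurable_funS measurableT) => //; exact: measurable_onem_powR.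
- by apply/measurable_EFinP; apply: (measurable_funS measurableT) => //; exact: measurable_onem_powR.
move=> s; rewrite /= in_itv /= => /andP[s0 s1]; rewrite lee_fin.
apply: ger_powR; last by rewrite /b' ge_min lexx.
by apply/andP; split; lra.
Qed.

End PowerIntegral.

(** * The weighted Bergman norm as a gauge *)

Section BergmanGauge.
Variables (R : realType) (beta : R).
Hypothesis hbeta : -1 < beta.
Local Notation mu := (@lebesgue_measure R).
Local Notation mu2 := (mu \x mu)%E.
Local Notation R1 := (measurableTypeR R).
Local Notation RR := (R1 * R1)%type.
Local Notation I01 := (`]0%R, 1%R[%classic : set R1).
Implicit Types (f g h phi : R[i] -> R[i]).

Definition bergman_weight (s : R1) : R := pi^-1 * (beta + 1) * (1 - s) `^ beta.

Definition bergman_density f (s : R1) : \bar R :=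
  (M2 f (Num.sqrt s) * bergman_weight s)%:E.

(** The interval is open at 0, at the cost of a null set, so that facts about circle means of radius
    r > 0 apply at every point. *)
Definition bergman_gauge f : \bar R :=
  (kappa R * \int[mu]_(s in I01) bergman_density f s)%E.

Lemma bergman_weight_ge0 s : 0 <= bergman_weight s.
Proof.
apply: mulr_ge0; last exact: powR_ge0.
by apply: mulr_ge0; [rewrite invr_ge0 pi_ge0|rewrite -lerBlDr sub0r ltW].
Qed.

Lemma measurable_bergman_weight : measurable_fun (setT : set R1) bergman_weight.
Proof. by apply: measurable_funM => //; exact: measurable_onem_powR. Qed.

Lemma bergman_density_ge0 f s : (0 <= bergman_density f s)%E.
Proof. by rewrite lee_fin mulr_ge0// ?M2_ge0// bergman_weight_ge0. Qed.

Lemma measurable_bergman_density f : analytic_on_disk f ->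
  measurable_fun (`[0%R, 1%R[%classic : set R1) (bergman_density f).
Proof.
move=> fa; apply/measurable_EFinP; apply: measurable_funM.
  exact: measurable_M2_sqrt.
by apply: (measurable_funS measurableT) => //; exact: measurable_bergman_weight.
Qed.

Lemma measurable_bergman_density_oo f : analytic_on_disk f ->
  measurable_fun I01 (bergman_density f).
Proof.
move=> fa; apply: (measurable_funS _ _ (measurable_bergman_density fa)) => //.
by move=> s /=; rewrite !in_itv /= => /andP[/ltW -> ->].
Qed.

Lemma bergman_norm_gauge f : analytic_on_disk f ->
  bergman_norm beta f = poweR (bergman_gauge f) 2^-1.
Proof.
move=> fa; rewrite /bergman_norm /bergman_gauge; congr (poweR _ _).
transitivity (\int[mu2]_(p in [set p : RR | (sqn p < 1)%R])
    (modulus (f (cz p)) ^+ 2 * bergman_weight (sqn p))%:E)%E.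
  have -> : [set p : RR | sqn p < 1] = [set p : R * R | disk (p.1 +i* p.2)].
    by apply/seteqP; split => p /= /disk_cz.
  by apply: eq_integral => p _; rewrite /bergman_weight -sqr_modulus_cz.
rewrite (integral_disk_radial fa measurable_bergman_weight bergman_weight_ge0).
congr (_ * _)%E; apply/esym.
exact: (integral_itv_obnd_cbnd (f := bergman_density f) (measurable_bergman_density_oo fa)).
Qed.

Lemma kappa_ge0 : (0 <= kappa R)%E.
Proof. exact: measure_ge0. Qed.

Lemma kappa_fin : kappa R \is a fin_num.
Proof. by rewrite ge0_fin_numE ?kappa_ge0// kappa_lty. Qed.

Lemma bergman_gauge_ge0 f : (0 <= bergman_gauge f)%E.
Proof.
by rewrite mule_ge0 ?kappa_ge0//; apply: integral_ge0 => s _; exact: bergman_density_ge0.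
Qed.

Lemma sqrt_itv (s : R) : 0 < s -> s < 1 -> 0 < Num.sqrt s /\ Num.sqrt s < 1.
Proof. by move=> s0 s1; split; rewrite ?sqrtr_gt0// -[ltRHS]sqrtr1 ltr_sqrt. Qed.

Lemma bergman_gauge_le f g h (a b : R) : analytic_on_disk f ->
  analytic_on_disk g -> analytic_on_disk h -> 0 <= a -> 0 <= b ->
  (forall r, 0 < r -> r < 1 -> M2 f r <= a * M2 g r + b * M2 h r) ->
  (bergman_gauge f <= a%:E * bergman_gauge g + b%:E * bergman_gauge h)%E.
Proof.
move=> fa ga ha a0 b0 H; rewrite /bergman_gauge.
have mf := measurable_bergman_density_oo fa.
have mg := measurable_bergman_density_oo ga.
have mh := measurable_bergman_density_oo ha.
have Ig k : (0 <= \int[mu]_(s in I01) bergman_density k s)%E.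
  by apply: integral_ge0 => s _; exact: bergman_density_ge0.
have ae : (0 <= a%:E :> \bar R)%E by rewrite lee_fin.
have be : (0 <= b%:E :> \bar R)%E by rewrite lee_fin.
rewrite !(muleCA _ (kappa R)) -ge0_muleDr ?mule_ge0//.
apply: lee_wpmul2l; first exact: kappa_ge0.
have mI : measurable I01 by exact: measurable_itv.
rewrite -(ge0_integralZl mu mI mg (fun s _ => bergman_density_ge0 g s) ae).
rewrite -(ge0_integralZl mu mI mh (fun s _ => bergman_density_ge0 h s) be).
have mag := measurable_funeM a%:E mg; have mbh := measurable_funeM b%:E mh.
rewrite -ge0_integralD//; last 2 first.
- by move=> s _; rewrite mule_ge0// bergman_density_ge0.
- by move=> s _; rewrite mule_ge0// bergman_density_ge0.
apply: ge0_le_integral => //.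
- by move=> s _; exact: bergman_density_ge0.
- exact: emeasurable_funD.
move=> s; rewrite /= in_itv /= => /andP[s0 s1].
have [r0 r1] := sqrt_itv s0 s1.
rewrite /bergman_density -!EFinM -EFinD lee_fin.
have := H _ r0 r1; have := bergman_weight_ge0 s.
move: (M2 f _) (M2 g _) (M2 h _) (bergman_weight s) => x y z w w0 Hx.
rewrite [leRHS](_ : _ = (a * y + b * z) * w); last by ring.
by apply: ler_wpM2r.
Qed.

Lemma bergman_gauge_one : (bergman_gauge (fun=> 1%R) < +oo)%E.
Proof.
rewrite /bergman_gauge.
have c0 : 0 <= pi^-1 * (beta + 1) by apply: mulr_ge0; [rewrite invr_ge0 pi_ge0|rewrite -lerBlDr sub0r ltW].
have -> : (\int[mu]_(s in I01) bergman_density (fun=> 1%R) s =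
    (pi^-1 * (beta + 1))%:E * \int[mu]_(s in I01) ((1 - s) `^ beta)%:E)%E.
  rewrite -ge0_integralZl//.
  - by apply: eq_integral => s _; rewrite /bergman_density M2_cst modulus1 expr1n mul1r EFinM.
  - apply/measurable_EFinP; apply: (measurable_funS measurableT) => //.
    exact: measurable_onem_powR.
  - by move=> s _; rewrite lee_fin powR_ge0.
rewrite lte_mul_pinfty ?kappa_ge0 ?kappa_fin//.
by rewrite lte_mul_pinfty ?lee_fin//; exact: integral_onem_powR.
Qed.

(** Littlewood's inequality followed by the substitution s -> 1 - c (1 - s): the weight costs
    c^-beta and the measure c^-1. *)
Lemma bergman_gauge_comp phi : analytic_on_disk phi ->
  (forall z, disk z -> disk (phi z)) -> exists2 K : R, 0 <= K &
  forall f, analytic_on_disk f ->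
    (bergman_gauge (f \o phi) <= K%:E * bergman_gauge f)%E.
Proof.
move=> pa pd; have [c [K [c0 c1 K0 HK]]] := littlewood_disk pa pd.
pose C := K * (c `^ beta)^-1; have C0 : 0 <= C by rewrite mulr_ge0 ?invr_ge0 ?powR_ge0.
exists (C * c^-1); first by rewrite mulr_ge0 ?invr_ge0 ?(ltW c0).
move=> f fa; rewrite /bergman_gauge muleCA; apply: lee_wpmul2l; first exact: kappa_ge0.
have mI : measurable I01 by exact: measurable_itv.
pose h := bergman_density f \_ I01.
have mh : measurable_fun (setT : set R1) h.
  by apply/(measurable_restrictT _ mI); exact: measurable_bergman_density_oo.
have h0 s : (0 <= h s)%E.
  by rewrite /h /patch; case: ifP => // _; exact: bergman_density_ge0.
have mha : measurable_fun (setT : set R1) (fun s => h (c * s + (1 - c))%R).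
  exact: (measurableT_comp mh (measurable_affine c (1 - c))).
have mhaI : measurable_fun I01 (fun s => h (c * s + (1 - c))%R).
  by apply: (measurable_funS measurableT).
have cb0 : 0 < c `^ beta by exact: powR_gt0.
apply: (@le_trans _ _ (\int[mu]_(s in I01) (C%:E * h (c * s + (1 - c))%R))%E).
  apply: ge0_le_integral => //.
  - by move=> s _; exact: bergman_density_ge0.
  - by apply: measurable_bergman_density_oo; exact: analytic_comp.
  - exact: measurable_funeM.
  move=> s; rewrite /= in_itv /= => /andP[s0 s1].
  have sE : c * s + (1 - c) = 1 - c * (1 - s) by ring.
  have s0' : 0 < c * (1 - s) by rewrite mulr_gt0// subr_gt0.
  have s1' : c * (1 - s) < 1 by nra.
  rewrite /h /patch mem_set; last by rewrite /= in_itv /= sE; apply/andP; split; lra.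
  rewrite sE /bergman_density -EFinM lee_fin.
  have -> : bergman_weight (1 - c * (1 - s)) = c `^ beta * bergman_weight s.
    rewrite /bergman_weight opprB addrCA subrr addr0 powRM ?(ltW c0)//; last lra.
    by ring.
  rewrite /C; set w := bergman_weight s; set x := M2 f _.
  rewrite (_ : K * _ * _ = K * x * w); last by field; rewrite gt_eqF.
  by apply: ler_wpM2r; [exact: bergman_weight_ge0|exact: HK].
have Ce : (0 <= C%:E :> \bar R)%E by rewrite lee_fin.
rewrite (ge0_integralZl mu mI mhaI (fun s _ => h0 (c * s + (1 - c))) Ce).
rewrite [(C * c^-1)%:E]EFinM -muleA; apply: lee_wpmul2l; first by rewrite lee_fin.
(* The integral is enlarged to the whole line, where the affine substitution holds; [h] vanishes
   outside ]0, 1[. *)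
apply: (@le_trans _ _ (\int[mu]_s h (c * s + (1 - c))%R)%E).
  by apply: ge0_subset_integral => //.
rewrite (lebesgue_affine (1 - c) c0 mh h0); apply: lee_wpmul2l.
  by rewrite lee_fin invr_ge0 ltW.
by rewrite [leRHS]integral_mkcond.
Qed.

Lemma M2_sub_psum_cvg0 f r : analytic_on_disk f -> 0 < r -> r < 1 ->
  (fun N => M2 (fun z => f z - psum (scoef f) N z) r) @ \oo --> 0.
Proof.
move=> fa r0 r1; rewrite (_ : (fun N => _) =
    (fun N => M2 f r - \sum_(n < N) modulus (scoef f n) ^+ 2 * r ^+ (2 * n))).
  by have := cvgB (cvg_cst (M2 f r)) (parseval fa r0 r1); rewrite subrr; exact.
by apply/funext => N; exact: M2_sub_psum.
Qed.

(** Dominated convergence: on each circle the mean square of the Taylor remainder tends to 0 and is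
    at most that of f. *)
Lemma bergman_gauge_dense f : analytic_on_disk f -> (bergman_gauge f < +oo)%E ->
  forall e : R, 0 < e ->
  exists N, (bergman_gauge (fun z => f z - psum (scoef f) N z)%R < e%:E)%E.
Proof.
(* [kappa] is only known to be nonnegative and finite; if it were 0, the gauge would vanish
   identically. *)
move=> fa fy e e0; have [k0|k0] := eqVneq (kappa R) 0%E.
  by exists 0%N; rewrite /bergman_gauge k0 mul0e lte_fin.
have kp : (0 < kappa R)%E by rewrite lt_def k0 kappa_ge0.
have mI : measurable I01 by exact: measurable_itv.
have Ify : (\int[mu]_(s in I01) bergman_density f s < +oo)%E.
  rewrite ltey; apply: contraTneq fy => E.
  by rewrite /bergman_gauge E gt0_muley// ltxx.
pose F N := bergman_density (fun z => f z - psum (scoef f) N z).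
have Fa N : analytic_on_disk (fun z => f z - psum (scoef f) N z).
  have pa : analytic_on_disk (psum (scoef f) N) by apply: analytic_psum.
  by apply: (@analyticB R f (psum (scoef f) N) fa pa).
have F0 N s : (0 <= F N s)%E.
  exact: (bergman_density_ge0 (fun z => f z - psum (scoef f) N z) s).
have mF N : measurable_fun I01 (F N) by exact: (measurable_bergman_density_oo (Fa N)).
have Fint : mu.-integrable I01 (bergman_density f).
  apply/integrableP; split; first exact: (measurable_bergman_density_oo fa).
  by under eq_integral do rewrite gee0_abs ?bergman_density_ge0//.
have cv0 : \forall s \ae mu, I01 s -> F ^~ s @ \oo --> (0 : \bar R)%E.
  apply: aeW => s; rewrite /= in_itv /= => /andP[s0 s1].
  have [r0 r1] := sqrt_itv s0 s1.
  apply: cvg_EFin; first exact: nearW.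
  have := cvgM (M2_sub_psum_cvg0 fa r0 r1) (cvg_cst (bergman_weight s)).
  by rewrite mul0r; exact.
have dom : \forall s \ae mu, forall N, I01 s -> (`|F N s| <= bergman_density f s)%E.
  apply: aeW => s N sI; have /andP[s0 s1] : (0 < s) && (s < 1) by move: sI; rewrite /= in_itv.
  have [r0 r1] := sqrt_itv s0 s1.
  rewrite (gee0_abs (F0 N s)) lee_fin.
  apply: ler_wpM2r; first exact: bergman_weight_ge0.
  rewrite M2_sub_psum// gerBl; apply: sumr_ge0 => n _.
  by rewrite mulr_ge0 ?sqr_ge0// exprn_ge0// ltW.
have [_ _] := dominated_convergence mI mF (measurable_cst (0%E : \bar R)) cv0 Fint dom.
rewrite integral0 => cv.
have := cvgeZl kappa_fin cv; rewrite mule0 => /fine_cvgP[_ /cvgrPdist_lt/(_ _ e0)[N _ NP]].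
exists N; have := NP N (leqnn _); rewrite sub0r normrN /= => H.
have fN : bergman_gauge (fun z => f z - psum (scoef f) N z) \is a fin_num.
  have G0 := bergman_gauge_ge0 (fun z => f z - psum (scoef f) N z).
  rewrite (ge0_fin_numE G0).
  have L r : 0 < r -> r < 1 ->
      M2 (fun z => f z - psum (scoef f) N z) r <= 1 * M2 f r + 0 * M2 f r.
    move=> r0 r1; rewrite M2_sub_psum// mul1r mul0r addr0 gerBl.
    by apply: sumr_ge0 => n _; rewrite mulr_ge0 ?sqr_ge0// exprn_ge0// ltW.
  apply: le_lt_trans (bergman_gauge_le (Fa N) fa fa ler01 (lexx 0) L) _.
  by rewrite mul1e mul0e adde0.
by rewrite -(fineK fN) lte_fin; apply: le_lt_trans H; exact: ler_norm.
Qed.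

Lemma bergman_gaugeP : gauge bergman_gauge.
Proof.
split.
- exact: bergman_gauge_ge0.
- exact: bergman_gauge_le.
- exact: bergman_gauge_one.
- exact: bergman_gauge_comp.
- exact: bergman_gauge_dense.
Qed.

Lemma bergman_le_hardy_gauge f : analytic_on_disk f ->
  (hardy_gauge f < +oo)%E ->
  (bergman_gauge f <= hardy_gauge f * bergman_gauge (fun=> 1%R))%E.
Proof.
move=> fa hy.
have hf : hardy_gauge f \is a fin_num by rewrite ge0_fin_numE// hardy_gauge_ge0.
have h0 : 0 <= fine (hardy_gauge f) by rewrite fine_ge0// hardy_gauge_ge0.
have a1 := @analytic_cst R 1.
have H : forall r : R, 0 < r -> r < 1 ->
    M2 f r <= fine (hardy_gauge f) * M2 (fun=> 1) r + 0 * M2 (fun=> 1) r.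
  move=> r r0 r1.
  rewrite M2_cst modulus1 expr1n mulr1 mul0r addr0 -lee_fin fineK//.
  exact: le_hardy_gauge.
have := bergman_gauge_le fa a1 a1 h0 (lexx 0) H.
by rewrite mul0e adde0 fineK.
Qed.

End BergmanGauge.

(** * Chaos from a dense family *)

Section Real.
Variable R : realType.

(** A limsup at most 0 would be below 1, and 1 would eventually bound the sequence. *)
Lemma limn_esup_gt0 (u : nat -> R) :
  ~ (exists B : R, \forall n \near \oo, u n <= B) ->
  (0 < limn_esup (EFin \o u))%E.
Proof.
move=> nB; rewrite ltNge; apply/negP => u0; apply: nB; exists 1.
have : (limn_esup (EFin \o u) < 1%:E)%E by rewrite (le_lt_trans u0)// lte_fin.
rewrite /limn_esup limf_esupE => /ereal_inf_lt[_ [V nV <-]] sup1.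
apply: filterS nV => n Vn; rewrite -lee_fin; apply: le_trans (ltW sup1).
by apply: ereal_sup_ubound; exists n.
Qed.

(** Nonnegativity gives one inequality; for the other, k <= N_k puts terms of the subsequence in
    every tail. *)
Lemma limn_einf_eq0 (u : nat -> R) (N_ : nat -> nat) : (forall n, 0 <= u n) ->
  (forall k, (k <= N_ k)%N) -> u \o N_ @ \oo --> 0 ->
  limn_einf (EFin \o u) = 0%E.
Proof.
move=> u0 kN cu; rewrite /limn_einf /limn_esup limf_esupE.
set s := ereal_inf _; suff -> : s = 0%E by rewrite oppe0.
apply/eqP; rewrite eq_le; apply/andP; split.
  apply: (@le_trans _ _ (ereal_sup [set (- (EFin \o u) n)%E | n in [set: nat]])).
    by apply: ereal_inf_lbound; exists setT => //; exact: filterT.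
  by apply: ge_ereal_sup => _ [n _ <-]; rewrite lee_fin oppr_le0.
apply: le_ereal_inf_tmp => _ [V [M _ MV] <-]; apply/lee_addgt0Pr => e e0.
have /cvgrPdist_lt/(_ _ e0)[K _ KP] := cu.
pose k := maxn M K.
have := KP k (leq_maxr _ _); rewrite /= sub0r normrN ger0_norm// => uk.
apply: (@le_trans _ _ ((- u (N_ k))%:E + e%:E)%E).
  by rewrite -EFinD lee_fin addrC subr_ge0 ltW.
rewrite leeD2r//; apply: ereal_sup_ubound; exists (N_ k) => //; apply: MV.
by rewrite /= (leq_trans (leq_maxl M K)).
Qed.

Lemma uncountable_real : ~ countable [set: R].
Proof.
move=> /countable_lebesgue_measure0 E0.
have : (lebesgue_measure (`[0%R, 1%R]%classic : set R) <= lebesgue_measure [set: R])%E.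
  by apply: le_measure => //; rewrite inE.
by rewrite E0 lebesgue_measure_itv /= lte_fin ltr01 oppr0 adde0 lee_fin ler10.
Qed.

Lemma countable_subsingleton (T : Type) (A : set T) :
  (forall x y, A x -> A y -> x = y) -> countable A.
Proof.
move=> A1; have [->|/set0P[x Ax]] := eqVneq A set0; first exact: countable0.
apply: (sub_countable _ (countable1 x)); apply: subset_card_le => y Ay.
exact: A1.
Qed.

Lemma countable_setU (T : Type) (A B : set T) :
  countable A -> countable B -> countable (A `|` B).
Proof.
by move=> cA cB; rewrite -bigcup2E; apply: bigcup_countable => // -[|[|i]] _.
Qed.

Lemma exists_notin_bigcup (J : countType) (A : J -> set R) :
  (forall j x y, A j x -> A j y -> x = y) -> exists t, forall j, ~ A j t.
Proof.
move=> A1; apply: contrapT => nt; apply: uncountable_real.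
rewrite (_ : setT = \bigcup_j A j); last first.
  apply/seteqP; split=> // t _; apply: contrapT => H; apply: nt; exists t => j Aj.
  by apply: H; exists j.
by apply: bigcup_countable => // j _; exact: countable_subsingleton (A1 j).
Qed.

End Real.

(** By pigeonhole, the infinitely many copies (i, n) of one index cannot all have small codes; hence
    each vector of the family is perturbed by arbitrarily small amounts. *)
Lemma pickle_pair_unbounded (I : countType) (i : I) (M : nat) :
  exists n : nat, (M <= pickle ((i, n) : I * nat))%N.
Proof.
apply: contrapT => H.
have lt n : (pickle ((i, n) : I * nat) < M)%N by rewrite ltnNge; apply/negP => ?; apply: H; exists n.
pose f (n : 'I_M.+1) : 'I_M := Ordinal (lt n).
have : (#|'I_M.+1| <= #|'I_M|)%N.
  apply: (leq_card f) => m n /(congr1 val)/= /(pcan_inj pickleK)[].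
  exact: val_inj.
by rewrite !card_ord ltnn.
Qed.

(** * An abstract criterion for dense mean Li-Yorke chaos *)

Section Chaos.
Variables (R : realType) (V : lmodType R[i]) (X : set V) (nrm : V -> \bar R).
Variables (T : V -> V) (p : V -> R) (N_ : nat -> nat).
Variables (I : countType) (d : I -> V) (e0 : V).
Hypothesis X_lin : forall (a : R[i]) x y, X x -> X y -> X (a *: x + y).
Hypothesis T_bounded : bounded_operator X nrm T.
Hypothesis nrmE : forall x, X x -> nrm x = (p x)%:E.
Hypothesis p_ge0 : forall x, 0 <= p x.
(** The factor 2 is compatible with [null] and [tame] being stable under linear combinations. *)
Hypothesis p_add : forall x y, X x -> X y -> p (x + y) <= 2 * (p x + p y).
Hypothesis p_scale : forall a x, X x -> p (a *: x) <= modulus a * p x.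
Hypothesis X_d : forall i, X (d i).
Hypothesis X_e0 : X e0.
Hypothesis le_N_ : forall k, (k <= N_ k)%N.

Definition orbit_mean x N := N%:R^-1 * \sum_(1 <= j < N.+1) p (iter j T x).

Let null x := orbit_mean x \o N_ @ \oo --> 0.
Let tame := [set x | X x /\ exists B : R, \forall N \near \oo, orbit_mean x N <= B].

Hypothesis null_d : forall i, null (d i).
Hypothesis null_e0 : null e0.
Hypothesis ntame_e0 : ~ tame e0.
Hypothesis d_dense : forall x, X x -> forall e, 0 < e -> exists i, p (x - d i) < e.

Lemma X_zero : X 0.
Proof. by have := X_lin (-1) X_e0 X_e0; rewrite scaleN1r addNr. Qed.

Lemma X_scale a x : X x -> X (a *: x).
Proof. by move=> Xx; have := X_lin a Xx X_zero; rewrite addr0. Qed.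

Lemma X_sub x y : X x -> X y -> X (x - y).
Proof. by move=> Xx Xy; have := X_lin (-1) Xy Xx; rewrite scaleN1r addrC. Qed.

Lemma iter_lin j (a : R[i]) x y : X x -> X y ->
  iter j T (a *: x + y) = a *: iter j T x + iter j T y.
Proof.
have [XT TL _] := T_bounded => Xx Xy.
have Xi k z : X z -> X (iter k T z) by move=> Xz; elim: k => //= k; exact: XT.
by elim: j => //= j ->; rewrite TL//; exact: Xi.
Qed.

Lemma iter_sub j x y : X x -> X y -> iter j T (x - y) = iter j T x - iter j T y.
Proof. by move=> Xx Xy; rewrite addrC -scaleN1r iter_lin// scaleN1r addrC. Qed.

Lemma X_iter j x : X x -> X (iter j T x).
Proof. by have [XT _ _] := T_bounded => Xx; elim: j => //= j; exact: XT. Qed.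

Lemma orbit_mean_ge0 x N : 0 <= orbit_mean x N.
Proof. by rewrite mulr_ge0 ?invr_ge0//; apply: sumr_ge0. Qed.

Lemma orbit_mean_lin (a : R[i]) x y N : X x -> X y ->
  orbit_mean (a *: x + y) N <= 2 * (modulus a * orbit_mean x N + orbit_mean y N).
Proof.
move=> Xx Xy; rewrite /orbit_mean (mulrCA (modulus a)) -mulrDr mulrCA.
apply: ler_wpM2l; first by rewrite invr_ge0.
rewrite mulr_sumr -big_split /= mulr_sumr; apply: ler_sum => j _.
rewrite iter_lin//; have Xj := X_iter j Xx.
apply: le_trans (p_add (X_scale a Xj) (X_iter j Xy)) _.
by rewrite ler_wpM2l// lerD2r; exact: p_scale.
Qed.

Lemma null_lin a x y : X x -> X y -> null x -> null y -> null (a *: x + y).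
Proof.
move=> Xx Xy nx ny.
have H : (fun k => 2 * (modulus a * orbit_mean x (N_ k) + orbit_mean y (N_ k))) @ \oo --> 0.
  have := cvgM (cvg_cst (2 : R)) (cvgD (cvgM (cvg_cst (modulus a)) nx) ny).
  by rewrite mulr0 addr0 mulr0; exact.
apply: (squeeze_cvgr _ (cvg_cst 0) H); apply: nearW => k.
by rewrite orbit_mean_ge0/=; exact: orbit_mean_lin.
Qed.

Lemma tame_lin a x y : tame x -> tame y -> tame (a *: x + y).
Proof.
move=> [Xx [B HB]] [Xy [C HC]]; split; first exact: X_lin.
exists (2 * (modulus a * B + C)); apply: filterS2 HB HC => N xB yC.
apply: le_trans (orbit_mean_lin a N Xx Xy) _.
by rewrite ler_wpM2l// lerD// ler_wpM2l ?modulus_ge0.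
Qed.

Lemma p_zero : p 0 = 0.
Proof.
apply/eqP; rewrite eq_le p_ge0 andbT.
by have := p_scale 0 X_e0; rewrite scale0r modulus0 mul0r.
Qed.

Lemma tame_zero : tame 0.
Proof.
split; first exact: X_zero.
exists 0; apply: nearW => N; rewrite /orbit_mean big1 ?mulr0// => j _.
have := iter_sub j X_e0 X_e0; rewrite !subrr => ->; exact: p_zero.
Qed.

Lemma tame_sub x y : tame x -> tame y -> tame (x - y).
Proof. by move=> tx ty; rewrite addrC -scaleN1r; exact: tame_lin. Qed.

Lemma tame_line x (s t : R) : tame (x + s%:C *: e0) -> tame (x + t%:C *: e0) -> s = t.
Proof.
move=> ts tt; apply/eqP; rewrite -subr_eq0; apply/eqP; apply: contrapT => /eqP st.
apply: ntame_e0.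
have := tame_lin ((s - t)%:C^-1) (tame_sub ts tt) tame_zero.
rewrite addr0 opprD addrACA subrr add0r -scalerBl -realcB scalerA mulVf ?scale1r//.
by rewrite (fmorph_eq0 (real_complex R)).
Qed.

(** Distinct for distinct indices and small for large codes; the successor avoids the inverse of
    0. *)
Let c (q : I * nat) : R := (pickle q).+1%:R^-1.

Lemma c_inj q q' : c q = c q' -> q = q'.
Proof.
move=> /invr_inj/eqP; rewrite eqr_nat eqSS => /eqP; exact: (pcan_inj pickleK).
Qed.

Lemma c_small i (e : R) : 0 < e -> exists n, c (i, n) < e.
Proof.
move=> e0'; have [n nM] := pickle_pair_unbounded i (Num.bound e^-1).
exists n; rewrite /c invf_plt ?posrE//.
apply: lt_le_trans (_ : (Num.bound e^-1)%:R <= _).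
  by apply: archi_boundP; rewrite invr_ge0 ltW.
by rewrite ler_nat ltnW// ltnS.
Qed.

Let base (t : R) (q : I * nat) : V := d q.1 + (t * c q)%:C *: e0.

Lemma X_base t q : X (base t q).
Proof. by rewrite /base addrC; exact: X_lin. Qed.

Lemma null_base t q : null (base t q).
Proof. by rewrite /base addrC; exact: null_lin. Qed.

Lemma base_dense t x (e : R) : X x -> 0 < e -> exists q, p (x - base t q) < e.
Proof.
(* The approximation and the perturbation each get e / 4, doubled by [p_add]. *)
move=> Xx e_gt0; have e4 : 0 < e / 4 by rewrite divr_gt0.
have [i Hi] := d_dense Xx e4.
have a0 : 0 < `|t| * p e0 + 1 by rewrite ltr_wpDl// mulr_ge0.
have [n Hn] := c_small i (divr_gt0 e4 a0); exists (i, n).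
have -> : x - base t (i, n) = (x - d i) + (- (t * c (i, n)))%:C *: e0.
  by rewrite /base /= opprD addrA (rmorphN (real_complex R)) scaleNr.
apply: le_lt_trans (p_add (X_sub Xx (X_d i)) (X_scale _ X_e0)) _.
have := p_scale (- (t * c (i, n)))%:C X_e0; rewrite modulus_real normrN normrM.
have c0 : 0 <= c (i, n) by rewrite invr_ge0.
rewrite (ger0_norm c0) => H.
move: Hn; rewrite ltr_pdivlMr// => Hn.
have t0 := normr_ge0 t; have pe := p_ge0 e0.
suff : `|t| * c (i, n) * p e0 <= e / 4 by lra.
apply: le_trans (ltW Hn); rewrite mulrDr mulr1 -mulrA mulrCA lerDl//.
Qed.

(** As t varies, the difference for a pair moves along a line in direction [e0] with nonzero speed c
    q - c q', so each of the countably many pairs excludes at most one t. *)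
Lemma exists_generic_base : exists t, forall q q', q <> q' -> ~ tame (base t q - base t q').
Proof.
pose A (j : (I * nat) * (I * nat)) := [set t | j.1 <> j.2 /\ tame (base t j.1 - base t j.2)].
have bE t q q' : base t q - base t q' = (d q.1 - d q'.1) + (t * (c q - c q'))%:C *: e0.
  by rewrite /base mulrBr realcB scalerBl opprD addrACA.
have [j s t|t tP] := @exists_notin_bigcup R _ A.
  move=> [jd]; rewrite bE => ts [_]; rewrite bE => tt.
  have := tame_line ts tt; apply: mulIf; rewrite subr_eq0.
  by apply/eqP => /c_inj.
by exists t => q q' qq' tq; apply: (tP (q, q')).
Qed.

Lemma chaos_of_dense_family : densely_mean_Li_Yorke_chaotic X nrm T.
Proof.
split=> //; have [t tP] := exists_generic_base.
pose C := \bigcup_(q : I * nat) [set m : R | tame (base t q - m%:C *: e0)].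
have cC : countable C.
  apply: bigcup_countable => // q _; apply: countable_subsingleton => m m' /= tm tm'.
  apply: oppr_inj; apply: (@tame_line (base t q)); rewrite (rmorphN (real_complex R)) scaleNr; [exact: tm|exact: tm'].
(* The first part is countable and provides density; the second provides uncountability, with [C]
   collecting the multiples that conflict with the first. *)
pose S := range (base t) `|` [set m%:C *: e0 | m in ~` C].
have SX x : S x -> X x by move=> [[q _ <-]|[m _ <-]]; [exact: X_base|exact: X_scale].
have null_scale a : null (a *: e0).
  by have := null_lin (a - 1) X_e0 X_e0 null_e0 null_e0; rewrite scalerBl scale1r subrK.
have Snull x : S x -> null x.
  by move=> [[q _ <-]|[m _ <-]]; [exact: null_base|exact: null_scale].
have tame_opp x y : tame (x - y) -> tame (y - x).
  by move=> txy; have := tame_lin (-1) txy tame_zero; rewrite addr0 scaleN1r opprB.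
have Stame x y : S x -> S y -> x <> y -> ~ tame (x - y).
  move=> [[q _ <-]|[m Cm <-]] [[q' _ <-]|[m' Cm' <-]] xy.
  - by apply: tP => qq'; apply: xy; rewrite qq'.
  - by move=> tq; apply: Cm'; exists q.
  - by move=> /tame_opp tq; apply: Cm; exists q'.
  - move=> tm; apply: xy; congr (_%:C *: _).
    apply: (@tame_line (- (m'%:C *: e0))); rewrite addrC ?subrr//; exact: tame_zero.
exists S; split=> //.
(* m -> m e0 is injective by [tame_line], so if S were countable then the complement of [C], and
   with it R, would be countable. *)
- move=> cS; apply: (@uncountable_real R).
  rewrite -(setvU C) setUC; apply: countable_setU => //.
  have [f fI] := countable_injP _ cS; apply/countable_injP.
  exists (fun m => f (m%:C *: e0)) => m m'; rewrite !inE => Cm Cm' fE.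
  have SC k : (~` C) k -> k%:C *: e0 \in S by move=> Ck; rewrite inE; right; exists k.
  have {fE} mE := fI _ _ (SC _ Cm) (SC _ Cm') fE.
  apply: (@tame_line (- (m'%:C *: e0))); rewrite addrC ?mE subrr; exact: tame_zero.
- move=> x Xx e e_gt0; have [q Hq] := base_dense t Xx e_gt0.
  exists (base t q); first by left; exists q.
  by rewrite nrmE ?lte_fin//; apply: X_sub => //; exact: X_base.
move=> x y Sx Sy xy mean.
have Xx := SX _ Sx; have Xy := SX _ Sy; have Xxy := X_sub Xx Xy.
have -> : mean = EFin \o orbit_mean (x - y).
  apply/funext => N; rewrite /mean /cesaro_mean /orbit_mean /= EFinM -sumEFin.
  congr (_ * _)%E; apply: eq_bigr => j _.
  by rewrite -iter_sub// nrmE//; exact: X_iter.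
split.
  apply: (limn_einf_eq0 (N_ := N_)) => //; first exact: orbit_mean_ge0.
  by rewrite addrC -scaleN1r; apply: null_lin => //; exact: Snull.
by apply: limn_esup_gt0 => HB; apply: (Stame x y).
Qed.

End Chaos.

(** * Weighted composition operators *)

Section GaugeNorm.
Variables (R : realType) (Phi : (R[i] -> R[i]) -> \bar R).
Hypothesis Phi_gauge : gauge Phi.
Implicit Types (f g phi w : R[i] -> R[i]).

Lemma M2_scale_le f g (C r : R) : circ f r -> circ g r -> 0 <= r ->
  (forall z, modulus z = r -> modulus (f z) <= C * modulus (g z)) -> 0 <= C ->
  M2 f r <= C ^+ 2 * M2 g r.
Proof.
move=> fc gc r0 fg C0.
have -> : C ^+ 2 * M2 g r = M2 (fun z => C%:C * g z) r.
  by rewrite (M2Z _ gc) modulus_real ger0_norm.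
apply: (le_M2 fc _ r0); first exact: (circM (circ_cst _ r) gc).
by move=> z zr; rewrite modulusM modulus_real ger0_norm//; exact: fg.
Qed.

Lemma M2D_le f g (r : R) : circ f r -> circ g r ->
  M2 (fun z => f z + g z) r <= 2 * M2 f r + 2 * M2 g r.
Proof.
move=> fc gc; rewrite /M2 !(mulrCA 2) -mulrDr; apply: ler_wpM2l.
  by rewrite invr_ge0 mulr_ge0// pi_ge0.
have sf := conts_sqr_modulus fc; have sg := conts_sqr_modulus gc.
have c2 h : conts 0 (2 * pi) h -> conts 0 (2 * pi) (fun t => 2 * h t : R).
  by move=> hc t tP; apply: cvgM; [exact: cvg_cst|exact: hc].
rewrite -!rintZ// -rintD; [|exact: c2|exact: c2].
apply: le_rint.
- exact: conts_sqr_modulus (circD fc gc).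
- by move=> t tP; apply: cvgD; [exact: (c2 _ sf)|exact: (c2 _ sg)].
move=> t _; have := le_modulusD (f (pt r t)) (g (pt r t)).
have := modulus_ge0 (f (pt r t) + g (pt r t)).
have := sqr_ge0 (modulus (f (pt r t)) - modulus (g (pt r t))).
move: (modulus _) (modulus (f _)) (modulus (g _)) => s a b H s0 sab.
nra.
Qed.

Lemma gauge_scale f g (C : R) : analytic_on_disk f -> analytic_on_disk g ->
  0 <= C -> (forall z, disk z -> modulus (f z) <= C * modulus (g z)) ->
  (Phi f <= (C ^+ 2)%:E * Phi g)%E.
Proof.
move=> fa ga C0 fg.
have H r : 0 < r -> r < 1 -> M2 f r <= C ^+ 2 * M2 g r + 0 * M2 g r.
  move=> r0 r1; rewrite mul0r addr0; apply: M2_scale_le => //.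
  - by apply: (circ_analytic fa) => //; exact: ltW.
  - by apply: (circ_analytic ga) => //; exact: ltW.
  - exact: ltW.
  - by move=> z zr; apply: fg; rewrite /disk /= zr.
have := gauge_le Phi_gauge fa ga ga (sqr_ge0 C) (lexx 0) H.
by rewrite mul0e adde0.
Qed.

Lemma gauge_add f g : analytic_on_disk f -> analytic_on_disk g ->
  (Phi (fun z => f z + g z)%R <= 2%:E * Phi f + 2%:E * Phi g)%E.
Proof.
move=> fa ga; have fga := analyticD fa ga.
apply: (gauge_le Phi_gauge fga fa ga) => // r r0 r1.
apply: M2D_le; first exact: (circ_analytic fa (ltW r0) r1).
exact: (circ_analytic ga (ltW r0) r1).
Qed.

Definition gauge_dom f := analytic_on_disk f /\ (Phi f < +oo)%E.

(** Real-valued for the chaos criterion; where the gauge is infinite the value is 0, so it is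
    meaningful on [gauge_dom] only. *)
Definition gauge_norm f : R := Num.sqrt (fine (Phi f)).

Lemma gauge_norm_ge0 f : 0 <= gauge_norm f.
Proof. exact: sqrtr_ge0. Qed.

Lemma gauge_fin f : gauge_dom f -> Phi f = (fine (Phi f))%:E.
Proof. by move=> [_ fy]; rewrite fineK// ge0_fin_numE// (gauge_ge0 Phi_gauge). Qed.

Lemma fine_gauge_ge0 f : 0 <= fine (Phi f).
Proof. by rewrite fine_ge0// (gauge_ge0 Phi_gauge). Qed.

Lemma gauge_dom_le f g (a : R) : analytic_on_disk f -> gauge_dom g ->
  (Phi f <= a%:E * Phi g)%E -> gauge_dom f.
Proof.
move=> fa gd fg; split=> //; apply: (le_lt_trans fg).
by rewrite (gauge_fin gd) -EFinM ltry.
Qed.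

Lemma gauge_norm_le f g (C : R) : gauge_dom f -> gauge_dom g -> 0 <= C ->
  (Phi f <= (C ^+ 2)%:E * Phi g)%E -> gauge_norm f <= C * gauge_norm g.
Proof.
move=> fd gd C0; rewrite (gauge_fin fd) (gauge_fin gd) -EFinM lee_fin => fg.
rewrite /gauge_norm -[X in X * _](ger0_norm C0) -sqrtr_sqr -sqrtrM ?sqr_ge0//.
exact: ler_wsqrtr.
Qed.

Lemma gauge_dom_add f g : gauge_dom f -> gauge_dom g ->
  gauge_dom (fun z => f z + g z).
Proof.
move=> fd gd; have [fa _] := fd; have [ga _] := gd.
split; first exact: analyticD.
apply: (le_lt_trans (gauge_add fa ga)).
by rewrite (gauge_fin fd) (gauge_fin gd) -!EFinM -EFinD ltry.
Qed.

(** The squared norms satisfy 2 x^2 + 2 y^2 <= (2 (x + y))^2 for x, y >= 0. *)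
Lemma gauge_norm_add f g : gauge_dom f -> gauge_dom g ->
  gauge_norm (fun z => f z + g z) <= 2 * (gauge_norm f + gauge_norm g).
Proof.
move=> fd gd; have [fa _] := fd; have [ga _] := gd.
have := gauge_add fa ga.
rewrite (gauge_fin fd) (gauge_fin gd) (gauge_fin (gauge_dom_add fd gd)).
rewrite -!EFinM -EFinD lee_fin => H.
have n0 : 0 <= 2 * (gauge_norm f + gauge_norm g).
  by rewrite mulr_ge0// addr_ge0// gauge_norm_ge0.
rewrite -(ger0_norm n0) -sqrtr_sqr; apply: ler_wsqrtr; apply: (le_trans H).
rewrite -(sqr_sqrtr (fine_gauge_ge0 f)) -(sqr_sqrtr (fine_gauge_ge0 g)).
rewrite -/(gauge_norm f) -/(gauge_norm g).
have := gauge_norm_ge0 f; have := gauge_norm_ge0 g.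
move: (gauge_norm f) (gauge_norm g) => x y; nra.
Qed.

Lemma gauge_dom_one : gauge_dom (fun=> 1).
Proof. by split; [exact: analytic_cst|exact: (gauge_one Phi_gauge)]. Qed.

Lemma gauge_bounded f (C : R) : analytic_on_disk f -> 0 <= C ->
  (forall z, disk z -> modulus (f z) <= C) ->
  gauge_dom f /\ gauge_norm f <= C * gauge_norm (fun=> 1).
Proof.
move=> fa C0 fC; have [a1 _] := gauge_dom_one.
have H : (Phi f <= (C ^+ 2)%:E * Phi (fun=> 1%R))%E.
  by apply: (gauge_scale fa a1 C0) => z zd; rewrite modulus1 mulr1; exact: fC.
have fd := gauge_dom_le fa gauge_dom_one H.
by split=> //; apply: gauge_norm_le => //; exact: gauge_dom_one.
Qed.

Lemma rat_approx (x e : R) : 0 < e -> exists q : rat, `|x - ratr q| < e.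
Proof.
move=> e0; have [q] := @rat_in_itvoo R (x - e) (x + e) ltac:(lra).
by rewrite in_itv /= => /andP[? ?]; exists q; rewrite ltr_norml; lra.
Qed.

(** Lists of pairs of rationals form the countable index type demanded by the chaos criterion. *)
Definition rat_coef (s : seq (rat * rat)) n : R[i] :=
  ratr (nth (0, 0) s n).1 +i* ratr (nth (0, 0) s n).2.

Definition rat_poly s : R[i] -> R[i] := psum (rat_coef s) (size s).

Lemma rat_coef_approx (a : nat -> R[i]) N (e : R) : 0 < e ->
  exists2 s, size s = N & forall n, (n < N)%N -> modulus (a n - rat_coef s n) <= e.
Proof.
move=> e0; have e2 : 0 < e / 2 by rewrite divr_gt0.
have /choice[b bP] : forall n, exists q : rat * rat,
    modulus (a n - (ratr q.1 +i* ratr q.2)) <= e.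
  move=> n; have [q Hq] := rat_approx (Re (a n)) e2.
  have [q' Hq'] := rat_approx (Im (a n)) e2; exists (q, q').
  apply: le_trans (modulus_le _) _; rewrite cReD cImD cReN cImN /=; lra.
exists (mkseq b N) => [|n nN]; first by rewrite size_mkseq.
by rewrite /rat_coef nth_mkseq.
Qed.

Lemma psum_bounded (b : nat -> R[i]) N (C : R) : (forall n, (n < N)%N -> modulus (b n) <= C) ->
  forall z, disk z -> modulus (psum b N z) <= N%:R * C.
Proof.
move=> bC z zd; elim: N bC => [|N IH] bC.
  by rewrite /psum big_ord0 mul0r modulus0.
rewrite psumS -natr1 mulrDl mul1r; apply: le_trans (le_modulusD _ _) _.
apply: lerD; first by apply: IH => n nN; apply: bC; exact: ltnW.
rewrite modulusM modulusX -[leRHS]mulr1; apply: ler_pM => //; rewrite ?modulus_ge0//.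
- by rewrite exprn_ge0// modulus_ge0.
- exact: bC.
- by rewrite exprn_ile1 ?modulus_ge0// ltW.
Qed.

Lemma rat_poly_dense f (e : R) : gauge_dom f -> 0 < e ->
  exists s, gauge_norm (fun z => f z - rat_poly s z) < e.
Proof.
move=> fd e0; have [fa fy] := fd; have e4 : 0 < e / 4 by rewrite divr_gt0.
have [N HN] := gauge_dense Phi_gauge fa fy (exprn_gt0 2 e4).
have [a aE] : exists a, a = scoef f by exists (scoef f).
rewrite -aE in HN; have pa : analytic_on_disk (psum a N) by exact: analytic_psum.
have d1 : gauge_dom (fun z => f z - psum a N z).
  by split; [exact: (analyticB fa pa)|exact: lt_trans HN (ltry _)].
have n1 : gauge_norm (fun z => f z - psum a N z) < e / 4.
  rewrite -(ger0_norm (ltW e4)) -sqrtr_sqr ltr_sqrt ?exprn_gt0//.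
  by rewrite -lte_fin -gauge_fin.
(* Rounding each coefficient by e / (4 k) moves the polynomial by at most N e / (4 k) on the disk,
   hence by at most e / 4 in norm. The added 1 keeps [k] positive. *)
pose k : R := N%:R * gauge_norm (fun=> 1) + 1.
have k0 : 0 < k by rewrite ltr_wpDl// mulr_ge0// gauge_norm_ge0.
have dl : 0 < e / 4 / k by rewrite divr_gt0.
have [s sN Hs] := rat_coef_approx a N dl; exists s.
have ra : analytic_on_disk (rat_poly s) by exact: analytic_psum.
have Hb z : disk z -> modulus (psum a N z - rat_poly s z) <= N%:R * (e / 4 / k).
  move=> zd; rewrite /rat_poly sN /psum -sumrB.
  have -> : \sum_(i < N) (a i * z ^+ i - rat_coef s i * z ^+ i) =
      psum (fun i => a i - rat_coef s i) N z.
    by apply: eq_bigr => i _; rewrite mulrBl.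
  exact: psum_bounded.
have C0 : 0 <= N%:R * (e / 4 / k) by rewrite mulr_ge0// ltW.
have [d2 n2] := gauge_bounded (analyticB pa ra) C0 Hb.
have -> : (fun z => f z - rat_poly s z) =
    (fun z => (f z - psum a N z) + (psum a N z - rat_poly s z)).
  by apply/funext => z; rewrite addrA subrK.
apply: (le_lt_trans (gauge_norm_add d1 d2)).
suff : N%:R * (e / 4 / k) * gauge_norm (fun=> 1) <= e / 4 by lra.
rewrite (_ : _ * _ * _ = e / 4 * (N%:R * gauge_norm (fun=> 1) / k)); last by ring.
rewrite -[leRHS]mulr1 ler_wpM2l ?(ltW e4)// ler_pdivrMr// mul1r /k.
by rewrite lerDl.
Qed.

End GaugeNorm.

Section WeightedComposition.
Variable R : realType.
Implicit Types (f g phi w : R[i] -> R[i]).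

Lemma iter_wcomp w phi j f z :
  iter j (wcomp w phi) f z = wprod w phi j z * f (iter j phi z).
Proof.
elim: j z => [|j IH] z; first by rewrite /wprod big_ord0 mul1r.
rewrite iterS {1}/wcomp IH mulrA -iterSr; congr (_ * _).
rewrite /wprod big_ord_recl; congr (_ * _).
by apply: eq_bigr => i _; rewrite -iterSr.
Qed.

Lemma iter_self_map phi : (forall z, disk z -> disk (phi z)) ->
  forall j z, disk z -> disk (iter j phi z).
Proof. by move=> pd; elim=> [//|j IH] z zd; apply: pd; exact: IH. Qed.

Lemma iter_analytic phi : analytic_on_disk phi ->
  (forall z, disk z -> disk (phi z)) -> forall j, analytic_on_disk (iter j phi).
Proof.
move=> pa pd; elim=> [|j IH]; first by apply/analytic_cdiff => z _; exact: cdiff_id.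
exact: (analytic_comp pa IH (@iter_self_map _ pd j)).
Qed.

Lemma wprod_Hinfty w phi : Hinfty w -> analytic_on_disk phi ->
  (forall z, disk z -> disk (phi z)) -> forall j, Hinfty (wprod w phi j).
Proof.
move=> [wa [M wM]] pa pd; elim=> [|j [IHa [B IHB]]].
  have -> : wprod w phi 0 = fun=> 1 by apply/funext => z; rewrite /wprod big_ord0.
  by split; [exact: analytic_cst|exists 1 => z _; rewrite modulus1].
have -> : wprod w phi j.+1 = fun z => wprod w phi j z * w (iter j phi z).
  by apply/funext => z; rewrite /wprod big_ord_recr.
have da := iter_self_map pd j.
have ca : analytic_on_disk (w \o iter j phi).
  exact: (@analytic_comp R w (iter j phi) wa (@iter_analytic phi pa pd j) da).
split; first exact: (@analyticM R (wprod w phi j) (w \o iter j phi) IHa ca).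
exists (B * M) => z zd; rewrite modulusM; apply: ler_pM; rewrite ?modulus_ge0//.
  exact: IHB.
by apply: wM; exact: da.
Qed.

Lemma Hinfty_bound f : Hinfty f ->
  exists2 M : R, 0 <= M & forall z, disk z -> modulus (f z) <= M.
Proof.
move=> [_ [M fM]]; exists `|M|; first exact: normr_ge0.
by move=> z /fM H; apply: le_trans H (ler_norm _).
Qed.

Lemma wcomp_gauge_bounded Phi w phi : gauge Phi -> Hinfty w ->
  analytic_on_disk phi -> (forall z, disk z -> disk (phi z)) ->
  exists M : R, forall f, gauge_dom Phi f -> gauge_dom Phi (wcomp w phi f) /\
    gauge_norm Phi (wcomp w phi f) <= M * gauge_norm Phi f.
Proof.
move=> G wH pa pd; have [wa _] := wH; have [M M0 wM] := Hinfty_bound wH.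
have [K K0 HK] := gauge_comp G pa pd.
have C0 : 0 <= M * Num.sqrt K by rewrite mulr_ge0// sqrtr_ge0.
exists (M * Num.sqrt K) => f fd; have [fa _] := fd.
have fpa := analytic_comp fa pa pd.
have wfa : analytic_on_disk (wcomp w phi f) := @analyticM R w (f \o phi) wa fpa.
have H : (Phi (wcomp w phi f) <= ((M * Num.sqrt K) ^+ 2)%:E * Phi f)%E.
  rewrite exprMn sqr_sqrtr// EFinM -muleA.
  apply: le_trans (lee_wpmul2l _ (HK f fa)); last by rewrite lee_fin sqr_ge0.
  apply: (gauge_scale G wfa fpa M0) => z zd; rewrite modulusM.
  by rewrite ler_wpM2r ?modulus_ge0//; exact: wM.
have wfd := gauge_dom_le G wfa fd H.
by split=> //; exact: (gauge_norm_le G wfd fd C0 H).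
Qed.

Definition weight_mean (Phi : (R[i] -> R[i]) -> \bar R) w phi N : R :=
  N%:R^-1 * \sum_(1 <= j < N.+1) gauge_norm Phi (wprod w phi j).

(** The criterion is applied to the rational polynomials and to the constant 1, whose orbit consists
    of the products w^(j) themselves. *)
Lemma wcomp_chaotic Phi (nrm : (R[i] -> R[i]) -> \bar R) w phi (N_ : nat -> nat) :
  gauge Phi -> (forall f, analytic_on_disk f -> nrm f = poweR (Phi f) 2^-1) ->
  Hinfty w -> analytic_on_disk phi -> (forall z, disk z -> disk (phi z)) ->
  (forall k, (k <= N_ k)%N) -> weight_mean Phi w phi \o N_ @ \oo --> 0 ->
  ~ (exists B : R, \forall N \near \oo, weight_mean Phi w phi N <= B) ->
  densely_mean_Li_Yorke_chaotic
    [set f | analytic_on_disk f /\ (nrm f < +oo)%E] nrm (wcomp w phi).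
Proof.
move=> G nrmE wH pa pd kN wm0 wmoo.
have [M HM] := wcomp_gauge_bounded G wH pa pd.
have XE f : analytic_on_disk f /\ (nrm f < +oo)%E <-> gauge_dom Phi f.
  split=> -[fa fy]; split=> //; first by move: fy; rewrite nrmE// => /lty_poweRy; apply.
  by rewrite nrmE//; exact: poweR_lty.
have nE f : gauge_dom Phi f -> nrm f = (gauge_norm Phi f)%:E.
  move=> fd; have [fa _] := fd.
  by rewrite nrmE// (gauge_fin G fd) poweR_EFin powR12_sqrt// fine_gauge_ge0.
have -> : [set f | analytic_on_disk f /\ (nrm f < +oo)%E] = gauge_dom Phi.
  by apply/seteqP; split=> f /= /XE.
have dom_iter j f : gauge_dom Phi f -> gauge_dom Phi (iter j (wcomp w phi) f).
  move=> fd; elim: j => [|j IH]; first exact: fd.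
  exact: (proj1 (HM _ IH)).
have meanE f (C : R) N : analytic_on_disk f -> 0 <= C ->
    (forall z, disk z -> modulus (f z) <= C) ->
    orbit_mean (wcomp w phi) (gauge_norm Phi) f N <= C * weight_mean Phi w phi N.
  move=> fa C0 fC; have [fd _] := gauge_bounded G fa C0 fC.
  rewrite /orbit_mean /weight_mean mulrCA; apply: ler_wpM2l; first by rewrite invr_ge0.
  rewrite mulr_sumr; apply: ler_sum => j _.
  have jd := dom_iter j f fd; have [ja _] := jd.
  have vH := wprod_Hinfty wH pa pd j; have [va _] := vH; have [B B0 vB] := Hinfty_bound vH.
  have [vd _] := gauge_bounded G va B0 vB.
  apply: (gauge_norm_le G jd vd C0); apply: (gauge_scale G ja va C0) => z zd.
  rewrite iter_wcomp modulusM mulrC ler_wpM2r ?modulus_ge0//.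
  by apply: fC; exact: iter_self_map.
have null f (C : R) : analytic_on_disk f -> 0 <= C ->
    (forall z, disk z -> modulus (f z) <= C) ->
    orbit_mean (wcomp w phi) (gauge_norm Phi) f \o N_ @ \oo --> 0.
  move=> fa C0 fC.
  have H : (fun k => C * weight_mean Phi w phi (N_ k)) @ \oo --> 0.
    by have := cvgM (cvg_cst C) wm0; rewrite mulr0; exact.
  apply: (squeeze_cvgr _ (cvg_cst 0) H); apply: nearW => k; apply/andP; split.
    by apply: orbit_mean_ge0 => g; exact: gauge_norm_ge0.
  exact: meanE.
have rat_poly_bounded s : exists2 C : R, 0 <= C &
    forall z, disk z -> modulus (rat_poly s z) <= C.
  have bB n : (n < size s)%N ->
      modulus (rat_coef R s n) <= \sum_(i < size s) modulus (rat_coef R s i).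
    move=> ns; rewrite (bigD1 (Ordinal ns))//= lerDl.
    by apply: sumr_ge0 => i _; exact: modulus_ge0.
  have pB := psum_bounded bB.
  eexists; last exact: pB.
  by rewrite mulr_ge0//; apply: sumr_ge0 => i _; exact: modulus_ge0.
have poly_analytic s : analytic_on_disk (@rat_poly R s) by exact: analytic_psum.
pose e0 : R[i] -> R[i] := fun=> 1.
have e0E N : orbit_mean (wcomp w phi) (gauge_norm Phi) e0 N = weight_mean Phi w phi N.
  congr (_ * _); apply: eq_bigr => j _; congr gauge_norm.
  by apply/funext => z; rewrite iter_wcomp mulr1.
have Zd (a : R[i]) f : gauge_dom Phi f -> gauge_dom Phi (fun z => a * f z) /\
    gauge_norm Phi (fun z => a * f z) <= modulus a * gauge_norm Phi f.
  move=> fd; have [fa _] := fd; have aa := @analytic_cst R a.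
  have afa : analytic_on_disk (fun z => a * f z) := @analyticM R (fun=> a) f aa fa.
  have H : (Phi (fun z => (a * f z)%R) <= (modulus a ^+ 2)%:E * Phi f)%E.
    apply: (gauge_scale G afa fa (modulus_ge0 a)) => z _.
    by rewrite modulusM.
  have afd := gauge_dom_le G afa fd H.
  by split=> //; exact: (gauge_norm_le G afd fd (modulus_ge0 a) H).
apply: (@chaos_of_dense_family R _ _ nrm (wcomp w phi) (gauge_norm Phi) N_
  (seq (rat * rat)) (@rat_poly R) e0).
- move=> a f g fd gd; have [afd _] := Zd a f fd.
  exact: (gauge_dom_add G afd gd).
- split.
  + by move=> f /HM[].
  + move=> a f g _ _; apply/funext => z; rewrite /wcomp /= !fctE.
    by rewrite mulrDr; congr (_ + _); exact: mulrCA.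
  exists M => f fd; have [Td le] := HM f fd.
  by rewrite (nE _ fd) (nE _ Td) -EFinM lee_fin.
- exact: nE.
- by move=> f; exact: gauge_norm_ge0.
- by move=> f g; exact: (gauge_norm_add G).
- by move=> a f fd; have [] := Zd a f fd.
- by move=> s; have [C C0 sC] := rat_poly_bounded s; have [] := gauge_bounded G (poly_analytic s) C0 sC.
- exact: gauge_dom_one.
- exact: kN.
- move=> s; have [C C0 sC] := rat_poly_bounded s.
  exact: (null (rat_poly s) C (poly_analytic s) C0 sC).
- have a1 := @analytic_cst R 1.
  have b1 (z : R[i]) : disk z -> modulus (e0 z) <= 1 by rewrite modulus1.
  exact: (null e0 1 a1 ler01 b1).
- by move=> [_ [B HB]]; apply: wmoo; exists B; apply: filterS HB => N; rewrite e0E.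
- by move=> f fd e e_gt0; exact: rat_poly_dense.
Qed.

End WeightedComposition.

Lemma cesaro_weight_mean (R : realType) Phi (nrm : (R[i] -> R[i]) -> \bar R) w phi N :
  gauge Phi -> (forall f, analytic_on_disk f -> nrm f = poweR (Phi f) 2^-1) ->
  Hinfty w -> analytic_on_disk phi -> (forall z, disk z -> disk (phi z)) ->
  cesaro_mean (fun j => nrm (wprod w phi j)) N = (weight_mean Phi w phi N)%:E.
Proof.
move=> G nrmE wH pa pd; rewrite /cesaro_mean /weight_mean EFinM -sumEFin.
congr (_ * _)%E; apply: eq_bigr => j _.
have vH := wprod_Hinfty wH pa pd j; have [va _] := vH; have [B B0 vB] := Hinfty_bound vH.
have [vd _] := gauge_bounded G va B0 vB.
by rewrite (nrmE _ va) (gauge_fin G vd) poweR_EFin powR12_sqrt// fine_gauge_ge0.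
Qed.

(** The finitely many early terms are absorbed by the sum of their absolute values. *)
Lemma ereal_sup_eventually_bounded (R : realType) (u : nat -> R) (D : set nat) (B : R) :
  (\forall n \near \oo, u n <= B) ->
  (ereal_sup [set (u n)%:E | n in D] < +oo)%E.
Proof.
move=> [M _ MB]; apply: (@le_lt_trans _ _ (`|B| + \sum_(i < M) `|u i|)%:E); last exact: ltry.
apply: ge_ereal_sup => _ [n _ <-]; rewrite lee_fin.
have s0 : 0 <= \sum_(i < M) `|u i| by apply: sumr_ge0.
have [Mn|nM] := leqP M n.
  by have := MB _ Mn; have := ler_norm B; lra.
rewrite (bigD1 (Ordinal nM))//=.
have : 0 <= \sum_(i < M | i != Ordinal nM) `|u i| by apply: sumr_ge0.
have := ler_norm (u n); have := normr_ge0 B; lra.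
Qed.

Theorem corollary4 (R : realType) (beta : R) (phi w : R[i] -> R[i])
  (hbeta : -1 < beta)
  (phi_analytic : analytic_on_disk phi)
  (phi_self_map : forall z, disk z -> disk (phi z))
  (hw : Hinfty w)
  (hN : exists N_ : nat -> nat,
      [/\ forall k, (0 < N_ k)%N,
          {homo N_ : k l / (k < l)%N}
        & (fun k => cesaro_mean (fun j => hardy_norm (wprod w phi j)) (N_ k))
            @ \oo --> 0%E])
  (hsup : ereal_sup
      [set cesaro_mean (fun j => bergman_norm beta (wprod w phi j)) N
        | N in [set N : nat | (0 < N)%N]] = +oo%E) :
  densely_mean_Li_Yorke_chaotic (@H2 R) (@hardy_norm R) (wcomp w phi) /\
  densely_mean_Li_Yorke_chaotic (A2 beta) (bergman_norm beta) (wcomp w phi).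
Proof.
have [N_ [_ N_incr cvN]] := hN.
have kN k : (k <= N_ k)%N.
  by elim: k => // k IH; apply: leq_ltn_trans IH _; exact: N_incr.
have HG := hardy_gaugeP R; have BG := bergman_gaugeP hbeta.
have hE := @hardy_norm_gauge R.
have bE f := @bergman_norm_gauge R beta hbeta f.
have hmE N := cesaro_weight_mean N HG hE hw phi_analytic phi_self_map.
have bmE N := cesaro_weight_mean N BG bE hw phi_analytic phi_self_map.
pose hm := weight_mean (@hardy_gauge R) w phi.
pose bm := weight_mean (bergman_gauge beta) w phi.
have hm0 : hm \o N_ @ \oo --> 0.
  have : (fun k => (hm (N_ k))%:E) @ \oo --> 0%E.
    rewrite (_ : (fun k => _) = (fun k => cesaro_mean (fun j => hardy_norm (wprod w phi j)) (N_ k))).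
      exact: cvN.
    by apply/funext => k; rewrite hmE.
  by move=> /fine_cvgP[_ H]; exact: H.
have bmoo : ~ exists B : R, \forall N \near \oo, bm N <= B.
  move=> [B HB]; have := @ereal_sup_eventually_bounded R bm [set N | (0 < N)%N] B HB.
  rewrite (_ : [set _ | _ in _] = [set cesaro_mean
    (fun j => bergman_norm beta (wprod w phi j)) N | N in [set N : nat | (0 < N)%N]]).
    by rewrite hsup ltxx.
  by congr (_ @` _); apply/funext => N; rewrite bmE.
(* The A^2_beta norm of 1, which is the constant comparing the A^2_beta norm with the H^2 norm. *)
pose c := gauge_norm (bergman_gauge beta) (fun=> 1 : R[i]).
have c0 : 0 <= c := gauge_norm_ge0 _ _.
have bm_le N : bm N <= c * hm N.
  rewrite /bm /hm /weight_mean mulrCA; apply: ler_wpM2l; first by rewrite invr_ge0.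
  rewrite mulr_sumr; apply: ler_sum => j _.
  have vH := wprod_Hinfty hw phi_analytic phi_self_map j.
  have [va _] := vH; have [B B0 vB] := Hinfty_bound vH.
  have [vb _] := gauge_bounded BG va B0 vB; have [vh _] := gauge_bounded HG va B0 vB.
  have := bergman_le_hardy_gauge hbeta va (proj2 vh).
  rewrite (gauge_fin BG vb) (gauge_fin HG vh) (gauge_fin BG (gauge_dom_one BG)).
  rewrite -EFinM lee_fin mulrC => H; rewrite /c /gauge_norm -sqrtrM.
    exact: ler_wsqrtr.
  exact: (fine_gauge_ge0 BG).
have bm0 : bm \o N_ @ \oo --> 0.
  have H : (fun k => c * hm (N_ k)) @ \oo --> 0.
    by have := cvgM (cvg_cst c) hm0; rewrite mulr0; exact.
  apply: (squeeze_cvgr _ (cvg_cst 0) H); apply: nearW => k; apply/andP; split.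
    rewrite /bm /weight_mean mulr_ge0 ?invr_ge0//; apply: sumr_ge0 => j _.
    exact: gauge_norm_ge0.
  exact: bm_le.
have hmoo : ~ exists B : R, \forall N \near \oo, hm N <= B.
  move=> [B HB]; apply: bmoo; exists (c * B); apply: filterS HB => N hB.
  by apply: le_trans (bm_le N) _; rewrite ler_wpM2l.
split.
- exact: (wcomp_chaotic HG hE hw phi_analytic phi_self_map kN hm0 hmoo).
- exact: (wcomp_chaotic BG bE hw phi_analytic phi_self_map kN bm0 bmoo).
Qed.
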